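(* Let $(E,C)$ be a finite bipartite separated graph and $\mathbb F$ the free group on $E^1$. (1) For any field with involution $K$, we have $$L^{\mathrm{ab}}_K(E,C)\cong C_K(\Omega(E,C))\rtimes_\alpha\mathbb F$$ as $*$-algebras, where $C_K(\Omega(E,C))$ is the algebra of $K$-valued continuous functions on $\Omega(E,C)$, with $K$ given the discrete topology. (2) We have $$\mathcal O(E,C)\cong C(\Omega(E,C))\rtimes_\alpha\mathbb F,$$ where $C(\Omega(E,C))$ is the C*-algebra of continuous complex functions on $\Omega(E,C)$ and $C(\Omega(E,C))\rtimes_\alpha\mathbb F$ denotes the full C*-algebra crossed product.
   Context: A separated graph is a pair $(E,C)$, where $E=(E^0,E^1,r,s)$ is a directed graph and $C=\bigsqcup_{v\in E^0}C_v$ with $C_v$ a partition of $r^{-1}(v)$ into nonempty subsets ($C_v=\emptyset$ if $r^{-1}(v)=\emptyset$). It is finite if $E^0,E^1$ are finite. It is bipartite if $E^0=E^{0,0}\sqcup E^{0,1}$, all arrows go from $E^{0,1}$ to $E^{0,0}$, $r(E^1)=E^{0,0}$ and $s(E^1)=E^{0,1}$. $L_K(E,C)$ is the $*$-algebra over $K$ with generators $v\in E^0$, $e\in E^1$ and relations: $vv'=\delta_{v,v'}v$, $v=v^*$; $r(e)e=e=es(e)$; $e^*e'=\delta_{e,e'}s(e)$ for $e,e'\in X$, $X\in C$; $v=\sum_{e\in X}ee^*$ for $X\in C_v$, $v\in E^0$. $C^*(E,C)$ is the universal C*-algebra with the same generators and relations. $L^{\mathrm{ab}}_K(E,C)=L_K(E,C)/J$,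 where $J$ is the ideal generated by all commutators $[ww^*,w'w'^*]$ for $w,w'$ in the multiplicative semigroup $U$ generated by $E^1\cup(E^1)^*$. $\mathcal O(E,C)$ is the quotient of $C^*(E,C)$ by the closed ideal generated by the corresponding commutators. Write $\underline w$ for the image of $w\in U$ in the quotient. The space $\Omega(E,C)$ with its partial action: call an $(E,C)$-dynamical system a compact Hausdorff space $\Omega$ with clopen subsets $\Omega_v$ ($v\in E^0$) with $\Omega=\bigsqcup_{v\in E^0}\Omega_v$, for each $v\in E^{0,0}$ clopen subsets $H_x\subseteq\Omega_v$ ($x\in r^{-1}(v)$) with $\Omega_v=\bigsqcup_{x\in X}H_x$ for all $X\in C_v$, and homeomorphisms $\theta_x\colon\Omega_{s(x)}\to H_x$ for all $x\in E^1$. A map $f$ between such systems is equivariant if $f(\Omega_w)\subseteq\Omega'_w$ ($w\in E^0$), $f(H_x)\subseteq H'_x$ and $f\circ\theta_x=\theta'_x\circ f$ on $\Omega_{s(x)}$ ($x\in E^1$). $\Omega(E,C)$ is the zero-dimensional metrizable compact space underlying the universal $(E,C)$-dynamical system, i.e. the one to which every $(E,C)$-dynamical system admits a unique continuous equivariant map (it exists and is unique up to isomorphism; concretely it is the spectrum of the commutative C*-subalgebra $\mathcal B_0$ of $\mathcal O(E,C)$ generated by all projections $\underline w\,\underline w^*$, $w\in U$, with $\Omega_v$, $H_x$ the clopen sets corresponding to the projections $v$, $\underline x\,\underline x^*$, and with $\theta_x(\xi)(b)=\xi(\underline x^*b\underline x)$ for characters $\xi$ with $\xi(s(x))=1$).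 It carries the partial action $\theta$ of $\mathbb F$ given, for a reduced word $g=g_1\cdots g_k$ in letters $x^{\pm1}$, $x\in E^1$, by the composition of partial homeomorphisms $\theta_g=\theta_{g_1}\circ\cdots\circ\theta_{g_k}$ (largest possible domain), $\theta_{x^{-1}}=\theta_x^{-1}$; $\theta_g\colon U_{g^{-1}}\to U_g$ with $U_g$ clopen. The induced partial action $\alpha$ of $\mathbb F$ on $\mathcal B=C_K(\Omega(E,C))$ or $C(\Omega(E,C))$: $\mathcal D_g=1_{U_g}\mathcal B$ and $\alpha_g\colon\mathcal D_{g^{-1}}\to\mathcal D_g$, $\alpha_g(f)=f\circ\theta_{g^{-1}}$ on $U_g$ (zero elsewhere). The algebraic crossed product $\mathcal B\rtimes_\alpha\mathbb F$ is the set of finite formal sums $\sum_ga_g\delta_g$, $a_g\in\mathcal D_g$, with $(a_g\delta_g)(b_h\delta_h)=\alpha_g(\alpha_{g^{-1}}(a_g)b_h)\delta_{gh}$, $(a_g\delta_g)^*=\alpha_{g^{-1}}(a_g^* )\delta_{g^{-1}}$; the full C*-crossed product is its universal C*-completion. *)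

(* Defs.v *)
From HB Require Import structures.
From mathcomp Require Import all_boot all_order all_algebra.
From mathcomp Require Import all_classical all_reals all_analysis.
From mathcomp Require Import complex.
Import numFieldNormedType.Exports.
Import Order.TTheory GRing.Theory Num.Theory.

Set Implicit Arguments.
Unset Strict Implicit.
Unset Printing Implicit Defensive.

Local Open Scope classical_set_scope.
Local Open Scope ring_scope.

Section FreeGroup.
Variable X : choiceType.

(* [(x, true)] is the letter [x] and [(x, false)] the letter [x^-1]. *)
Definition letter := (X * bool)%type.
Implicit Types (l m : letter) (u v w : seq letter).

Definition linv l : letter := (l.1, ~~ l.2).

Definition reduced w : bool := sorted (fun l m => m != linv l) w.

Definition lcons l w : seq letter :=
  if w is m :: w' then if m == linv l then w' else l :: w else [:: l].

Definition wmul u v : seq letter := foldr lcons v u.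
Definition winv w : seq letter := map linv (rev w).

Lemma linvK : involutive linv.
Proof. by case=> x b; rewrite /linv /= negbK. Qed.

Lemma lcons_reduced l w : reduced w -> reduced (lcons l w).
Proof.
case: w => [//|m w] rw /=; case: ifPn => [_|ml]; first exact: path_sorted rw.
by rewrite /= ml.
Qed.

Lemma wmul_reduced u v : reduced v -> reduced (wmul u v).
Proof. by move=> rv; elim: u => //= l u; exact: lcons_reduced. Qed.

Lemma winv_reduced w : reduced w -> reduced (winv w).
Proof.
rewrite /winv map_rev /reduced rev_sorted sorted_map.
apply: sub_sorted => l m; apply: contraNneq => e.
by rewrite [linv l]e linvK.
Qed.

Lemma lconsK l w : reduced w -> lcons (linv l) (lcons l w) = w.
Proof.
case: w => [_|m w] /=; first by rewrite linvK eqxx.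
case: eqP => [->|ml] rw /=; last by rewrite linvK eqxx.
case: w rw => [//|n w] /= /andP[]; rewrite linvK => nl _.
by rewrite (negbTE nl).
Qed.

Lemma wmul_lcons l u v :
  reduced v -> wmul (lcons l u) v = lcons l (wmul u v).
Proof.
move=> rv; case: u => [//|m u] /=; case: eqP => [->|//].
by rewrite -{1}[l]linvK lconsK // wmul_reduced.
Qed.

Lemma wmulA u v w : reduced w -> wmul u (wmul v w) = wmul (wmul u v) w.
Proof.
by move=> rw; elim: u => //= l u IHu; rewrite wmul_lcons // IHu.
Qed.

Lemma wmul0 w : reduced w -> wmul w [::] = w.
Proof.
elim: w => //= l w IHw rw; rewrite IHw; last exact: path_sorted rw.
by case: w rw {IHw} => //= m w /andP[/negbTE->].
Qed.

Lemma wmul_cat u v w : wmul (u ++ v) w = wmul u (wmul v w).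
Proof. by rewrite /wmul foldr_cat. Qed.

Lemma wmulVw w v : reduced v -> wmul (winv w) (wmul w v) = v.
Proof.
elim: w v => //= l w IHw v rv.
rewrite /winv rev_cons map_rcons -cats1 wmul_cat /= lconsK ?wmul_reduced //.
exact: IHw.
Qed.

Lemma winvK : involutive winv.
Proof.
by move=> w; rewrite /winv -map_rev revK mapK //; exact: linvK.
Qed.

Definition freeGroup := {w : seq letter | reduced w}.
HB.instance Definition _ := Choice.on freeGroup.

Definition fg_one : freeGroup := exist _ [::] isT.
Definition fg_mul (g h : freeGroup) : freeGroup :=
  exist _ (wmul (val g) (val h)) (wmul_reduced _ (valP h)).
Definition fg_inv (g : freeGroup) : freeGroup :=
  exist _ (winv (val g)) (winv_reduced (valP g)).

Lemma fg_mulA : associative fg_mul.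
Proof. by move=> f g h; apply: val_inj; rewrite /= wmulA //; exact: valP. Qed.
Lemma fg_mul1 : left_id fg_one fg_mul.
Proof. by move=> g; apply: val_inj. Qed.
Lemma fg_mulg1 : right_id fg_one fg_mul.
Proof. by move=> g; apply: val_inj; rewrite /= wmul0 //; exact: valP. Qed.
Lemma fg_mulV : left_inverse fg_one fg_inv fg_mul.
Proof.
move=> g; apply: val_inj => /=.
by rewrite -{2}(wmul0 (valP g)) wmulVw.
Qed.
Lemma fg_mulgV : right_inverse fg_one fg_inv fg_mul.
Proof.
move=> g; apply: val_inj => /=; rewrite -{1}(winvK (val g)).
have /wmul0 {2}<- := winv_reduced (valP g); exact: wmulVw.
Qed.
HB.instance Definition _ := isGroup.Build freeGroup
  fg_mulA fg_mul1 fg_mulg1 fg_mulV fg_mulgV.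

End FreeGroup.

Record involution (K : fieldType) := Involution {
  invol_fun :> {rmorphism K -> K};
  involK : involutive invol_fun }.

(* No unit is required: the empty graph gives the zero algebra, and C*-algebras *)
(* are not assumed to be unital.                                              *)
Record star_structure (K : fieldType) (c : involution K) (V : lmodType K) :=
  StarStructure {
  ss_mul : V -> V -> V;
  ss_star : V -> V;
  ss_mulA : associative ss_mul;
  ss_mulDl : left_distributive ss_mul +%R;
  ss_mulDr : right_distributive ss_mul +%R;
  ss_mulZl : forall (k : K) x y, ss_mul (k *: x) y = k *: ss_mul x y;
  ss_mulZr : forall (k : K) x y, ss_mul x (k *: y) = k *: ss_mul x y;
  ss_starK : involutive ss_star;
  ss_starD : {morph ss_star : x y / x + y};
  ss_starZ : forall (k : K) x, ss_star (k *: x) = c k *: ss_star x;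
  ss_starM : forall x y, ss_star (ss_mul x y) = ss_mul (ss_star y) (ss_star x)
}.

Record starAlgebra (K : fieldType) (c : involution K) := StarAlgebra {
  sa_car :> lmodType K;
  sa_str : star_structure c sa_car }.

Definition smul K c (A : @starAlgebra K c) : A -> A -> A := ss_mul (sa_str A).
Definition sstar K c (A : @starAlgebra K c) : A -> A := ss_star (sa_str A).
Arguments smul {K c A}.
Arguments sstar {K c A}.
Notation "x ** y" := (smul x y) (at level 40, left associativity) : ring_scope.

Section StarAlgebras.
Variables (K : fieldType) (c : involution K).
Implicit Types A B : starAlgebra c.

Record star_hom A B (f : A -> B) : Prop := StarHom {
  star_hom_lin : linear f;
  star_hom_mul : {morph f : x y / x ** y};
  star_hom_star : {morph f : x / sstar x} }.

(* For C*-algebras this is the usual notion: a bijective *-homomorphism *)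
(* between C*-algebras is isometric.                                   *)
Definition star_isomorphic A B : Prop :=
  exists2 f : A -> B, star_hom f & bijective f.

Record is_ideal A (J : set A) : Prop := IsIdeal {
  sideal0 : J 0;
  sidealP : forall (k : K) x y, J x -> J y -> J (k *: x + y);
  sidealMl : forall a x, J x -> J (a ** x);
  sidealMr : forall a x, J x -> J (x ** a) }.

Definition ideal_gen A (S : set A) : set A :=
  [set x | forall J, is_ideal J -> S `<=` J -> J x].

Inductive subsemigroup A (S : set A) : A -> Prop :=
| Subsemigroup_gen x : S x -> subsemigroup S x
| Subsemigroup_mul x y :
    subsemigroup S x -> subsemigroup S y -> subsemigroup S (x ** y).

Definition range_proj_comm A (U : set A) : set A :=
  [set x | exists w w', [/\ U w, U w' &
     x = (w ** sstar w) ** (w' ** sstar w')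
         - (w' ** sstar w') ** (w ** sstar w)]].

End StarAlgebras.

Section StarQuotient.
Variables (K : fieldType) (c : involution K).

Record setoidStarAlgebra := SetoidStarAlgebra {
  st_car : choiceType;
  st_eqv : st_car -> st_car -> Prop;
  st_zero : st_car;
  st_add : st_car -> st_car -> st_car;
  st_scale : K -> st_car -> st_car;
  st_mul : st_car -> st_car -> st_car;
  st_star : st_car -> st_car;
  st_refl : forall x, st_eqv x x;
  st_sym : forall x y, st_eqv x y -> st_eqv y x;
  st_trans : forall y x z, st_eqv x y -> st_eqv y z -> st_eqv x z;
  st_add_eqv : forall x x' y y', st_eqv x x' -> st_eqv y y' ->
    st_eqv (st_add x y) (st_add x' y');
  st_scale_eqv : forall k x x', st_eqv x x' ->
    st_eqv (st_scale k x) (st_scale k x');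
  st_mul_eqv : forall x x' y y', st_eqv x x' -> st_eqv y y' ->
    st_eqv (st_mul x y) (st_mul x' y');
  st_star_eqv : forall x x', st_eqv x x' -> st_eqv (st_star x) (st_star x');
  st_addA : forall x y z, st_eqv (st_add x (st_add y z)) (st_add (st_add x y) z);
  st_addC : forall x y, st_eqv (st_add x y) (st_add y x);
  st_add0 : forall x, st_eqv (st_add st_zero x) x;
  st_addN : forall x, st_eqv (st_add (st_scale (-1) x) x) st_zero;
  st_scaleA : forall a b x,
    st_eqv (st_scale a (st_scale b x)) (st_scale (a * b) x);
  st_scale1 : forall x, st_eqv (st_scale 1 x) x;
  st_scaleDr : forall a x y,
    st_eqv (st_scale a (st_add x y)) (st_add (st_scale a x) (st_scale a y));
  st_scaleDl : forall x a b,
    st_eqv (st_scale (a + b) x) (st_add (st_scale a x) (st_scale b x));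
  st_mulA : forall x y z, st_eqv (st_mul x (st_mul y z)) (st_mul (st_mul x y) z);
  st_mulDl : forall x y z,
    st_eqv (st_mul (st_add x y) z) (st_add (st_mul x z) (st_mul y z));
  st_mulDr : forall x y z,
    st_eqv (st_mul x (st_add y z)) (st_add (st_mul x y) (st_mul x z));
  st_mulZl : forall k x y,
    st_eqv (st_mul (st_scale k x) y) (st_scale k (st_mul x y));
  st_mulZr : forall k x y,
    st_eqv (st_mul x (st_scale k y)) (st_scale k (st_mul x y));
  st_starK : forall x, st_eqv (st_star (st_star x)) x;
  st_starD : forall x y,
    st_eqv (st_star (st_add x y)) (st_add (st_star x) (st_star y));
  st_starZ : forall k x,
    st_eqv (st_star (st_scale k x)) (st_scale (c k) (st_star x));
  st_starM : forall x y,
    st_eqv (st_star (st_mul x y)) (st_mul (st_star y) (st_star x)) }.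

Variable A : setoidStarAlgebra.

Definition st_rel : rel (st_car A) := fun x y => `[< st_eqv x y >].
Lemma st_rel_refl : reflexive st_rel.
Proof. by move=> x; apply/asboolP; exact: st_refl. Qed.
Lemma st_rel_sym : symmetric st_rel.
Proof.
by move=> x y; apply/asboolP/asboolP; exact: st_sym.
Qed.
Lemma st_rel_trans : transitive st_rel.
Proof.
by move=> y x z /asboolP xy /asboolP yz; apply/asboolP; exact: st_trans xy yz.
Qed.
Definition st_equiv_rel := EquivRel st_rel st_rel_refl st_rel_sym st_rel_trans.
Definition st_quot := {eq_quot st_equiv_rel}%qT.
HB.instance Definition _ := Choice.on st_quot.

Definition st_pi (x : st_car A) : st_quot := (\pi_st_quot x)%qT.

Lemma st_piP x y : st_pi x = st_pi y <-> st_eqv x y.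
Proof.
split; first by move=> /(@eqquotP _ st_equiv_rel) /asboolP.
by move=> xy; apply/(@eqquotP _ st_equiv_rel)/asboolP.
Qed.

Lemma st_reprK x : st_pi (repr x) = x. Proof. exact: reprK. Qed.

Lemma st_repr_eqv x : st_eqv (repr (st_pi x)) x.
Proof. by apply/st_piP; rewrite st_reprK. Qed.

Definition sq_zero : st_quot := st_pi (st_zero A).
Definition sq_add (x y : st_quot) : st_quot := st_pi (st_add (repr x) (repr y)).
Definition sq_scale k (x : st_quot) : st_quot := st_pi (st_scale k (repr x)).
Definition sq_opp := sq_scale (-1).
Definition sq_mul (x y : st_quot) : st_quot := st_pi (st_mul (repr x) (repr y)).
Definition sq_star (x : st_quot) : st_quot := st_pi (st_star (repr x)).

Lemma sq_addE x y : sq_add (st_pi x) (st_pi y) = st_pi (st_add x y).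
Proof. by apply/st_piP/st_add_eqv; exact: st_repr_eqv. Qed.
Lemma sq_scaleE k x : sq_scale k (st_pi x) = st_pi (st_scale k x).
Proof. by apply/st_piP/st_scale_eqv; exact: st_repr_eqv. Qed.
Lemma sq_mulE x y : sq_mul (st_pi x) (st_pi y) = st_pi (st_mul x y).
Proof. by apply/st_piP/st_mul_eqv; exact: st_repr_eqv. Qed.
Lemma sq_starE x : sq_star (st_pi x) = st_pi (st_star x).
Proof. by apply/st_piP/st_star_eqv; exact: st_repr_eqv. Qed.

Lemma st_quotP (P : st_quot -> Prop) : (forall x, P (st_pi x)) -> forall x, P x.
Proof. by move=> Ppi x; rewrite -[x]st_reprK. Qed.

Let sqE := (sq_addE, sq_scaleE, sq_mulE, sq_starE).

Lemma sq_addA : associative sq_add.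
Proof.
elim/st_quotP=> x; elim/st_quotP=> y; elim/st_quotP=> z.
by rewrite !sqE; apply/st_piP/st_addA.
Qed.
Lemma sq_addC : commutative sq_add.
Proof.
by elim/st_quotP=> x; elim/st_quotP=> y; rewrite !sqE; apply/st_piP/st_addC.
Qed.
Lemma sq_add0 : left_id sq_zero sq_add.
Proof. by elim/st_quotP=> x; rewrite !sqE; apply/st_piP/st_add0. Qed.
Lemma sq_addN : left_inverse sq_zero sq_opp sq_add.
Proof. by elim/st_quotP=> x; rewrite /sq_opp !sqE; apply/st_piP/st_addN. Qed.
HB.instance Definition _ :=
  GRing.isZmodule.Build st_quot sq_addA sq_addC sq_add0 sq_addN.

Lemma sq_scaleA a b v : sq_scale a (sq_scale b v) = sq_scale (a * b) v.
Proof. by elim/st_quotP: v => x; rewrite !sqE; apply/st_piP/st_scaleA. Qed.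
Lemma sq_scale1 : left_id 1 sq_scale.
Proof. by elim/st_quotP=> x; rewrite !sqE; apply/st_piP/st_scale1. Qed.
Lemma sq_scaleDr : right_distributive sq_scale +%R.
Proof.
move=> a; elim/st_quotP=> x; elim/st_quotP=> y.
by rewrite /GRing.add /= !sqE; apply/st_piP/st_scaleDr.
Qed.
Lemma sq_scaleDl v : {morph sq_scale^~ v : a b / a + b}.
Proof.
elim/st_quotP: v => x a b.
by rewrite [in RHS]/GRing.add /= !sqE; apply/st_piP/st_scaleDl.
Qed.
HB.instance Definition _ := GRing.Zmodule_isLmodule.Build K st_quot
  sq_scaleA sq_scale1 sq_scaleDr sq_scaleDl.

Lemma sq_mulA : associative sq_mul.
Proof.
elim/st_quotP=> x; elim/st_quotP=> y; elim/st_quotP=> z.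
by rewrite !sqE; apply/st_piP/st_mulA.
Qed.
Lemma sq_mulDl : left_distributive sq_mul +%R.
Proof.
elim/st_quotP=> x; elim/st_quotP=> y; elim/st_quotP=> z.
by rewrite /GRing.add /= !sqE; apply/st_piP/st_mulDl.
Qed.
Lemma sq_mulDr : right_distributive sq_mul +%R.
Proof.
elim/st_quotP=> x; elim/st_quotP=> y; elim/st_quotP=> z.
by rewrite /GRing.add /= !sqE; apply/st_piP/st_mulDr.
Qed.
Lemma sq_mulZl (k : K) (x y : st_quot) : sq_mul (k *: x) y = k *: sq_mul x y.
Proof.
elim/st_quotP: x => x; elim/st_quotP: y => y.
by rewrite /GRing.scale /= !sqE; apply/st_piP/st_mulZl.
Qed.
Lemma sq_mulZr (k : K) (x y : st_quot) : sq_mul x (k *: y) = k *: sq_mul x y.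
Proof.
elim/st_quotP: x => x; elim/st_quotP: y => y.
by rewrite /GRing.scale /= !sqE; apply/st_piP/st_mulZr.
Qed.
Lemma sq_starK : involutive sq_star.
Proof. by elim/st_quotP=> x; rewrite !sqE; apply/st_piP/st_starK. Qed.
Lemma sq_starD : {morph sq_star : x y / x + y}.
Proof.
elim/st_quotP=> x; elim/st_quotP=> y.
by rewrite /GRing.add /= !sqE; apply/st_piP/st_starD.
Qed.
Lemma sq_starZ (k : K) (x : st_quot) : sq_star (k *: x) = c k *: sq_star x.
Proof.
elim/st_quotP: x => x.
by rewrite /GRing.scale /= !sqE; apply/st_piP/st_starZ.
Qed.
Lemma sq_starM x y : sq_star (sq_mul x y) = sq_mul (sq_star y) (sq_star x).
Proof.
elim/st_quotP: x => x; elim/st_quotP: y => y.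
by rewrite !sqE; apply/st_piP/st_starM.
Qed.

Definition setoid_quotient : starAlgebra c :=
  @StarAlgebra K c st_quot (StarStructure sq_mulA sq_mulDl sq_mulDr sq_mulZl
    sq_mulZr sq_starK sq_starD sq_starZ sq_starM).

End StarQuotient.

Section IdealQuotient.
Variables (K : fieldType) (c : involution K) (A : starAlgebra c).
Implicit Types (x y z : A) (S : set A).

Lemma ideal_gen_ideal S : is_ideal (ideal_gen S).
Proof.
split=> [J [] //|k x y Jx Jy J iJ SJ|a x Jx J iJ SJ|a x Jx J iJ SJ].
- by apply: (sidealP iJ); [exact: Jx | exact: Jy].
- by apply: (sidealMl iJ); exact: Jx.
- by apply: (sidealMr iJ); exact: Jx.
Qed.

Lemma smulA : associative (@smul K c A). Proof. exact: ss_mulA. Qed.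
Lemma smulDl : left_distributive (@smul K c A) +%R. Proof. exact: ss_mulDl. Qed.
Lemma smulDr : right_distributive (@smul K c A) +%R. Proof. exact: ss_mulDr. Qed.
Lemma smulZl k x y : (k *: x) ** y = k *: (x ** y). Proof. exact: ss_mulZl. Qed.
Lemma smulZr k x y : x ** (k *: y) = k *: (x ** y). Proof. exact: ss_mulZr. Qed.
Lemma sstarK : involutive (@sstar K c A). Proof. exact: ss_starK. Qed.
Lemma sstarD : {morph (@sstar K c A) : x y / x + y}. Proof. exact: ss_starD. Qed.
Lemma sstarZ k x : sstar (k *: x) = c k *: sstar x. Proof. exact: ss_starZ. Qed.
Lemma sstarM x y : sstar (x ** y) = sstar y ** sstar x.
Proof. exact: ss_starM. Qed.
Lemma sstarN x : sstar (- x) = - sstar x.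
Proof. by rewrite -scaleN1r sstarZ rmorphN1 scaleN1r. Qed.
Lemma sstarB x y : sstar (x - y) = sstar x - sstar y.
Proof. by rewrite sstarD sstarN. Qed.
Lemma smulBl x y z : (x - y) ** z = x ** z - y ** z.
Proof. by rewrite smulDl -scaleN1r smulZl scaleN1r. Qed.
Lemma smulBr x y z : z ** (x - y) = z ** x - z ** y.
Proof. by rewrite smulDr -scaleN1r smulZr scaleN1r. Qed.

Lemma sidealD J x y : is_ideal J -> J x -> J y -> J (x + y).
Proof. by move=> iJ Jx Jy; rewrite -[x]scale1r; exact: sidealP. Qed.
Lemma sidealZ J k x : is_ideal J -> J x -> J (k *: x).
Proof. by move=> iJ Jx; rewrite -[_ *: _]addr0; apply: sidealP => //; exact: sideal0. Qed.
Lemma sidealN J x : is_ideal J -> J x -> J (- x).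
Proof. by move=> iJ Jx; rewrite -scaleN1r; exact: sidealZ. Qed.

Lemma ideal_gen_star S : (forall x, S x -> S (sstar x)) ->
  forall x, ideal_gen S x -> ideal_gen S (sstar x).
Proof.
move=> Sstar x Jx J iJ SJ; apply: (Jx [set y | J (sstar y)]).
  split=> /= [|k y z Jy Jz|a y Jy|a y Jy].
  - by rewrite -(subrr 0) sstarB subrr; exact: sideal0 iJ.
  - by rewrite sstarD sstarZ; exact: sidealP.
  - by rewrite sstarM; exact: sidealMr.
  - by rewrite sstarM; exact: sidealMl.
by move=> y Sy /=; exact/SJ/Sstar.
Qed.

Lemma range_proj_comm_star (U : set A) x :
  range_proj_comm U x -> range_proj_comm U (sstar x).
Proof.
move=> [w [w' [Uw Uw' ->]]]; exists w', w; split => //.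
by rewrite sstarB !sstarM !sstarK.
Qed.

Variables (S : set A) (Sstar : forall x, S x -> S (sstar x)).
Let J := ideal_gen S.
Let iJ : is_ideal J := ideal_gen_ideal S.
Let eqv x y := J (x - y).

Let eqvxx x y : x = y -> eqv x y.
Proof. by move=> ->; rewrite /eqv subrr; exact: sideal0. Qed.
Let eqv_sym x y : eqv x y -> eqv y x.
Proof. by rewrite /eqv -[y - x]opprB; exact: (sidealN iJ). Qed.
Let eqv_trans y x z : eqv x y -> eqv y z -> eqv x z.
Proof.
move=> xy yz; have -> : eqv x z = J ((x - y) + (y - z)).
  by rewrite addrA subrK.
exact: (sidealD iJ).
Qed.
Let eqvD x x' y y' : eqv x x' -> eqv y y' -> eqv (x + y) (x' + y').
Proof. by move=> xx yy; rewrite /eqv opprD addrACA; exact: (sidealD iJ). Qed.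
Let eqvZ k x x' : eqv x x' -> eqv (k *: x) (k *: x').
Proof. by move=> xx; rewrite /eqv -scalerBr; exact: (sidealZ _ iJ). Qed.
Let eqvM x x' y y' : eqv x x' -> eqv y y' -> eqv (x ** y) (x' ** y').
Proof.
move=> xx yy; apply: (@eqv_trans (x' ** y)).
- by rewrite /eqv -smulBl; exact: (sidealMr iJ).
- by rewrite /eqv -smulBr; exact: (sidealMl iJ).
Qed.
Let eqv_star x x' : eqv x x' -> eqv (sstar x) (sstar x').
Proof. by move=> xx; rewrite /eqv -sstarB; exact: (ideal_gen_star Sstar). Qed.

Definition ideal_setoid : setoidStarAlgebra c.
Proof.
apply: (@SetoidStarAlgebra K c A eqv 0 +%R *:%R smul sstar) => //.
- by move=> x; exact: eqvxx.
- by move=> x y z; apply: eqvxx; exact: addrA.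
- by move=> x y; apply: eqvxx; exact: addrC.
- by move=> x; apply: eqvxx; exact: add0r.
- by move=> x; apply: eqvxx; rewrite scaleN1r addNr.
- by move=> a b x; apply: eqvxx; exact: scalerA.
- by move=> x; apply: eqvxx; exact: scale1r.
- by move=> a x y; apply: eqvxx; exact: scalerDr.
- by move=> x a b; apply: eqvxx; exact: scalerDl.
- by move=> x y z; apply: eqvxx; exact: smulA.
- by move=> x y z; apply: eqvxx; exact: smulDl.
- by move=> x y z; apply: eqvxx; exact: smulDr.
- by move=> k x y; apply: eqvxx; exact: smulZl.
- by move=> k x y; apply: eqvxx; exact: smulZr.
- by move=> x; apply: eqvxx; exact: sstarK.
- by move=> x y; apply: eqvxx; exact: sstarD.
- by move=> k x; apply: eqvxx; exact: sstarZ.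
- by move=> x y; apply: eqvxx; exact: sstarM.
Defined.

Definition ideal_quotient : starAlgebra c := setoid_quotient ideal_setoid.

Definition ideal_proj (x : A) : ideal_quotient := @st_pi K c ideal_setoid x.

Lemma ideal_proj_hom : star_hom ideal_proj.
Proof.
split=> [k x y|x y|x]; rewrite /ideal_proj; symmetry.
- rewrite /GRing.add/= -[k *: st_pi _]/(sq_scale k (st_pi _)).
  by rewrite sq_scaleE sq_addE.
- exact: sq_mulE.
- exact: sq_starE.
Qed.

Lemma ideal_proj_surj (y : ideal_quotient) : exists x, ideal_proj x = y.
Proof. by exists (repr y); exact: st_reprK. Qed.

Lemma ideal_proj_ker x : ideal_proj x = 0 <-> ideal_gen S x.
Proof.
have -> : ideal_gen S x = J (x - 0) by rewrite subr0.
exact: (@st_piP K c ideal_setoid).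
Qed.

End IdealQuotient.

Inductive star_term (K G : Type) :=
| TGen (g : G)
| TZero
| TAdd (t u : star_term K G)
| TScale (k : K) (t : star_term K G)
| TMul (t u : star_term K G)
| TStar (t : star_term K G).
Arguments TGen {K G}.
Arguments TZero {K G}.

HB.instance Definition _ K G := gen_eqMixin (star_term K G).
HB.instance Definition _ K G := gen_choiceMixin (star_term K G).

Section Presentation.
Variables (K : fieldType) (c : involution K) (G : Type).

Fixpoint eval (A : starAlgebra c) (f : G -> A) (t : star_term K G) : A :=
  match t with
  | TGen g => f g
  | TZero => 0
  | TAdd t u => eval f t + eval f u
  | TScale k t => k *: eval f t
  | TMul t u => eval f t ** eval f u
  | TStar t => sstar (eval f t)
  end.

Variable rel : star_term K G -> star_term K G -> Prop.

Definition satisfies (A : starAlgebra c) (f : G -> A) : Prop :=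
  forall t u, rel t u -> eval f t = eval f u.

(* Two terms are identified when the relations force them to be equal, i.e. *)
(* when they agree in every *-algebra in which the relations hold; see      *)
(* [presented_univ] for the resulting universal property.                   *)
Definition forced (t u : star_term K G) : Prop :=
  forall (A : starAlgebra c) (f : G -> A), satisfies f -> eval f t = eval f u.

Definition presented_setoid : setoidStarAlgebra c.
Proof.
apply: (@SetoidStarAlgebra K c (star_term K G) forced TZero (@TAdd K G)
  (@TScale K G) (@TMul K G) (@TStar K G)).
- by [].
- by move=> t u tu A f rf; rewrite tu.
- by move=> u t v tu uv A f rf; rewrite tu // uv.
- by move=> t t' u u' tt uu A f rf /=; rewrite tt // uu.
- by move=> k t t' tt A f rf /=; rewrite tt.
- by move=> t t' u u' tt uu A f rf /=; rewrite tt // uu.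
- by move=> t t' tt A f rf /=; rewrite tt.
- by move=> t u v A f _ /=; rewrite addrA.
- by move=> t u A f _ /=; rewrite addrC.
- by move=> t A f _ /=; rewrite add0r.
- by move=> t A f _ /=; rewrite scaleN1r addNr.
- by move=> a b t A f _ /=; rewrite scalerA.
- by move=> t A f _ /=; rewrite scale1r.
- by move=> a t u A f _ /=; rewrite scalerDr.
- by move=> t a b A f _ /=; rewrite scalerDl.
- by move=> t u v A f _ /=; rewrite smulA.
- by move=> t u v A f _ /=; rewrite smulDl.
- by move=> t u v A f _ /=; rewrite smulDr.
- by move=> k t u A f _ /=; rewrite smulZl.
- by move=> k t u A f _ /=; rewrite smulZr.
- by move=> t A f _ /=; rewrite sstarK.
- by move=> t u A f _ /=; rewrite sstarD.
- by move=> k t A f _ /=; rewrite sstarZ.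
- by move=> t u A f _ /=; rewrite sstarM.
Defined.

Definition presented : starAlgebra c := setoid_quotient presented_setoid.

Definition presented_gen (g : G) : presented :=
  @st_pi K c presented_setoid (TGen g).

Lemma eval_presented t : eval presented_gen t = @st_pi K c presented_setoid t.
Proof.
elim: t => //= [t -> u ->|k t ->|t -> u ->|t ->].
- exact: (@sq_addE K c presented_setoid).
- exact: (@sq_scaleE K c presented_setoid).
- exact: (@sq_mulE K c presented_setoid).
- exact: (@sq_starE K c presented_setoid).
Qed.

Lemma presented_satisfies : satisfies presented_gen.
Proof.
by move=> t u tu; rewrite !eval_presented; apply/st_piP => A f; exact.
Qed.

Lemma eval_hom (A B : starAlgebra c) (f : G -> A) (h : A -> B) t :
  star_hom h -> eval (h \o f) t = h (eval f t).
Proof.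
move=> hh; have h0 : h 0 = 0.
  by rewrite -(subrr 0) -scaleN1r addrC (star_hom_lin hh) scaleN1r addNr.
elim: t => //= [t -> u ->|k t ->|t -> u ->|t ->].
- by rewrite -[eval f t in RHS]scale1r (star_hom_lin hh) scale1r.
- by rewrite -[k *: eval f t]addr0 (star_hom_lin hh) h0 addr0.
- by rewrite (star_hom_mul hh).
- by rewrite (star_hom_star hh).
Qed.

Lemma presented_univ (A : starAlgebra c) (f : G -> A) : satisfies f ->
  exists! h : presented -> A, star_hom h /\ forall g, h (presented_gen g) = f g.
Proof.
move=> rf; pose h (x : presented) : A := eval f (repr (x : st_quot _)).
have hE t : h (@st_pi K c presented_setoid t) = eval f t.
  exact: (@st_repr_eqv K c presented_setoid t) rf.
have hE' t : h (eval presented_gen t) = eval f t by rewrite eval_presented hE.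
exists h; split; first split; first split.
- move=> k; elim/(@st_quotP K c presented_setoid) => t.
  elim/(@st_quotP K c presented_setoid) => u.
  rewrite -!eval_presented; apply: etrans (hE' (TAdd (TScale k t) u)) _.
  by rewrite /= !hE'.
- elim/(@st_quotP K c presented_setoid) => t.
  elim/(@st_quotP K c presented_setoid) => u.
  rewrite -!eval_presented; apply: etrans (hE' (TMul t u)) _.
  by rewrite /= !hE'.
- elim/(@st_quotP K c presented_setoid) => t.
  rewrite -!eval_presented; apply: etrans (hE' (TStar t)) _.
  by rewrite /= !hE'.
- by move=> g; rewrite hE.
move=> h' [hh' h'g]; apply/funext.
elim/(@st_quotP K c presented_setoid) => t.
rewrite hE -eval_presented -eval_hom //; congr eval.
by apply/funext => g /=; rewrite h'g.
Qed.

End Presentation.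

Record sepGraph := SepGraph {
  sg_V : finType;
  sg_E : finType;
  sg_r : sg_E -> sg_V;
  sg_s : sg_E -> sg_V;
  sg_C : sg_V -> {set {set sg_E}};
  sg_partition : forall v, finset.partition (sg_C v) [set e | sg_r e == v]%SET }.

Definition bipartite (E : sepGraph) : Prop :=
  exists V0 V1 : {set sg_V E},
    [/\ V0 :|: V1 = [set: sg_V E]%SET, V0 :&: V1 = finset.set0,
        [set sg_r e | e : sg_E E]%SET = V0
      & [set sg_s e | e : sg_E E]%SET = V1].

Section GraphRelations.
Variables (E : sepGraph) (K : fieldType).

Definition ec_gen := (sg_V E + sg_E E)%type.
Local Notation term := (star_term K ec_gen).

Definition ec_v (v : sg_V E) : term := TGen (inl v).
Definition ec_e (e : sg_E E) : term := TGen (inr e).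

Inductive ec_rel : term -> term -> Prop :=
| ECvv v v' : ec_rel (TMul (ec_v v) (ec_v v')) (if v == v' then ec_v v else TZero)
| ECvstar v : ec_rel (ec_v v) (TStar (ec_v v))
| ECre e : ec_rel (TMul (ec_v (sg_r e)) (ec_e e)) (ec_e e)
| ECes e : ec_rel (TMul (ec_e e) (ec_v (sg_s e))) (ec_e e)
| ECee v X e e' : X \in sg_C v -> e \in X -> e' \in X ->
    ec_rel (TMul (TStar (ec_e e)) (ec_e e'))
           (if e == e' then ec_v (sg_s e) else TZero)
| ECsum v X : X \in sg_C v ->
    ec_rel (ec_v v)
           (\big[@TAdd K ec_gen/TZero]_(e in X) TMul (ec_e e) (TStar (ec_e e))).

Variable c : involution K.

(* The commutators [ww^*, w'w'^*], with w and w' in the semigroup generated *)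
(* by the edges and their adjoints.                                         *)
Definition ec_comm (A : starAlgebra c) (f : ec_gen -> A) : set A :=
  range_proj_comm (subsemigroup
    [set x | exists e, x = f (inr e) \/ x = sstar (f (inr e))]).

Lemma ec_comm_star (A : starAlgebra c) (f : ec_gen -> A) x :
  ec_comm f x -> ec_comm f (sstar x).
Proof. exact: range_proj_comm_star. Qed.

Definition leavitt : starAlgebra c := presented c ec_rel.
Definition leavitt_gen : ec_gen -> leavitt := @presented_gen K c ec_gen ec_rel.
Definition leavitt_ab : starAlgebra c :=
  ideal_quotient (@ec_comm_star leavitt leavitt_gen).

End GraphRelations.

Section Dynamics.
Variable E : sepGraph.

(* The clopen sets H_x and the decompositions of Omega_v are stated for all *)
(* vertices v: only those of r(E^1) carry edges or blocks. [ds_thV x] is    *)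
(* the inverse of [ds_th x : Omega_(s x) -> H_x]; the values of these maps  *)
(* outside Omega_(s x), resp. H_x, are irrelevant.                          *)
Record dynSystem := DynSystem {
  ds_space :> topologicalType;
  ds_compact : compact [set: ds_space];
  ds_hausdorff : hausdorff_space ds_space;
  ds_V : sg_V E -> set ds_space;
  ds_V_clopen : forall v, clopen (ds_V v);
  ds_V_cover : \bigcup_v ds_V v = [set: ds_space];
  ds_V_disj : trivIset [set: sg_V E] ds_V;
  ds_H : sg_E E -> set ds_space;
  ds_H_clopen : forall x, clopen (ds_H x);
  ds_H_sub : forall x, ds_H x `<=` ds_V (sg_r x);
  ds_H_cover : forall v X, X \in sg_C v -> \bigcup_(x in [set` X]) ds_H x = ds_V v;
  ds_H_disj : forall v X, X \in sg_C v -> trivIset [set` X] ds_H;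
  ds_th : sg_E E -> ds_space -> ds_space;
  ds_thV : sg_E E -> ds_space -> ds_space;
  ds_th_cont : forall x, {within ds_V (sg_s x), continuous (ds_th x)};
  ds_thV_cont : forall x, {within ds_H x, continuous (ds_thV x)};
  ds_th_fun : forall x w, ds_V (sg_s x) w -> ds_H x (ds_th x w);
  ds_thV_fun : forall x w, ds_H x w -> ds_V (sg_s x) (ds_thV x w);
  ds_thK : forall x w, ds_V (sg_s x) w -> ds_thV x (ds_th x w) = w;
  ds_thVK : forall x w, ds_H x w -> ds_th x (ds_thV x w) = w }.

Record equivariant (S S' : dynSystem) (f : S -> S') : Prop := Equivariant {
  equi_V : forall v, f @` ds_V v `<=` ds_V v;
  equi_H : forall x, f @` ds_H x `<=` ds_H x;
  equi_th : forall x w, ds_V (sg_s x) w -> f (ds_th x w) = ds_th x (f w) }.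

Definition universal_system (S : dynSystem) : Prop :=
  forall S' : dynSystem, exists! f : S' -> S, continuous f /\ equivariant f.

Variable S : dynSystem.
Local Notation F := (freeGroup (sg_E E)).
Implicit Types (g h : F) (w : S) (l : letter (sg_E E)).

Definition theta_letter l w : option S :=
  if l.2 then (if `[< ds_V (sg_s l.1) w >] then Some (ds_th l.1 w) else None)
  else (if `[< ds_H l.1 w >] then Some (ds_thV l.1 w) else None).

(* Composition of the partial maps attached to the letters, on its largest *)
(* possible domain; the rightmost letter acts first.                       *)
Definition theta_word (u : seq (letter (sg_E E))) w : option S :=
  foldr (fun l ow => obind (theta_letter l) ow) (Some w) u.

Definition theta g w : option S := theta_word (val g) w.

Definition theta_range g : set S := [set w | exists w', theta g w' = Some w].

Lemma theta_letterV l w w' :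
  theta_letter l w = Some w' -> theta_letter (linv l) w' = Some w.
Proof.
case: l => x [] /=; rewrite /theta_letter /=.
  case: asboolP => // Vw [<-]; case: asboolP => [_|[]]; first by rewrite ds_thK.
  exact: ds_th_fun.
case: asboolP => // Hw [<-]; case: asboolP => [_|[]]; first by rewrite ds_thVK.
exact: ds_thV_fun.
Qed.

Lemma theta_word_lcons l u w w1 w2 : theta_word u w = Some w1 ->
  theta_letter l w1 = Some w2 -> theta_word (lcons l u) w = Some w2.
Proof.
case: u => [[<-] /= lw|m u] /=; first by rewrite lw.
case: eqP => [-> /=|_ /= -> //=].
case uw: (theta_word u w) => [w0|//] /= /theta_letterV; rewrite linvK => lw1 lw2.
by move: lw1; rewrite lw2.
Qed.

Lemma theta_word_mul u v w w1 w2 : theta_word v w = Some w1 ->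
  theta_word u w1 = Some w2 -> theta_word (wmul u v) w = Some w2.
Proof.
move=> vw; elim: u w2 => [w2 [<-] //|l u IHu w2 /=].
case uw1: (theta_word u w1) => [w3|//] /= lw3.
by apply: theta_word_lcons lw3; exact: IHu.
Qed.

Lemma theta_mul g h w w1 w2 :
  theta h w = Some w1 -> theta g w1 = Some w2 -> theta (g * h)%g w = Some w2.
Proof. exact: theta_word_mul. Qed.

Lemma theta1 w : theta 1%g w = Some w. Proof. by []. Qed.

Lemma theta_wordV u w w' :
  theta_word u w = Some w' -> theta_word (winv u) w' = Some w.
Proof.
elim: u w' => [w' [->] //|l u IHu w' /=].
case uw: (theta_word u w) => [w1|//] /= /theta_letterV lw.
rewrite /winv rev_cons map_rcons -cats1 /theta_word foldr_cat /= lw.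
exact: IHu.
Qed.

Lemma thetaV g w w' : theta g w = Some w' -> theta g^-1%g w' = Some w.
Proof. exact: theta_wordV. Qed.

Lemma theta_rangeP g w : theta_range g w <-> theta g^-1%g w.
Proof.
split=> [[w' /thetaV -> //]|].
case gw: (theta _ w) => [w'|//] _; exists w'.
by move/thetaV: gw; rewrite invgK.
Qed.

End Dynamics.

(* A *-algebra of K-valued functions on T, stable under the transport of *)
(* functions along a continuous map defined on a clopen subset.          *)
Record functionAlgebra (T : topologicalType) (K : fieldType) (c : involution K) :=
  FunctionAlgebra {
  fa_mem :> (T -> K) -> Prop;
  fa_const : forall k, fa_mem (fun=> k);
  fa_add : forall f g, fa_mem f -> fa_mem g -> fa_mem (fun w => f w + g w);
  fa_mul : forall f g, fa_mem f -> fa_mem g -> fa_mem (fun w => f w * g w);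
  fa_conj : forall f, fa_mem f -> fa_mem (fun w => c (f w));
  fa_transport : forall (D : set T) (p : T -> T) f, clopen D ->
    {within D, continuous p} -> fa_mem f ->
    fa_mem (fun w => if `[< D w >] then f (p w) else 0) }.

Section CrossedProduct.
Variables (E : sepGraph) (S : dynSystem E) (K : fieldType) (c : involution K).
Variable B : functionAlgebra S c.
Local Notation F := (freeGroup (sg_E E)).
Implicit Types (g h k : F) (f : S -> K) (w : S).

(* Defined on all functions; the partial action is its restriction to D_(g^-1). *)
Definition alpha g f : S -> K :=
  fun w => if theta g^-1%g w is Some w' then f w' else 0.

Definition alpha_dom g : set (S -> K) :=
  [set (fun w => (w \in theta_range g)%:R * f w) | f in fa_mem B].

Lemma alpha_mem g f : B f -> B (alpha g f).
Proof.
rewrite /alpha /theta; move: (val _) => u.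
elim: u f => [//|l u IHu] f Bf.
pose f' w := if theta_letter l w is Some w' then f w' else 0.
suff /IHu : B f'.
  congr (fa_mem _ _); apply/funext => w /=.
  by case: (theta_word u w).
rewrite /f'; case: l {f' IHu} => x [].
  have := fa_transport (ds_V_clopen S (sg_s x)) (@ds_th_cont _ _ x) Bf.
  congr (fa_mem _ _); apply/funext => w; rewrite /theta_letter /=.
  by case: asboolP.
have := fa_transport (ds_H_clopen S x) (@ds_thV_cont _ _ x) Bf.
congr (fa_mem _ _); apply/funext => w; rewrite /theta_letter /=.
by case: asboolP.
Qed.

Lemma theta_range_mem g : B (fun w => (w \in theta_range g)%:R).
Proof.
have := alpha_mem g (fa_const B 1); congr (fa_mem _ _); apply/funext => w.
rewrite /alpha; case gw: (theta _ w) => [w'|].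
  by rewrite mem_set //; apply/theta_rangeP; rewrite gw.
by rewrite memNset // => /theta_rangeP; rewrite gw.
Qed.

Lemma alpha_domP g f :
  alpha_dom g f <-> B f /\ forall w, ~~ theta g^-1%g w -> f w = 0.
Proof.
split=> [[b Bb <-]|[Bf f0]].
  split; first exact: fa_mul (theta_range_mem g) Bb.
  move=> w /negP gw; rewrite memNset ?mul0r //.
  by move/theta_rangeP.
exists f => //; apply/funext => w.
have [/f0 ->|gw] := boolP (~~ theta g^-1%g w); first by rewrite mulr0.
by rewrite mem_set ?mul1r //; apply/theta_rangeP/negPn.
Qed.

Definition xp_pred : {pred F -> S -> K^o} := fun a =>
  `[< (forall g, alpha_dom g (a g)) /\ finite_set [set g | a g <> (fun=> 0)] >].

(* [XP a] is the formal sum of the (a g) delta_g, with a g in the domain D_g. *)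
Record xp := XP { xp_val :> F -> S -> K^o; xp_valP : xp_val \in xp_pred }.
HB.instance Definition _ := [isSub for xp_val].
HB.instance Definition _ := [Choice of xp by <:].

Lemma xp_predP (a : F -> S -> K^o) : a \in xp_pred <->
  (forall g, alpha_dom g (a g)) /\ finite_set [set g | a g <> (fun=> 0)].
Proof. by split => [/asboolP|H]; [|apply/asboolP]. Qed.

Lemma xp_submod : submod_closed xp_pred.
Proof.
have B0 : B (fun=> 0) := fa_const B 0.
split.
  apply/xp_predP; split=> [g|]; first by apply/alpha_domP; split.
  by apply: (@sub_finite_set _ _ set0); [by move=> g /=; apply | exact: finite_set0].
move=> k a b /xp_predP[aD af] /xp_predP[bD bf]; apply/xp_predP; split.
  move=> g; have /alpha_domP[Ba a0] := aD g; have /alpha_domP[Bb b0] := bD g.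
  apply/alpha_domP; split.
    exact: fa_add (fa_mul (fa_const B k) Ba) Bb.
  by move=> w gw; rewrite -[LHS]/(k * a g w + b g w) a0 // b0 // mulr0 addr0.
have ab_fin : finite_set ([set g | a g <> (fun=> 0)] `|` [set g | b g <> (fun=> 0)]).
  by rewrite finite_setU.
apply: (sub_finite_set _ ab_fin) => g /= abg.
apply: contrapT => /not_orP[/contrapT ag /contrapT bg]; apply: abg.
apply/funext => w; rewrite -[LHS]/(k * a g w + b g w) ag bg.
by rewrite mulr0 addr0.
Qed.
HB.instance Definition _ :=
  GRing.isSubmodClosed.Build K (F -> S -> K^o) xp_pred xp_submod.
HB.instance Definition _ := [SubChoice_isSubLmodule of xp by <:].

(* Coefficient of the product at delta_k: the sum, over all factorizations *)
(* k = g h, of the coefficients of (a_g delta_g) (b_h delta_h).            *)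
Definition xp_mul_fun (a b : F -> S -> K) : F -> S -> K := fun k w =>
  \sum_(g \in [set: F])
    alpha g (fun w' => alpha g^-1%g (a g) w' * b (g^-1 * k)%g w') w.

Definition xp_star_fun (a : F -> S -> K) : F -> S -> K := fun k =>
  alpha k (fun w => c (a k^-1%g w)).

Lemma alpha_domM g f f' w : alpha_dom g f ->
  alpha g (fun w' => alpha g^-1%g f w' * f' w') w = f w * alpha g f' w.
Proof.
move=> /alpha_domP[_ f0]; rewrite {1 3}/alpha.
case gw: (theta _ w) => [w'|]; last by rewrite mulr0.
by rewrite /alpha (thetaV gw).
Qed.

Lemma xp_mul_funE a b k w : (forall g, alpha_dom g (a g)) ->
  xp_mul_fun a b k w = \sum_(g \in [set: F]) a g w * alpha g (b (g^-1 * k)%g) w.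
Proof. by move=> aD; apply: eq_fsbigr => g _; rewrite alpha_domM. Qed.

Lemma fsum_seq (s : seq F) (G : F -> K) : uniq s ->
  (forall g, g \notin s -> G g = 0) ->
  \sum_(g \in [set: F]) G g = \sum_(g <- s) G g.
Proof.
move=> us G0; rewrite (fsbigE s) //; last by move=> g _; exact: G0.
by apply: eq_bigl => g; rewrite in_setT.
Qed.

Lemma xp_supp (a : F -> S -> K^o) : a \in xp_pred ->
  exists2 s : seq F, uniq s & forall g, g \notin s -> forall w, a g w = 0.
Proof.
move=> /xp_predP[_ /finite_seqP[s sE]]; exists (undup s); first exact: undup_uniq.
move=> g; rewrite mem_undup => gs w.
have : ~ [set` s] g by move=> /= gs'; rewrite gs' in gs.
by rewrite -sE /= => /contrapT ->.
Qed.

Lemma alpha_sum g (s : seq F) (G : F -> S -> K) w :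
  alpha g (fun w => \sum_(h <- s) G h w) w = \sum_(h <- s) alpha g (G h) w.
Proof. by rewrite /alpha; case: (theta _ w) => //; rewrite big1. Qed.

Lemma alpha_mul g f f' w :
  alpha g (fun w => f w * f' w) w = alpha g f w * alpha g f' w.
Proof. by rewrite /alpha; case: (theta _ w) => //; rewrite mulr0. Qed.

Lemma alpha_conj g f w : alpha g (fun w => c (f w)) w = c (alpha g f w).
Proof. by rewrite /alpha; case: (theta _ w) => //; rewrite rmorph0. Qed.

Lemma alpha0 g w : alpha g (fun=> 0) w = 0.
Proof. by rewrite /alpha; case: (theta _ w). Qed.

Lemma alpha_comp g h f f' w : alpha_dom h f ->
  alpha g f w * alpha g (alpha h f') w = alpha g f w * alpha (g * h)%g f' w.
Proof.
move=> /alpha_domP[_ f0]; rewrite /alpha; case gw: (theta g^-1%g w) => [w'|].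
  have [/f0 ->|] := boolP (~~ theta h^-1%g w'); first by rewrite !mul0r.
  case hw: (theta _ w') => [w''|//] _.
  by rewrite invgM (theta_mul gw hw).
by rewrite !mul0r.
Qed.

Lemma fa_sum (s : seq F) (G : F -> S -> K) : (forall g, B (G g)) ->
  B (fun w => \sum_(g <- s) G g w).
Proof.
move=> BG; elim: s => [|g s IHs].
  by have := fa_const B 0; congr (fa_mem _ _); apply/funext => w; rewrite big_nil.
have := fa_add (BG g) IHs; congr (fa_mem _ _); apply/funext => w.
by rewrite big_cons.
Qed.

Lemma xp_mul_closed (a b : F -> S -> K^o) :
  a \in xp_pred -> b \in xp_pred -> (xp_mul_fun a b : F -> S -> K^o) \in xp_pred.
Proof.
move=> aP bP; have [s us s0] := xp_supp aP; have [t ut t0] := xp_supp bP.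
have /xp_predP[aD _] := aP; have /xp_predP[bD _] := bP.
have abE k w : xp_mul_fun a b k w =
    \sum_(g <- s) a g w * alpha g (b (g^-1 * k)%g) w.
  by rewrite xp_mul_funE //; apply: fsum_seq => // g gs; rewrite s0 ?mul0r.
apply/xp_predP; split=> [k|].
  apply/alpha_domP; split.
    have -> : xp_mul_fun a b k =
        fun w => \sum_(g <- s) a g w * alpha g (b (g^-1 * k)%g) w.
      by apply/funext => w; exact: abE.
    apply: fa_sum => g; have /alpha_domP[Ba _] := aD g.
    have /alpha_domP[Bb _] := bD (g^-1 * k)%g.
    exact: fa_mul Ba (alpha_mem _ Bb).
  move=> w kw; rewrite abE big1 // => g _.
  rewrite /alpha; case gw: (theta g^-1%g w) => [w'|]; last by rewrite mulr0.
  have /alpha_domP[_ ->] := bD (g^-1 * k)%g; first by rewrite mulr0.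
  apply: contra kw; case hw: (theta _ w') => [w''|//] _.
  by have := theta_mul gw hw; rewrite -invgM mulVKg => ->.
apply: (@sub_finite_set _ _ [set` [seq (g * h)%g | g <- s, h <- t]]); last first.
  exact: finite_seq.
move=> k /= abk; apply: contrapT => /negP kst; apply: abk.
apply/funext => w; rewrite abE big_seq big1 // => g gs.
have -> : b (g^-1 * k)%g = fun=> 0.
  apply/funext => w'; apply: t0; apply: contra kst => gkt.
  by apply/allpairsP; exists (g, g^-1 * k)%g; rewrite /= mulVKg.
by rewrite alpha0 mulr0.
Qed.

Lemma xp_star_closed (a : F -> S -> K^o) :
  a \in xp_pred -> (xp_star_fun a : F -> S -> K^o) \in xp_pred.
Proof.
move=> aP; have [s us s0] := xp_supp aP; have /xp_predP[aD _] := aP.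
apply/xp_predP; split=> [k|].
  apply/alpha_domP; split.
    by apply: alpha_mem; apply: fa_conj; have /alpha_domP[] := aD k^-1%g.
  by move=> w; rewrite /xp_star_fun /alpha; case: (theta _ w).
apply: (@sub_finite_set _ _ [set` [seq g^-1%g | g <- s]]); last exact: finite_seq.
move=> k /= ak; apply: contrapT => /negP ks; apply: ak.
apply/funext => w; rewrite /xp_star_fun.
have -> : (fun w => c (a k^-1%g w)) = fun=> 0; last by rewrite alpha0.
apply/funext => w'; rewrite s0 ?rmorph0 //; apply: contra ks => ks.
by apply/mapP; exists k^-1%g; rewrite ?invgK.
Qed.

Definition xp_mul (a b : xp) : xp := XP (xp_mul_closed (xp_valP a) (xp_valP b)).
Definition xp_star (a : xp) : xp := XP (xp_star_closed (xp_valP a)).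

Lemma xp_eqP (a b : xp) : (forall g w, a g w = b g w) -> a = b.
Proof.
move=> ab; apply: val_inj; apply/funext => g; apply/funext => w; exact: ab.
Qed.

Lemma xp_domP (a : xp) g : alpha_dom g (a g).
Proof. by have /xp_predP[] := xp_valP a. Qed.

Lemma xpDE (a b : xp) g w : (a + b) g w = a g w + b g w. Proof. by []. Qed.
Lemma xpZE (k : K) (a : xp) g w : (k *: a) g w = k * a g w. Proof. by []. Qed.

Lemma xp_mulE (s : seq F) (a b : xp) k w : uniq s ->
  (forall g, g \notin s -> forall w, a g w = 0) ->
  xp_mul a b k w = \sum_(g <- s) a g w * alpha g (b (g^-1 * k)%g) w.
Proof.
move=> us s0; rewrite -[LHS]/(xp_mul_fun a b k w) xp_mul_funE.
  by apply: fsum_seq => // g gs; rewrite s0 ?mul0r.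
exact: xp_domP.
Qed.

Lemma xp_mulTE (a b : xp) k w :
  xp_mul a b k w = \sum_(g \in [set: F]) a g w * alpha g (b (g^-1 * k)%g) w.
Proof. exact: xp_mul_funE (@xp_domP a). Qed.

Lemma xp_suppU (a b : xp) : exists2 s : seq F, uniq s &
  forall g, g \notin s -> forall w, a g w = 0 /\ b g w = 0.
Proof.
have [s us s0] := xp_supp (xp_valP a); have [t ut t0] := xp_supp (xp_valP b).
exists (undup (s ++ t)); first exact: undup_uniq.
move=> g; rewrite mem_undup mem_cat negb_or => /andP[gs gt] w.
by rewrite s0 ?t0.
Qed.

Lemma xp_mulA : associative xp_mul.
Proof.
move=> a b d; apply: xp_eqP => k w.
have [s us s0] := xp_supp (xp_valP a); have [t ut t0] := xp_supp (xp_valP b).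
have [st ust st0] := xp_supp (xp_valP (xp_mul a b)).
rewrite (xp_mulE _ _ _ us) // xp_mulTE.
transitivity (\sum_(g <- s) \sum_(h \in [set: F])
    a g w * (alpha g (b h) w * alpha (g * h)%g (d ((g * h)^-1 * k)%g) w)).
  apply: eq_bigr => g _; rewrite -mulr_fsumr; congr (_ * _).
  transitivity (\sum_(h <- t) alpha g (b h) w * alpha (g * h)%g (d ((g * h)^-1 * k)%g) w).
    have -> : xp_mul b d (g^-1 * k)%g =
        fun w => \sum_(h <- t) b h w * alpha h (d (h^-1 * (g^-1 * k))%g) w.
      by apply/funext => w'; rewrite (xp_mulE _ _ _ ut).
    rewrite (alpha_sum g t (fun h w => b h w * alpha h (d (h^-1 * (g^-1 * k))%g) w)).
    apply: eq_bigr => h _; rewrite alpha_mul alpha_comp; last exact: xp_domP.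
    by rewrite invgM mulgA.
  apply/esym/fsum_seq => // h ht; have -> : b h = fun=> 0.
    by apply/funext => w'; exact: t0.
  by rewrite alpha0 mul0r.
transitivity (\sum_(g <- s) \sum_(h \in [set: F])
    a g w * (alpha g (b (g^-1 * h)%g) w * alpha h (d (h^-1 * k)%g) w)).
  apply: eq_bigr => g _.
  rewrite (reindex_fsbigT (fun h => g^-1 * h)%g); last first.
    exists (fun h => g * h)%g => h; [exact: mulVKg|exact: mulKg].
  by apply: eq_fsbigr => h _; rewrite mulVKg.
set r := undup [seq (g * h)%g | g <- s, h <- t].
have rP g h : g \in s -> h \notin r -> forall w, alpha g (b (g^-1 * h)%g) w = 0.
  move=> gs hr w'; have -> : b (g^-1 * h)%g = fun=> 0; last exact: alpha0.
  apply/funext => w''; apply: t0; apply: contra hr => ght; rewrite mem_undup.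
  by apply/allpairsP; exists (g, g^-1 * h)%g; rewrite /= mulVKg.
transitivity (\sum_(g <- s) \sum_(h <- r)
    a g w * (alpha g (b (g^-1 * h)%g) w * alpha h (d (h^-1 * k)%g) w)).
  rewrite big_seq [RHS]big_seq; apply: eq_bigr => g gs.
  apply: fsum_seq; first exact: undup_uniq.
  by move=> h hr; rewrite rP // mul0r mulr0.
rewrite exchange_big /=.
have -> : (\sum_(h \in [set: F]) xp_mul a b h w * alpha h (d (h^-1 * k)%g) w) =
    \sum_(h <- r) xp_mul a b h w * alpha h (d (h^-1 * k)%g) w.
  apply: fsum_seq; first exact: undup_uniq.
  move=> h hr; rewrite (xp_mulE _ _ _ us) // big_seq big1 ?mul0r // => g gs.
  by rewrite rP // mulr0.
apply: eq_bigr => h _; rewrite (xp_mulE _ _ _ us) // mulr_suml.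
by apply: eq_bigr => g _; rewrite mulrA.
Qed.

Lemma alphaD g f f' w :
  alpha g (fun w => f w + f' w) w = alpha g f w + alpha g f' w.
Proof. by rewrite /alpha; case: (theta _ w) => //; rewrite addr0. Qed.

Lemma alphaZ g (x : K) f w : alpha g (fun w => x * f w) w = x * alpha g f w.
Proof. by rewrite /alpha; case: (theta _ w) => //; rewrite mulr0. Qed.

Lemma xp_mulDl : left_distributive xp_mul +%R.
Proof.
move=> a b d; apply: xp_eqP => k w; have [s us s0] := xp_suppU a b.
have sa g : g \notin s -> forall w, a g w = 0 by move=> /s0 + w' => /(_ w')[].
have sb g : g \notin s -> forall w, b g w = 0 by move=> /s0 + w' => /(_ w')[].
have sab g : g \notin s -> forall w, (a + b) g w = 0.
  by move=> gs w'; rewrite xpDE sa // sb // addr0.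
rewrite xpDE !(xp_mulE _ _ _ us) //.
by rewrite -big_split; apply: eq_bigr => g _; rewrite xpDE mulrDl.
Qed.

Lemma xp_mulDr : right_distributive xp_mul +%R.
Proof.
move=> a b d; apply: xp_eqP => k w; have [s us s0] := xp_supp (xp_valP a).
rewrite xpDE !(xp_mulE _ _ _ us) // -big_split; apply: eq_bigr => g _.
rewrite /= -mulrDr -alphaD; congr (_ * alpha _ _ _).
Qed.

Lemma xp_mulZl (x : K) (a b : xp) : xp_mul (x *: a) b = x *: xp_mul a b.
Proof.
apply: xp_eqP => k w; have [s us s0] := xp_supp (xp_valP a).
rewrite xpZE !(xp_mulE _ _ _ us) //; last first.
  by move=> g gs w'; rewrite xpZE s0 // mulr0.
by rewrite mulr_sumr; apply: eq_bigr => g _; rewrite xpZE mulrA.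
Qed.

Lemma xp_mulZr (x : K) (a b : xp) : xp_mul a (x *: b) = x *: xp_mul a b.
Proof.
apply: xp_eqP => k w; have [s us s0] := xp_supp (xp_valP a).
rewrite xpZE !(xp_mulE _ _ _ us) // mulr_sumr; apply: eq_bigr => g _.
rewrite mulrCA; congr (_ * _).
exact: (alphaZ g x (b (g^-1 * k)%g) w).
Qed.

Lemma xp_starE (a : xp) k w : xp_star a k w = c (alpha k (a k^-1%g) w).
Proof. by rewrite -alpha_conj. Qed.

Lemma alphaVK g f w : alpha_dom g f -> alpha g (alpha g^-1%g f) w = f w.
Proof.
move=> fD; have /alpha_domP[_ f0] := fD.
rewrite {1}/alpha; case gw: (theta _ w) => [w'|]; last by rewrite f0 // gw.
by rewrite /alpha (thetaV gw).
Qed.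

Lemma xp_starK : involutive xp_star.
Proof.
move=> a; apply: xp_eqP => k w; rewrite xp_starE -alpha_conj.
have -> : (fun w => c (xp_star a k^-1%g w)) = alpha k^-1%g (a k).
  by apply/funext => w'; rewrite xp_starE involK invgK.
apply: alphaVK; exact: xp_domP.
Qed.

Lemma xp_starD : {morph xp_star : a b / a + b}.
Proof.
move=> a b; apply: xp_eqP => k w.
by rewrite xpDE !xp_starE -rmorphD -alphaD.
Qed.

Lemma xp_starZ (x : K) (a : xp) : xp_star (x *: a) = c x *: xp_star a.
Proof.
by apply: xp_eqP => k w; rewrite xpZE !xp_starE -rmorphM -alphaZ.
Qed.

Lemma alpha_starM g h f f' w :
    alpha_dom h f -> alpha_dom (g * h)^-1%g f' ->
  alpha g f w * alpha g (alpha h f') w =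
  alpha (g * h)%g f' w * alpha (g * h)%g (alpha h^-1%g f) w.
Proof.
move=> fD f'D; rewrite alpha_comp // mulrC.
have /alpha_domP[_ f0] := fD; rewrite /alpha.
case ghw: (theta _ w) => [w2|]; last by rewrite !mul0r.
congr (_ * _); rewrite invgK.
case hw: (theta h w2) => [w1|].
  have := thetaV ghw; rewrite invgK => ghw2.
  by have := theta_mul (thetaV hw) ghw2; rewrite mulgK => /thetaV ->.
case gw: (theta g^-1%g w) => [w1|//]; apply: f0; apply/negP.
case hw1: (theta _ w1) => [w3|//] _.
have := theta_mul gw hw1; rewrite -invgM ghw => -[e].
by move: hw1; rewrite -e => /thetaV; rewrite invgK hw.
Qed.

Lemma xp_starM a b : xp_star (xp_mul a b) = xp_mul (xp_star b) (xp_star a).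
Proof.
apply: xp_eqP => k w; have [s us s0] := xp_supp (xp_valP a).
rewrite xp_mulTE (reindex_fsbigT (fun g => k * g)%g); last first.
  by exists (fun g => k^-1 * g)%g => g; [exact: mulKg|exact: mulVKg].
rewrite xp_starE.
have -> : xp_mul a b k^-1%g =
    fun w => \sum_(g <- s) a g w * alpha g (b (g^-1 * k^-1)%g) w.
  by apply/funext => w'; rewrite (xp_mulE _ _ _ us).
rewrite (alpha_sum k s (fun g w => a g w * alpha g (b (g^-1 * k^-1)%g) w)).
rewrite rmorph_sum; apply/esym.
transitivity (\sum_(g \in [set: F])
   c (alpha k (fun w => a g w * alpha g (b (g^-1 * k^-1)%g) w) w)).
  apply: eq_fsbigr => g _; rewrite alpha_mul alpha_starM; first last.
  - by rewrite invgM; exact: xp_domP.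
  - exact: xp_domP.
  rewrite rmorphM xp_starE -invgM; congr (_ * _).
  rewrite -alpha_conj; congr (alpha _ _ _); apply/funext => w'.
  by rewrite xp_starE invgM mulgVK invgK.
apply: fsum_seq => // g gs; have -> : a g = fun=> 0.
  by apply/funext => w'; exact: s0.
by rewrite alpha_mul alpha0 mul0r rmorph0.
Qed.

Definition crossed_product : starAlgebra c :=
  @StarAlgebra K c xp (StarStructure xp_mulA xp_mulDl xp_mulDr xp_mulZl xp_mulZr
    xp_starK xp_starD xp_starZ xp_starM).

End CrossedProduct.

Section ContinuousFunctions.
Variables (T U : topologicalType).

Lemma transport_continuous (D : set T) (p : T -> T) (f : T -> U) (z : U) :
  clopen D -> {within D, continuous p} -> continuous f ->
  continuous (fun w => if `[< D w >] then f (p w) else z).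
Proof.
move=> [oD cD] pc fc w; have [Dw|nDw] := pselect (D w).
  have pw : p @ w --> p w.
    have := pc w; rewrite /continuous_at /= -nbhs_subspace_interior //.
    exact: open_nbhs_nbhs.
  have fpw : (f \o p) @ w --> f (p w) := continuous_comp pw (fc (p w)).
  rewrite /continuous_at /= (asboolT Dw); apply: cvg_trans fpw; apply: near_eq_cvg.
  have : \forall w' \near w, D w' by exact: open_nbhs_nbhs.
  by apply: filterS => w' Dw'; rewrite asboolT.
rewrite /continuous_at /= (asboolF nDw).
have cz : (fun _ : T => z) @ w --> z by exact: cvg_cst.
apply: cvg_trans cz; apply: near_eq_cvg.
have : \forall w' \near w, (~` D) w'.
  by apply: open_nbhs_nbhs; split => //; exact: closed_openC.
by apply: filterS => w' nDw'; rewrite asboolF.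
Qed.

End ContinuousFunctions.

Section DiscreteFunctions.
Variables (T : topologicalType) (K : fieldType) (c : involution K).

Definition discrete_continuous : set (T -> K) :=
  [set f | continuous (f : T -> discrete_topology K)].

Lemma discrete_continuousP (f : T -> K) :
  discrete_continuous f <-> forall w, \forall w' \near w, f w' = f w.
Proof.
split=> [fc w|fw w]; last by apply/discrete_cvg; exact: fw.
by have /discrete_cvg := fc w.
Qed.

Definition functions_discrete : functionAlgebra T c.
Proof.
apply: (@FunctionAlgebra T K c discrete_continuous).
- by move=> k; apply/discrete_continuousP => w; exact: nearW.
- move=> f g /discrete_continuousP fc /discrete_continuousP gc.
  apply/discrete_continuousP => w.
  by apply: filterS2 (fc w) (gc w) => w' -> ->.
- move=> f g /discrete_continuousP fc /discrete_continuousP gc.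
  apply/discrete_continuousP => w.
  by apply: filterS2 (fc w) (gc w) => w' -> ->.
- move=> f /discrete_continuousP fc; apply/discrete_continuousP => w.
  by apply: filterS (fc w) => w' ->.
- move=> D p f clD pc fc.
  exact: (@transport_continuous T (discrete_topology K) D p f 0 clD pc fc).
Defined.

End DiscreteFunctions.

Definition conj_involution (R : realType) : involution R[i] :=
  Involution (@conjCK R[i]).

Section ComplexFunctions.
Variables (T : topologicalType) (R : realType).

Definition functions_complex : functionAlgebra T (conj_involution R).
Proof.
apply: (@FunctionAlgebra T R[i] (conj_involution R)
  [set f : T -> R[i] | continuous (f : T -> (R[i] : numFieldType))]).
- by move=> k w; exact: cvg_cst.
- by move=> f g fc gc w; apply: cvgD; [exact: fc|exact: gc].
- by move=> f g fc gc w; apply: cvgM; [exact: fc|exact: gc].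
- move=> f fc w; apply/cvgrPdist_lt => e e0.
  have /cvgrPdist_lt/(_ e e0) := fc w; apply: filterS => w' /=.
  by rewrite -rmorphB norm_conjC.
- move=> D p f clD pc fc.
  exact: (@transport_continuous T (R[i] : numFieldType) D p f 0 clD pc fc).
Defined.

End ComplexFunctions.

Section CstarAlgebras.
Variable R : realType.

Record cstarAlgebra := CstarAlgebra {
  cs_space : completeNormedModType R[i];
  cs_str : star_structure (conj_involution R) cs_space;
  cs_normM : forall x y : cs_space, `|ss_mul cs_str x y| <= `|x| * `|y|;
  cs_normS : forall x : cs_space, `|ss_mul cs_str (ss_star cs_str x) x| = `|x| ^+ 2 }.

Coercion cstar_star (A : cstarAlgebra) : starAlgebra (conj_involution R) :=
  StarAlgebra (cs_str A).

Definition closed_ideal_gen (A : cstarAlgebra) (S : set A) : set A :=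
  [set x | forall J : set A, is_ideal J -> @closed (cs_space A) J ->
     S `<=` J -> J x].

Definition universal_cstar (G : Type)
    (rel : star_term R[i] G -> star_term R[i] G -> Prop)
    (A : cstarAlgebra) (f : G -> A) : Prop :=
  satisfies rel f /\
  forall (D : cstarAlgebra) (h : G -> D), satisfies rel h ->
    exists! phi : A -> D, star_hom phi /\ forall g, phi (f g) = h g.

(* [q] exhibits [Q] as the quotient of [A] by the closed ideal generated by [S]. *)
(* Nothing is asked of the norm of [Q]: it is determined by its *-algebra.     *)
Definition cstar_quotient (A Q : cstarAlgebra) (S : set A) (q : A -> Q) : Prop :=
  [/\ star_hom q, forall y, exists x, q x = y
    & forall x, q x = 0 <-> closed_ideal_gen S x].

Definition universal_completion (A : starAlgebra (conj_involution R))
    (P : cstarAlgebra) (j : A -> P) : Prop :=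
  star_hom j /\
  forall (D : cstarAlgebra) (h : A -> D), star_hom h ->
    exists! phi : P -> D, star_hom phi /\ forall a, phi (j a) = h a.

End CstarAlgebras.

(* Main.v *)
From HB Require Import structures.
Require Import Defs.
From mathcomp Require Import all_boot all_order all_algebra.
From mathcomp Require Import all_classical all_reals all_analysis.
From mathcomp Require Import complex.
From mathcomp Require Import ring lra.
Import numFieldNormedType.Exports.
Import Order.TTheory GRing.Theory Num.Theory.
Local Open Scope classical_set_scope.
Local Open Scope ring_scope.

(** Consider a representation [f] of the relations of (E, C) in a *-algebra [D]
for which the range projections of words commute; call it tame. A word [u] in
the letters x and x^-1 has a value e_u in [D], and P_u is the product of e_u
and its adjoint. Tameness makes the P_u and the vertices into commuting
idempotents, and gives e_u e_v = P_(uv) e_w with w the product of [u] and [v]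
in the free group ([word_val_mul]). So, apart from the commutative algebra that
the P_u generate, words multiply as elements of the free group, which is the
shape of a crossed product. What has to be shown is that this commutative
algebra is an image of the functions on Omega.

The comparison goes through configurations: truth values for all coordinates,
a coordinate being a vertex v or a word u. A point of Omega has an itinerary,
in which v is true when the point lies in Omega_v and u is true when
theta_u^-1 is defined at it. [cylinder F y] says that a polynomial in the
coordinates takes the values [F] on configurations and [y] when the projections
of [D] are substituted for the coordinates. A configuration is consistent when
F vanishes at it as soon as y = 0, that is, when it is a character of the
commutative algebra. Conjugation by letters shifts consistent configurations,
and they form an (E, C)-dynamical system ([consistent_system]).

Universality of Omega is used twice. Its existence half maps the consistent
system of [D] to Omega, and equivariant maps preserve itineraries, so every
consistent configuration is an itinerary ([itinerary_surj]). As a nonzero [y]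
is detected by a consistent configuration ([cylinder_separate]), [y] depends
only on the function that [F] induces on Omega ([cylinder_inj]). Its uniqueness
half is applied to the crossed product, which is itself tame: the composite of
the itinerary map from Omega to that consistent system with the map back to
Omega must be the identity, so a point is determined by its itinerary
([itinerary_inj]). Cylinder functions therefore separate the points of Omega
and, by compactness, approximate continuous functions ([cylinder_approx]).

Consequently the locally constant functions act in every tame [D], covariantly
with respect to the partial action, and sum a_g delta_g |-> sum rho(a_g) e_g
is a *-homomorphism on the crossed product ([integrated_hom]). For the
universal tame algebra it is inverse to the homomorphism defined by the
generators, which is the first statement.

For the second statement the action rho of cylinder functions has to be
extended to all continuous functions. It is contractive because a real function
h with |h| <= 1 is the real part of the unitary h + i sqrt(1 - h^2), and
unitaries have norm at most one. The same remark, with the square root replaced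
by a fixed point so that no unit is needed, shows that *-homomorphisms of
C*-algebras are bounded ([star_hom_bounded]); hence their kernels are closed and
the quotient O has the expected universal property. The universal properties of
O and of the completion P now give homomorphisms in both directions, and
the uniqueness clauses make them mutually inverse. *)

Set Implicit Arguments.
Unset Strict Implicit.
Unset Printing Implicit Defensive.

Local Notation eval := Defs.eval.

(** * Star algebras and their homomorphisms *)

Section StarAlgebraBasics.
Variables (K : fieldType) (c : involution K) (A : starAlgebra c).
Implicit Types x y z : A.

Lemma smul0l x : 0 ** x = 0.
Proof. by have := smulBl 0 0 x; rewrite !subrr. Qed.

Lemma smul0r x : x ** 0 = 0.
Proof. by have := smulBr 0 0 x; rewrite !subrr. Qed.

Lemma sstar0 : sstar (0 : A) = 0.
Proof. by have := sstarB (0 : A) 0; rewrite !subrr. Qed.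

Lemma smul_suml (I : Type) (s : seq I) (Q : pred I) (G : I -> A) x :
  (\sum_(i <- s | Q i) G i) ** x = \sum_(i <- s | Q i) G i ** x.
Proof.
apply: (big_morph (fun y => y ** x)) => [y z|]; [exact: smulDl | exact: smul0l].
Qed.

Lemma smul_sumr (I : Type) (s : seq I) (Q : pred I) (G : I -> A) x :
  x ** (\sum_(i <- s | Q i) G i) = \sum_(i <- s | Q i) x ** G i.
Proof.
apply: (big_morph (fun y => x ** y)) => [y z|]; [exact: smulDr | exact: smul0r].
Qed.

Lemma sstar_sum (I : Type) (s : seq I) (Q : pred I) (G : I -> A) :
  sstar (\sum_(i <- s | Q i) G i) = \sum_(i <- s | Q i) sstar (G i).
Proof. apply: (big_morph (@sstar K c A)); [exact: sstarD | exact: sstar0]. Qed.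

End StarAlgebraBasics.

Section StarHoms.
Variables (K : fieldType) (c : involution K) (A B C : starAlgebra c).

Lemma star_hom0 (h : A -> B) : star_hom h -> h 0 = 0.
Proof.
move=> hh; rewrite -(subrr 0) -scaleN1r addrC (star_hom_lin hh).
by rewrite scaleN1r addNr.
Qed.

Lemma star_homD (h : A -> B) : star_hom h -> {morph h : x y / x + y}.
Proof.
by move=> hh x y; rewrite -[x in LHS]scale1r (star_hom_lin hh) scale1r.
Qed.

Lemma star_homZ (h : A -> B) (k : K) x : star_hom h -> h (k *: x) = k *: h x.
Proof.
by move=> hh; rewrite -[k *: x]addr0 (star_hom_lin hh) star_hom0 // addr0.
Qed.

Lemma star_homB (h : A -> B) : star_hom h -> {morph h : x y / x - y}.
Proof.
by move=> hh x y; rewrite star_homD // -scaleN1r star_homZ // scaleN1r.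
Qed.

Lemma star_hom_sum (h : A -> B) (I : Type) (s : seq I) (Q : pred I) G :
  star_hom h -> h (\sum_(i <- s | Q i) G i) = \sum_(i <- s | Q i) h (G i).
Proof.
by move=> hh; apply: (big_morph h); [exact: star_homD | exact: star_hom0].
Qed.

Lemma star_hom_comp (h : A -> B) (h' : B -> C) :
  star_hom h -> star_hom h' -> star_hom (h' \o h).
Proof.
move=> hh hh'; split=> [k x y|x y|x] /=.
- by rewrite (star_hom_lin hh) (star_hom_lin hh').
- by rewrite (star_hom_mul hh) (star_hom_mul hh').
- by rewrite (star_hom_star hh) (star_hom_star hh').
Qed.

End StarHoms.

Lemma star_hom_id (K : fieldType) (c : involution K) (A : starAlgebra c) :
  star_hom (@id A).
Proof. by []. Qed.

(** * Tame representations of a separated graph *)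

Section TameRepresentations.
Variables (E : sepGraph) (K : fieldType) (c : involution K).
Local Notation lett := (letter (sg_E E)).
Local Notation word := (seq lett).

Lemma edge_block (x : sg_E E) : exists2 X, X \in sg_C (sg_r x) & x \in X.
Proof.
have /and3P[/eqP covC _ _] := sg_partition (sg_r x).
have : x \in finset.cover (sg_C (sg_r x)) by rewrite covC inE.
by move=> /finset.bigcupP[X XC xX]; exists X.
Qed.

(** Tame representations are those of the quotient by the commutators; the
crossed product, the quotient L^ab and the C*-algebra O are all instances. *)
Record tame (D : starAlgebra c) (f : ec_gen E -> D) : Prop := Tame {
  tame_rel : satisfies (@ec_rel E K) f;
  tame_comm : forall x, ec_comm f x -> x = 0 }.

Definition letter_target (l : lett) : sg_V E := if l.2 then sg_r l.1 else sg_s l.1.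

Fact range_proj_key : unit. Proof. by []. Qed.

Section Words.
Variables (D : starAlgebra c) (f : ec_gen E -> D).

Definition letter_val (l : lett) : D :=
  if l.2 then f (inr l.1) else sstar (f (inr l.1)).

(** The value of the empty word; it acts as a unit on words and projections,
although [D] itself may have no unit. *)
Definition vertex_sum : D := \sum_v f (inl v).

Definition word_val (u : word) : D :=
  foldr (fun l y => letter_val l ** y) vertex_sum u.

(** Locked: otherwise rewriting with associativity unfolds it. *)
Definition range_proj (u : word) : D :=
  locked_with range_proj_key (word_val u ** sstar (word_val u)).

Definition proj_of (i : sg_V E + word) : D :=
  match i with inl v => f (inl v) | inr u => range_proj u end.

End Words.

Lemma range_projE (D : starAlgebra c) (f : ec_gen E -> D) u :
  range_proj f u = word_val f u ** sstar (word_val f u).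
Proof. by rewrite /range_proj unlock. Qed.

Lemma eval_bigTAdd (D : starAlgebra c) (G I : Type) (f : G -> D) (s : seq I)
    (Q : pred I) (t : I -> star_term K G) :
  eval f (\big[@TAdd K G/TZero]_(i <- s | Q i) t i) =
  \sum_(i <- s | Q i) eval f (t i).
Proof. exact: (big_morph (eval f)). Qed.

Lemma word_val_hom (A B : starAlgebra c) (f : ec_gen E -> A) (h : A -> B) u :
  star_hom h -> word_val (h \o f) u = h (word_val f u).
Proof.
move=> hh; elim: u => [|[x b] u IHu] /=.
  by rewrite /vertex_sum star_hom_sum.
rewrite IHu (star_hom_mul hh); congr (_ ** _).
by case: b; rewrite /letter_val //= (star_hom_star hh).
Qed.

Lemma proj_of_hom (A B : starAlgebra c) (f : ec_gen E -> A) (h : A -> B) i :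
  star_hom h -> proj_of (h \o f) i = h (proj_of f i).
Proof.
move=> hh; case: i => [//|u] /=.
by rewrite !range_projE !(word_val_hom _ _ hh) (star_hom_mul hh) (star_hom_star hh).
Qed.

Lemma tame_hom (A B : starAlgebra c) (f : ec_gen E -> A) (h : A -> B) :
  star_hom h -> satisfies (@ec_rel E K) f -> (forall x, ec_comm f x -> h x = 0) ->
  tame (h \o f).
Proof.
move=> hh rf hc; split.
  by move=> t u tu; rewrite !(eval_hom f t hh, eval_hom f u hh); congr h; exact: rf.
have img w : subsemigroup [set x | exists e, x = (h \o f) (inr e) \/
      x = sstar ((h \o f) (inr e))] w ->
    exists2 w', subsemigroup [set x | exists e, x = f (inr e) \/
      x = sstar (f (inr e))] w' & w = h w'.
  elim=> [x [e [->|->]]|x y _ [x' Ux' ->] _ [y' Uy' ->]].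
  - by exists (f (inr e)) => //; apply: Subsemigroup_gen; exists e; left.
  - exists (sstar (f (inr e))); last by rewrite (star_hom_star hh).
    by apply: Subsemigroup_gen; exists e; right.
  - by exists (x' ** y'); [exact: Subsemigroup_mul | rewrite (star_hom_mul hh)].
move=> _ [_ [_ [/img[w Uw ->] /img[w' Uw' ->] ->]]].
rewrite -!(star_hom_star hh) -!(star_hom_mul hh) -star_homB //.
by apply: hc; exists w, w'.
Qed.

Variables (D : starAlgebra c) (f : ec_gen E -> D) (tf : tame f).
Local Notation e_ := (letter_val f).
Local Notation one := (vertex_sum f).
Local Notation wd := (word_val f).
Local Notation P_ := (range_proj f).
Implicit Types (l : lett) (u : word) (v : sg_V E).

Lemma vertexM v v' : f (inl v) ** f (inl v') = if v == v' then f (inl v) else 0.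
Proof. by have /= -> := tame_rel tf (ECvv _ v v'); case: ifP. Qed.

Lemma vertex_star v : sstar (f (inl v)) = f (inl v).
Proof. by have /= <- := tame_rel tf (ECvstar _ v). Qed.

Lemma letter_valV l : e_ (linv l) = sstar (e_ l).
Proof. by case: l => x []; rewrite /letter_val /= ?sstarK. Qed.

Lemma target_letter l : f (inl (letter_target l)) ** e_ l = e_ l.
Proof.
case: l => x []; rewrite /letter_val /letter_target /=.
  exact: (tame_rel tf (ECre _ x)).
by have /= e := tame_rel tf (ECes _ x); rewrite -[in RHS]e sstarM vertex_star.
Qed.

Lemma vertex_letter v l : f (inl v) ** e_ l = if v == letter_target l then e_ l else 0.
Proof.
rewrite -{1}target_letter smulA vertexM; case: eqP => [->|_]; last exact: smul0l.
exact: target_letter.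
Qed.

Lemma vertex_sum_star : sstar one = one.
Proof. by rewrite sstar_sum; apply: eq_bigr => v _; exact: vertex_star. Qed.

Lemma one_vertex v : one ** f (inl v) = f (inl v).
Proof.
rewrite smul_suml (bigD1 v) //= vertexM eqxx big1 ?addr0 // => w wv.
by rewrite vertexM (negbTE wv).
Qed.

Lemma one_letter l : one ** e_ l = e_ l.
Proof. by rewrite -target_letter smulA one_vertex. Qed.

Lemma letter_one l : e_ l ** one = e_ l.
Proof.
by rewrite -[e_ l]sstarK -vertex_sum_star -sstarM -letter_valV one_letter.
Qed.

Lemma one_one : one ** one = one.
Proof. by rewrite {2 3}/vertex_sum smul_sumr; apply: eq_bigr => v _; exact: one_vertex. Qed.

Lemma one_word u : one ** wd u = wd u.
Proof. by case: u => [|l u] /=; rewrite ?one_one // smulA one_letter. Qed.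

Lemma word_one u : wd u ** one = wd u.
Proof. by elim: u => [|l u IHu] /=; rewrite ?one_one // -smulA IHu. Qed.

Lemma word_val_cat u u' : wd (u ++ u') = wd u ** wd u'.
Proof. by elim: u => [|l u IHu] /=; rewrite ?one_word // IHu smulA. Qed.

Lemma word_val1 l : wd [:: l] = e_ l.
Proof. exact: letter_one. Qed.

Lemma word_val_winv u : wd (winv u) = sstar (wd u).
Proof.
elim: u => [|l u IHu]; first by rewrite /= vertex_sum_star.
rewrite /winv rev_cons map_rcons -cats1 word_val_cat -/(winv u) IHu word_val1.
by rewrite letter_valV /= sstarM.
Qed.

Lemma word_semigroup l u : subsemigroup
  [set x | exists e, x = f (inr e) \/ x = sstar (f (inr e))] (wd (l :: u)).
Proof.
elim: u l => [|m u IHu] l.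
  rewrite word_val1; apply: Subsemigroup_gen; exists l.1.
  by rewrite /letter_val; case: l.2; [left | right].
apply: (@Subsemigroup_mul _ _ _ _ (e_ l)); last exact: IHu.
apply: Subsemigroup_gen; exists l.1.
by rewrite /letter_val; case: l.2; [left | right].
Qed.

Lemma range_proj_nil : P_ [::] = one.
Proof. by rewrite range_projE /= vertex_sum_star one_one. Qed.

Lemma range_proj_star u : sstar (P_ u) = P_ u.
Proof. by rewrite range_projE sstarM sstarK. Qed.

Lemma proj_of_star i : sstar (proj_of f i) = proj_of f i.
Proof. by case: i => [v|u]; [exact: vertex_star | exact: range_proj_star]. Qed.

Lemma one_proj i : one ** proj_of f i = proj_of f i.
Proof.
by case: i => [v|u] /=; rewrite ?one_vertex // range_projE smulA one_word.
Qed.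

Lemma proj_one i : proj_of f i ** one = proj_of f i.
Proof. by rewrite -vertex_sum_star -proj_of_star -sstarM one_proj. Qed.

Lemma vertex_word v l u :
  f (inl v) ** wd (l :: u) = if v == letter_target l then wd (l :: u) else 0.
Proof. by rewrite /= smulA vertex_letter; case: ifP; rewrite ?smul0l. Qed.

Lemma vertex_range_proj v l u :
  f (inl v) ** P_ (l :: u) = if v == letter_target l then P_ (l :: u) else 0.
Proof.
by rewrite range_projE smulA vertex_word; case: ifP; rewrite ?smul0l.
Qed.

(** The commutators that tameness kills involve nonempty words only; a vertex
either fixes or annihilates such a word, and the empty word has the vertex sum
as its value, a unit for all projections. *)
Lemma proj_comm i j : proj_of f i ** proj_of f j = proj_of f j ** proj_of f i.
Proof.
have nil_comm k : P_ [::] ** proj_of f k = proj_of f k ** P_ [::].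
  by rewrite range_proj_nil one_proj proj_one.
have vert v k : f (inl v) ** proj_of f k = proj_of f k ** f (inl v).
  case: k => [w|[|l u]] /=; first by rewrite !vertexM eq_sym; case: eqP => // ->.
    by rewrite range_proj_nil one_vertex; have /= -> := proj_one (inl v).
  rewrite -[f (inl v) in RHS]vertex_star -range_proj_star -sstarM.
  by rewrite range_proj_star vertex_range_proj; case: ifP; rewrite ?range_proj_star ?sstar0.
case: i => [v|[|l u]]; [exact: vert | exact: nil_comm|].
case: j => [v|[|l' u']]; [by rewrite vert | by rewrite nil_comm|].
apply/eqP; rewrite -subr_eq0; apply/eqP; apply: (tame_comm tf).
exists (wd (l :: u)), (wd (l' :: u')).
by split; [exact: word_semigroup | exact: word_semigroup | rewrite /= !range_projE].
Qed.

Lemma range_proj_comm u u' : P_ u ** P_ u' = P_ u' ** P_ u.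
Proof. exact: (proj_comm (inr u) (inr u')). Qed.

Lemma range_proj1 l : P_ [:: l] = e_ l ** sstar (e_ l).
Proof. by rewrite range_projE word_val1. Qed.

Lemma range_proj_cons l u : P_ (l :: u) = e_ l ** P_ u ** sstar (e_ l).
Proof. by rewrite !range_projE /= sstarM !smulA. Qed.

Lemma edge_star_edge x : sstar (f (inr x)) ** f (inr x) = f (inl (sg_s x)).
Proof.
have [X XC xX] := edge_block x.
by have /= -> := tame_rel tf (ECee _ XC xX xX); rewrite eqxx.
Qed.

Lemma letter_partial_isometry l : e_ l ** sstar (e_ l) ** e_ l = e_ l.
Proof.
have edge x : f (inr x) ** sstar (f (inr x)) ** f (inr x) = f (inr x).
  by rewrite -smulA edge_star_edge; exact: (tame_rel tf (ECes _ x)).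
case: l => x [] //=; rewrite /letter_val /= ?sstarK //.
by have := congr1 sstar (edge x); rewrite !sstarM sstarK smulA.
Qed.

Lemma word_partial_isometry u : P_ u ** wd u = wd u.
Proof.
elim: u => [|l u IHu]; first by rewrite range_proj_nil one_one.
have -> : P_ (l :: u) ** wd (l :: u) =
    e_ l ** (P_ u ** P_ [:: linv l]) ** wd u.
  by rewrite range_proj_cons range_proj1 letter_valV sstarK /= !smulA.
rewrite range_proj_comm -!smulA IHu /= range_proj1 letter_valV sstarK smulA.
by rewrite smulA letter_partial_isometry.
Qed.

Lemma proj_idem i : proj_of f i ** proj_of f i = proj_of f i.
Proof.
case: i => [v|u] /=; first by rewrite vertexM eqxx.
by rewrite {2}range_projE smulA word_partial_isometry -range_projE.
Qed.

Lemma letter_star_proj l : sstar (e_ l) ** P_ [:: l] = sstar (e_ l).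
Proof.
by rewrite -[P_ _]range_proj_star -sstarM range_proj1 letter_partial_isometry.
Qed.

(** In between the factors stands a range projection, which moves past [y] and
is absorbed by the first letter; so conjugation is a homomorphism on the
commutative algebra generated by the projections. *)
Lemma letter_conjM l y y' : P_ [:: l] ** y = y ** P_ [:: l] ->
  sstar (e_ l) ** (y ** y') ** e_ l =
  (sstar (e_ l) ** y ** e_ l) ** (sstar (e_ l) ** y' ** e_ l).
Proof.
move=> yC.
have -> : sstar (e_ l) ** y ** e_ l ** (sstar (e_ l) ** y' ** e_ l) =
    sstar (e_ l) ** (y ** P_ [:: l]) ** y' ** e_ l.
  by rewrite range_proj1 !smulA.
by rewrite -yC !smulA letter_star_proj.
Qed.

Lemma range_proj_prefix l u : P_ [:: l] ** P_ (l :: u) = P_ (l :: u).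
Proof.
by rewrite range_proj1 range_proj_cons !smulA letter_partial_isometry.
Qed.

Lemma range_proj_prefixC l u : P_ (l :: u) ** P_ [:: l] = P_ (l :: u).
Proof. by rewrite range_proj_comm range_proj_prefix. Qed.

Lemma letter_source l : sstar (e_ l) ** e_ l = P_ [:: linv l].
Proof. by rewrite range_proj1 letter_valV sstarK. Qed.

Lemma range_proj_cancel l u :
  P_ (linv l :: l :: u) = P_ [:: linv l] ** P_ u.
Proof.
transitivity (sstar (e_ l) ** e_ l ** P_ u ** (sstar (e_ l) ** e_ l)).
  by rewrite !range_proj_cons letter_valV sstarK !smulA.
by rewrite letter_source -smulA (range_proj_comm u) smulA (proj_idem (inr _)).
Qed.

Lemma conj_proj_word l u :
  sstar (e_ l) ** P_ u ** e_ l = P_ (linv l :: u).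
Proof. by rewrite range_proj_cons letter_valV sstarK. Qed.

Lemma conj_proj_vertex l v :
  sstar (e_ l) ** f (inl v) ** e_ l =
  if v == letter_target l then P_ [:: linv l] else 0.
Proof.
rewrite -smulA vertex_letter; case: ifP => _; last exact: smul0r.
exact: letter_source.
Qed.

(** Cancelling x^-1 x in a word replaces it by a range projection, and these
projections collect into that of the uncancelled word. *)
Lemma word_val_mul u u' :
  wd u ** wd u' = P_ (u ++ u') ** wd (wmul u u').
Proof.
elim: u => [|l u IHu] /=; first by rewrite one_word word_partial_isometry.
set m := wmul u u' in IHu *.
rewrite -smulA IHu smulA.
have -> : e_ l ** P_ (u ++ u') = P_ (l :: u ++ u') ** e_ l.
  rewrite range_proj_cons -smulA letter_source.
  rewrite -smulA range_proj_comm smulA range_proj1 letter_valV sstarK smulA.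
  by rewrite letter_partial_isometry.
rewrite -smulA; case: m {IHu} => [//|l' m] /=; case: eqP => // -> /=.
rewrite [e_ l ** _]smulA letter_valV -range_proj1 smulA.
by rewrite range_proj_prefixC.
Qed.

End TameRepresentations.

(** * Subspaces of products of discrete spaces *)

Lemma compact_set_type (X : topologicalType) (A : set X) :
  compact A -> compact [set: set_type A].
Proof.
move=> cA F PF _.
have [|p [Ap clp]] := cA (set_val @ F) _.
  by apply: nearW => x; exact: set_valP.
exists (exist _ p (mem_set Ap)); split => // U V FU [W [[B oB <-] Bp] BV].
have [||q [[x Ux <-] Bx]] := clp (set_val @` U) B.
- by apply: (@filterS _ F _ U _ _ FU) => x Ux; exists x.
- exact: open_nbhs_nbhs.
by exists x; split => //; exact: BV.
Qed.

Lemma hausdorff_set_type (X : topologicalType) (A : set X) :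
  hausdorff_space X -> hausdorff_space (set_type A).
Proof.
move=> hX x y clxy; apply: val_inj; apply: hX => U V xU yV.
have [||z [Uz Vz]] := clxy (set_val @^-1` U) (set_val @^-1` V).
- exact: (@initial_continuous _ _ (@set_val _ A)).
- exact: (@initial_continuous _ _ (@set_val _ A)).
by exists (set_val z).
Qed.

Lemma clopen_bool (X : topologicalType) (b : X -> bool) :
  continuous b -> clopen [set x | b x].
Proof.
move=> /continuousP cb; split; first by have := cb [set true] (discrete_open _).
rewrite -[X in closed X]setCK; apply: open_closedC.
have := cb [set false] (discrete_open _); congr open.
by apply/seteqP; split=> x /=; case: (b x).
Qed.

Lemma continuous_product (X : topologicalType) (I : eqType)
    (Y : topologicalType) (g : X -> prod_topology (fun _ : I => Y)) :
  (forall i, continuous (fun x => g x i)) -> continuous g.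
Proof.
move=> cg x; apply/cvg_sup => i.
exact: (@continuous_comp_initial _ _ _ (fun f : I -> Y => f i) g (cg i)).
Qed.

(** Any point of the space makes it a pointed one. *)
Lemma compact_cover_inhabited (X : topologicalType) (x0 : X) (A : set X) :
  compact A -> cover_compact A.
Proof.
pose T : ptopologicalType :=
  HB.pack (X : Type) (Topological.class X) (isPointed.Build X x0).
move=> cA; have : @cover_compact T A by rewrite -(@compact_cover T); exact: cA.
exact.
Qed.

(** * Cylinder functions and consistent configurations *)

Section Cylinders.
Variables (E : sepGraph) (K : fieldType) (c : involution K).
Local Notation lett := (letter (sg_E E)).
Local Notation word := (seq lett).
Local Notation idx := (sg_V E + word)%type.

Definition config := prod_topology (fun _ : idx => bool).
Implicit Types xi : config.

Section Pairs.
Variables (D : starAlgebra c) (f : ec_gen E -> D).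

(** Pairs of a polynomial in the coordinates, as a function, and its value at
the projections of [D]. As a relation it needs no normal form for
polynomials, and it becomes the graph of a function only in [cylinder_inj]. *)
Inductive cylinder : (config -> K) -> D -> Prop :=
| Cylinder_one : cylinder (fun=> 1) (vertex_sum f)
| Cylinder_proj i : cylinder (fun xi => (xi i)%:R) (proj_of f i)
| Cylinder_lin k F y F' y' : cylinder F y -> cylinder F' y' ->
    cylinder (fun xi => k * F xi + F' xi) (k *: y + y')
| Cylinder_mul F y F' y' : cylinder F y -> cylinder F' y' ->
    cylinder (fun xi => F xi * F' xi) (y ** y').

(** The configurations at which evaluation of polynomials factors through [D]:
the {0, 1}-valued characters of the algebra generated by the projections. *)
Definition consistent : set config :=
  [set xi | forall F, cylinder F 0 -> F xi = 0].

Lemma cylinder_eq F F' y y' : F =1 F' -> y = y' -> cylinder F y -> cylinder F' y'.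
Proof. by move=> /funext -> ->. Qed.

Lemma cylinder0 : cylinder (fun=> 0) 0.
Proof.
apply: cylinder_eq (Cylinder_lin (-1) Cylinder_one Cylinder_one).
  by move=> xi; rewrite mulr1 addNr.
by rewrite scaleN1r addNr.
Qed.

Lemma cylinderD F y F' y' : cylinder F y -> cylinder F' y' ->
  cylinder (fun xi => F xi + F' xi) (y + y').
Proof.
move=> Fy Fy'; apply: cylinder_eq (Cylinder_lin 1 Fy Fy').
  by move=> xi; rewrite mul1r.
by rewrite scale1r.
Qed.

Lemma cylinderB F y F' y' : cylinder F y -> cylinder F' y' ->
  cylinder (fun xi => F xi - F' xi) (y - y').
Proof.
move=> Fy Fy'; apply: cylinder_eq (Cylinder_lin (-1) Fy' Fy).
  by move=> xi; rewrite mulN1r addrC.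
by rewrite scaleN1r addrC.
Qed.

Lemma cylinder_sum (I : Type) (s : seq I) (Q : pred I) F y :
  (forall i, cylinder (F i) (y i)) ->
  cylinder (fun xi => \sum_(i <- s | Q i) F i xi) (\sum_(i <- s | Q i) y i).
Proof.
move=> Fy; elim: s => [|i s IHs].
  by apply: cylinder_eq cylinder0 => [xi|]; rewrite big_nil.
case Qi: (Q i); last first.
  by apply: cylinder_eq IHs => [xi|]; rewrite big_cons Qi.
by apply: cylinder_eq (cylinderD (Fy i) IHs) => [xi|]; rewrite big_cons Qi.
Qed.

Lemma consistent_eq xi F F' y : consistent xi ->
  cylinder F y -> cylinder F' y -> F xi = F' xi.
Proof.
move=> cxi Fy Fy'; apply/eqP; rewrite -subr_eq0; apply/eqP.
by apply: (cxi (fun xi => F xi - F' xi)); rewrite -(subrr y); exact: cylinderB.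
Qed.

Lemma config_coord_near (i : idx) xi : \forall xi' \near xi, xi' i = xi i.
Proof. exact: (@proj_continuous idx (fun=> bool) i xi [set b | b = xi i]). Qed.

Lemma cylinder_locally_constant F y xi :
  cylinder F y -> \forall xi' \near xi, F xi' = F xi.
Proof.
elim=> [|i|k {}F {}y F' y' _ near1 _ near2|{}F {}y F' y' _ near1 _ near2].
- by apply: (@nearW _ (nbhs xi)) => xi'.
- by apply: filterS (config_coord_near i xi) => xi' ->.
- by apply: filterS2 near1 near2 => xi' -> ->.
- by apply: filterS2 near1 near2 => xi' -> ->.
Qed.

(** A polynomial involves finitely many coordinates, so it keeps a nonzero value
near an inconsistent configuration. *)
Lemma consistent_closed : closed consistent.
Proof.
rewrite -[consistent]setCK; apply: open_closedC; rewrite openE => xi.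
move=> /existsNP[F /not_implyP[F0 Fxi]]; rewrite /interior.
apply: filterS (cylinder_locally_constant xi F0) => xi' FE cxi'.
by apply: Fxi; rewrite -FE; exact: cxi'.
Qed.

Lemma consistent_compact : compact consistent.
Proof.
apply: (subclosed_compact consistent_closed (B := setT)) => //.
have := @tychonoff idx (fun=> bool) (fun=> setT) (fun=> bool_compact).
by congr compact; apply/seteqP; split.
Qed.

End Pairs.

(** The itinerary of theta_l w in terms of that of w: the coordinate [u] of the
image is the coordinate [linv l :: u] of the source, and the image lies in
the vertex set of the target of [l]. *)
Definition shift_config (l : lett) xi : config := fun i =>
  match i with inl v => v == letter_target l | inr u => xi (inr (linv l :: u)) end.

Lemma shift_continuous l : continuous (shift_config l).
Proof.
apply: continuous_product => -[v|u]; first by move=> xi; exact: cvg_cst.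
exact: (@proj_continuous idx (fun=> bool)).
Qed.

Variables (D : starAlgebra c) (f : ec_gen E -> D) (tf : tame f).
Local Notation e_ := (letter_val f).
Local Notation P_ := (proj_of f).
Local Notation cyl := (cylinder f).

Lemma cylinder_comm F y i : cyl F y -> P_ i ** y = y ** P_ i.
Proof.
elim=> [|j|k {}F {}y F' y' _ C1 _ C2|{}F {}y F' y' _ C1 _ C2].
- by rewrite (one_proj tf) (proj_one tf).
- exact: proj_comm.
- by rewrite smulDl smulDr smulZl smulZr C1 C2.
- by rewrite smulA C1 -!smulA C2.
Qed.

Lemma cylinder_one F y : cyl F y -> y ** vertex_sum f = y.
Proof.
elim=> [|j|k {}F {}y F' y' _ C1 _ C2|{}F {}y F' y' _ C1 _ C2].
- exact: one_one.
- exact: proj_one.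
- by rewrite smulDl smulZl C1 C2.
- by rewrite -smulA C2.
Qed.

(** Conjugation by a letter on [D] corresponds to the shift on configurations;
it sends the unit to the projection of [linv l], whence the restriction to
configurations where that coordinate is true. *)
Lemma cylinder_shift l F y : cyl F y ->
  exists2 F', cyl F' (sstar (e_ l) ** y ** e_ l) &
    forall xi, xi (inr [:: linv l]) -> F' xi = F (shift_config l xi).
Proof.
have PlE := letter_source tf l.
elim=> [|[v|u]|k {}F {}y F' y' _ [G Gy GE] _ [G' Gy' GE']|
        {}F {}y F' y' Fy [G Gy GE] _ [G' Gy' GE']].
- exists (fun xi => (xi (inr [:: linv l]))%:R) => [|xi ->//].
  rewrite -smulA (one_letter tf) PlE; exact: (Cylinder_proj f (inr _)).
- rewrite (conj_proj_vertex tf) /shift_config; case: eqP => _.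
    exists (fun xi => (xi (inr [:: linv l]))%:R) => [|xi ->//].
    exact: (Cylinder_proj f (inr _)).
  by exists (fun=> 0) => //; exact: cylinder0.
- exists (fun xi => (xi (inr (linv l :: u)))%:R) => //.
  by rewrite conj_proj_word; exact: (Cylinder_proj f (inr _)).
- exists (fun xi => k * G xi + G' xi).
    rewrite smulDr smulDl smulZr smulZl; exact: Cylinder_lin.
  by move=> xi xl; rewrite GE // GE'.
- exists (fun xi => G xi * G' xi).
    rewrite (letter_conjM tf); last exact: (@cylinder_comm _ _ (inr _) Fy).
    exact: Cylinder_mul.
  by move=> xi xl; rewrite GE // GE'.
Qed.

Lemma consistent_shift l xi : consistent f xi -> xi (inr [:: linv l]) ->
  consistent f (shift_config l xi).
Proof.
move=> cxi xl F /(cylinder_shift l)[F' F'0 <- //].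
by apply: cxi; rewrite smul0r smul0l in F'0.
Qed.

Section Consistent.
Variables (xi : config) (cxi : consistent f xi).

Lemma consistent_meet i j k : P_ i ** P_ j = P_ k -> xi i && xi j = xi k.
Proof.
move=> ijk; have := consistent_eq cxi
  (Cylinder_mul (Cylinder_proj f i) (Cylinder_proj f j)) _.
rewrite ijk => /(_ _ (Cylinder_proj f k)) /=.
by case: (xi i); case: (xi j); case: (xi k) => //=; rewrite ?mulr1 ?mulr0 ?mul0r;
  move=> /eqP; rewrite ?oner_eq0 // eq_sym oner_eq0.
Qed.

Lemma consistent_disj i j : P_ i ** P_ j = 0 -> xi i -> xi j -> False.
Proof.
move=> ij xii xij; have := Cylinder_mul (Cylinder_proj f i) (Cylinder_proj f j).
by rewrite ij => /cxi /eqP; rewrite xii xij mulr1 oner_eq0.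
Qed.

Lemma consistent_vertex : exists v, xi (inl v).
Proof.
apply: contrapT => /forallNP nxi.
have := consistent_eq cxi (cylinder_sum (index_enum _) xpredT
  (fun v => Cylinder_proj f (inl v))) (Cylinder_one f).
rewrite big1 => [/eqP|v _]; first by rewrite eq_sym oner_eq0.
by case: (xi _) (nxi v) => // /(_ isT).
Qed.

(** Characters of [D] see the relation v = sum x x^*: if all terms of the
sum had value 0, so would v. *)
Lemma consistent_edge_sum v X : X \in sg_C v -> xi (inl v) ->
  exists2 x, x \in X & xi (inr [:: (x, true)]).
Proof.
move=> XC xv; apply: contrapT => nxi.
have := consistent_eq cxi (cylinder_sum (index_enum _) (mem X)
  (fun x => Cylinder_proj f (inr [:: (x, true)]))) _.
have /= := tame_rel tf (ECsum _ XC); rewrite eval_bigTAdd => vE.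
move=> /(_ (fun xi => (xi (inl v))%:R)) H.
have {}H : \sum_(x in X) (xi (inr [:: (x, true)]))%:R = (xi (inl v))%:R :> K.
  apply: H; have := Cylinder_proj f (inl v); congr cylinder => /=.
  by rewrite vE; apply: eq_bigr => x _; rewrite (range_proj1 tf).
move: H; rewrite xv big1 => [/eqP|x xX]; first by rewrite eq_sym oner_eq0.
by case xx: (xi _) => //; case: nxi; exists x.
Qed.

Lemma consistent_vertex_disj v w : xi (inl v) -> xi (inl w) -> v = w.
Proof.
move=> xv xw; apply: contrapT => /eqP vw.
apply: (consistent_disj _ xv xw) => /=.
by rewrite (vertexM tf) (negbTE vw).
Qed.

Lemma consistent_tgt l u : xi (inr (l :: u)) -> xi (inl (letter_target l)).
Proof.
rewrite -(@consistent_meet (inl (letter_target l)) (inr (l :: u)) (inr (l :: u))).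
  by case/andP.
by rewrite /= (vertex_range_proj tf) eqxx.
Qed.

Lemma consistent_source x : xi (inr [:: (x, false)]) = xi (inl (sg_s x)).
Proof.
have E1 : P_ (inr [:: (x, false)]) = P_ (inl (sg_s x)).
  by rewrite /= -[(x, false)]/(linv (x, true)) -(letter_source tf) (edge_star_edge tf).
have := @consistent_meet (inr [:: (x, false)]) (inr [:: (x, false)]) (inl (sg_s x)).
rewrite andbb; apply; rewrite E1; exact: (proj_idem tf (inl _)).
Qed.

Lemma consistent_prefix l u : xi (inr (l :: u)) -> xi (inr [:: l]).
Proof.
rewrite -(@consistent_meet (inr [:: l]) (inr (l :: u)) (inr (l :: u))).
  by case/andP.
exact: (range_proj_prefix tf).
Qed.

Lemma consistent_edge_disj v X x y : X \in sg_C v -> x \in X -> y \in X ->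
  xi (inr [:: (x, true)]) -> xi (inr [:: (y, true)]) -> x = y.
Proof.
move=> XC xX yX xx xy; apply: contrapT => /eqP nxy.
apply: (consistent_disj _ xx xy) => /=.
have /= := tame_rel tf (ECee _ XC xX yX); rewrite (negbTE nxy) /= => xy0.
rewrite !(range_proj1 tf) /letter_val /= -smulA (smulA (sstar _)) xy0.
by rewrite smul0l smul0r.
Qed.

Lemma consistent_nil : xi (inr [::]).
Proof.
have := consistent_eq cxi (Cylinder_proj f (inr [::])) _.
rewrite /= (range_proj_nil tf) => /(_ _ (Cylinder_one f)).
by case: (xi _) => //= /eqP; rewrite eq_sym oner_eq0.
Qed.

Lemma shiftK l : xi (inr [:: linv l]) -> shift_config (linv l) (shift_config l xi) = xi.
Proof.
move=> xl; apply/funext => -[v|u] /=; last first.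
  rewrite linvK.
  rewrite -(@consistent_meet (inr [:: linv l]) (inr u) (inr (linv l :: l :: u))).
    by rewrite xl.
  by rewrite /= (range_proj_cancel tf).
apply/eqP/idP => [->|xv]; first exact: consistent_tgt xl.
exact: consistent_vertex_disj xv (consistent_tgt xl).
Qed.

Lemma shift_domain l : xi (inr [:: linv l]) -> shift_config l xi (inr [:: l]).
Proof.
move=> xl; rewrite /= -(@consistent_meet (inr [:: linv l]) (inr [::])).
  by rewrite xl consistent_nil.
by rewrite /= (range_proj_cancel tf).
Qed.

End Consistent.

(** An ultrafilter of projections that does not kill [y], built along an
enumeration of the coordinates: at each step multiply by P_i if the result
still does not kill [y], by 1 - P_i otherwise. On the tail of the sequence
every polynomial acts as the scalar given by the resulting configuration. *)
Lemma cylinder_separate F y : cyl F y -> y <> 0 ->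
  exists2 xi, consistent f xi & F xi <> 0.
Proof.
move=> Fy y0; pose one := vertex_sum f.
pose step n b : D := if unpickle n is Some i then
   (if `[< y ** (P_ i ** b) = 0 >] then b - P_ i ** b else P_ i ** b) else b.
pose b := fix b n : D := if n is n'.+1 then step n' (b n') else one.
(* If P_i b is killed by y, then (1 - P_i) b is not. *)
have yb0 n : y ** b n <> 0.
  elim: n => [|n IHn] /=; first by rewrite (cylinder_one Fy).
  rewrite /step; case: unpickle => [i|//]; case: asboolP => // yPb.
  by rewrite smulBr yPb subr0.
pose xi (i : idx) := ~~ `[< y ** (P_ i ** b (pickle i)) = 0 >].
(* From step i on, P_i acts on b n as the chosen truth value. *)
have Pb i n : (pickle i < n)%N -> P_ i ** b n = (xi i)%:R *: b n.
  elim: n => // n IHn; rewrite ltnS leq_eqVlt => /orP[/eqP <-|lt_in] /=.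
    rewrite /step pickleK /xi; case: asboolP => _ /=.
      by rewrite smulBr smulA (proj_idem tf) subrr scale0r.
    by rewrite smulA (proj_idem tf) scale1r.
  rewrite /step; case: unpickle => [j|]; last exact: IHn.
  have PPb : P_ i ** (P_ j ** b n) = (xi i)%:R *: (P_ j ** b n).
    by rewrite smulA (proj_comm tf) -smulA IHn // smulZr.
  by case: ifP => _ //; rewrite smulBr IHn // PPb scalerBr.
have oneb n : one ** b n = b n.
  elim: n => [|n IHn] /=; first exact: one_one.
  rewrite /step; case: unpickle => [j|//].
  have Pj : one ** (P_ j ** b n) = P_ j ** b n by rewrite smulA (one_proj tf).
  by case: ifP => _ //; rewrite smulBr IHn Pj.
have ev G z : cyl G z -> exists n0, forall n, (n0 <= n)%N ->
    z ** b n = G xi *: b n.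
  elim=> [|i|k {}G {}z G' z' _ [m Hm] _ [m' Hm']|
          {}G {}z G' z' _ [m Hm] _ [m' Hm']].
  - by exists 0%N => n _; rewrite oneb scale1r.
  - by exists (pickle i).+1 => n; exact: Pb.
  - exists (maxn m m') => n; rewrite geq_max => /andP[mn mn'].
    by rewrite smulDl smulZl Hm // Hm' // scalerDl scalerA.
  - exists (maxn m m') => n; rewrite geq_max => /andP[mn mn'].
    by rewrite -smulA Hm' // smulZr Hm // scalerA mulrC.
exists xi => [G /ev[n /(_ n (leqnn n))]|Fxi].
  rewrite smul0l => /esym/eqP; rewrite scaler_eq0 => /orP[/eqP //|/eqP bn0].
  by have := yb0 n; rewrite bn0 smul0r.
by have [n /(_ n (leqnn n))] := ev _ _ Fy; rewrite Fxi scale0r => /yb0.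
Qed.

End Cylinders.

(** * Itineraries in a dynamical system *)

Section ItineraryOfSystem.
Variables (E : sepGraph) (S : dynSystem E).
Local Notation lett := (letter (sg_E E)).
Implicit Types (w : S) (l : lett) (u : seq lett).

(** The range of theta_u is the domain of its inverse, which the word [winv u]
defines; words are not required to be reduced. *)
Definition itinerary w : config E := fun i =>
  match i with
  | inl v => `[< ds_V v w >]
  | inr u => isSome (theta_word (winv u) w)
  end.

Lemma theta_word_rcons u l w :
  theta_word (rcons u l) w = obind (theta_word u) (theta_letter l w).
Proof.
rewrite -cats1 /theta_word foldr_cat /=; case: theta_letter => //=.
by elim: u => //= m u ->.
Qed.

Lemma winv_cons l u : winv (l :: u) = rcons (winv u) (linv l).
Proof. by rewrite /winv rev_cons map_rcons. Qed.

(** The map alpha_u of the partial action, for words that need not be reduced. *)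
Definition word_transport (K : fieldType) u (f : S -> K) : S -> K :=
  fun w => if theta_word (winv u) w is Some w' then f w' else 0.

Lemma word_transport_cons (K : fieldType) l u (f : S -> K) :
  word_transport (l :: u) f = word_transport [:: l] (word_transport u f).
Proof.
apply/funext => w; rewrite /word_transport !winv_cons !theta_word_rcons.
by case: theta_letter.
Qed.

Lemma word_transport_mem (K : fieldType) (c : involution K)
    (B : functionAlgebra S c) u f : B f -> B (word_transport u f).
Proof.
elim: u f => [//|[x b] u IHu] f Bf; rewrite word_transport_cons.
move/IHu: Bf; move: (word_transport u f) => g Bg; case: b.
  have := fa_transport (ds_H_clopen S x) (@ds_thV_cont _ _ x) Bg.
  congr (fa_mem _ _); apply/funext => w.
  by rewrite /word_transport /= /theta_letter /=; case: `[< _ >].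
have := fa_transport (ds_V_clopen S (sg_s x)) (@ds_th_cont _ _ x) Bg.
congr (fa_mem _ _); apply/funext => w.
by rewrite /word_transport /= /theta_letter /=; case: `[< _ >].
Qed.

Lemma fa_vertex (K : fieldType) (c : involution K) (B : functionAlgebra S c) v :
  B (fun w => (itinerary w (inl v))%:R).
Proof.
have cid : {within ds_V v, continuous (@id S)} by apply: continuous_subspaceT => w; exact: cvg_id.
have := fa_transport (ds_V_clopen S v) cid (fa_const B 1).
by congr (fa_mem _ _); apply/funext => w /=; case: `[< _ >].
Qed.

Lemma fa_word (K : fieldType) (c : involution K) (B : functionAlgebra S c) u :
  B (fun w => (itinerary w (inr u))%:R).
Proof.
have := word_transport_mem u (fa_const B 1).
congr (fa_mem _ _); apply/funext => w.
by rewrite /word_transport /=; case: theta_word.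
Qed.

Lemma fa_itinerary (K : fieldType) (c : involution K)
  (B : functionAlgebra S c) i : B (fun w => (itinerary w i)%:R).
Proof. by case: i => [v|u]; [exact: fa_vertex | exact: fa_word]. Qed.

Lemma itinerary_near w i : \forall w' \near w, itinerary w' i = itinerary w i.
Proof.
(* Values in any field turn the closure properties of function algebras into
   the clopenness of domains. *)
have c : involution rat by exists idfun; move=> x.
have /discrete_continuousP/(_ w) := fa_itinerary (functions_discrete S c) i.
by apply: filterS => w'; case: (itinerary w' i); case: (itinerary w i) => //= /eqP.
Qed.

Lemma itinerary_continuous : continuous itinerary.
Proof.
apply: continuous_product => i w A /=.
rewrite nbhs_principalE => /principal_filterP Aw.
by apply: filterS (itinerary_near w i) => w' /= ->.
Qed.

Lemma vertex_unique w v v' : ds_V v w -> ds_V v' w -> v = v'.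
Proof.
move=> vw vw'; apply: contrapT => /eqP nvv'.
have /trivIsetP/(_ v v' I I nvv')/seteqP[+ _] := @ds_V_disj _ S.
by move=> /(_ w); apply.
Qed.

Lemma itinerary_vertex w v v' : ds_V v w -> itinerary w (inl v') = (v' == v).
Proof.
move=> vw; rewrite /=; apply/asboolP/eqP => [v'w|-> //].
exact: vertex_unique v'w vw.
Qed.

Lemma theta_letter_tgt l w w' :
  theta_letter l w = Some w' -> ds_V (letter_target l) w'.
Proof.
case: l => x []; rewrite /theta_letter /letter_target /=; case: asboolP => // wx [<-].
- exact/ds_H_sub/ds_th_fun.
- exact: ds_thV_fun.
Qed.

Lemma itinerary_shift l w w' : theta_letter l w = Some w' ->
  itinerary w' = shift_config l (itinerary w).
Proof.
move=> lw; apply/funext => -[v|u].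
  exact: (itinerary_vertex v (theta_letter_tgt lw)).
by rewrite /shift_config /itinerary winv_cons linvK theta_word_rcons lw.
Qed.

Lemma itinerary_letter l w : itinerary w (inr [:: l]) = theta_letter (linv l) w :> bool.
Proof. by []. Qed.

End ItineraryOfSystem.

(** * The dynamical system of consistent configurations *)

Section ConsistentSystem.
Variables (E : sepGraph) (K : fieldType) (c : involution K).
Local Notation lett := (letter (sg_E E)).
Variables (D : starAlgebra c) (f : ec_gen E -> D) (tf : tame f).

Definition consistent_space : topologicalType :=
  set_type (consistent f : set (config E)).
Implicit Types p : consistent_space.

Definition cval (p : consistent_space) : config E := set_val p.

Lemma cvalP p : consistent f (cval p). Proof. exact: set_valP. Qed.

Lemma cval_inj : injective cval. Proof. exact: val_inj. Qed.

Lemma cval_continuous : continuous cval.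
Proof. exact: (@initial_continuous _ _ (@set_val _ (consistent f))). Qed.

Lemma cval_coord_continuous i : continuous (fun p => cval p i).
Proof.
move=> p; apply: (@continuous_comp _ _ _ cval (fun xi : config E => xi i)).
  exact: cval_continuous.
exact: (@proj_continuous _ (fun=> bool)).
Qed.

(** Off the domain of the letter the shift may be inconsistent; the point is
then left where it is. *)
Definition cshift (l : lett) p : consistent_space := insubd p (shift_config l (cval p)).

Lemma cval_cshift l p : cval p (inr [:: linv l]) ->
  cval (cshift l p) = shift_config l (cval p).
Proof.
move=> pl; apply: insubdK; rewrite inE; apply: (consistent_shift tf) => //.
exact: cvalP.
Qed.

Lemma cshift_continuous l (A : set consistent_space) :
  (forall p, A p -> cval p (inr [:: linv l])) -> {within A, continuous (cshift l)}.
Proof.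
move=> Al.
have cs : {within A, continuous (shift_config l \o cval)}.
  apply: continuous_subspaceT => p.
  apply: (@continuous_comp _ _ _ cval (@shift_config E l)).
    exact: cval_continuous.
  exact: shift_continuous.
have : {within A, continuous (cval \o cshift l)}.
  apply: (subspace_eq_continuous _ cs) => p /[!inE] Ap.
  exact: esym (cval_cshift (Al p Ap)).
exact: (@continuous_comp_initial _ (subspace A) _ (@set_val _ (consistent f))).
Qed.

Definition cs_V v : set consistent_space := [set p | cval p (inl v)].
Definition cs_H x : set consistent_space := [set p | cval p (inr [:: (x, true)])].

Lemma cs_V_source x p : cs_V (sg_s x) p -> cval p (inr [:: linv (x, true)]).
Proof. by rewrite /cs_V /= -(consistent_source tf (cvalP p)). Qed.

Lemma consistent_space_compact : compact [set: consistent_space].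
Proof. exact/compact_set_type/consistent_compact. Qed.

Lemma consistent_space_hausdorff : hausdorff_space consistent_space.
Proof.
apply: hausdorff_set_type; apply: (@hausdorff_product _ (fun=> bool)) => i.
exact: discrete_hausdorff.
Qed.

Definition consistent_system : dynSystem E.
Proof.
apply: (@DynSystem E consistent_space consistent_space_compact
  consistent_space_hausdorff cs_V _ _ _ cs_H _ _ _ _
  (fun x => cshift (x, true)) (fun x => cshift (x, false))).
- by move=> v; apply: clopen_bool; exact: cval_coord_continuous.
- apply/seteqP; split=> // p _.
  by have [v pv] := consistent_vertex (cvalP p); exists v.
- apply/trivIsetP => v v' _ _ /eqP nvv'; apply/seteqP; split=> // p [pv pv'].
  exact/nvv'/(consistent_vertex_disj tf (cvalP p)).
- by move=> x; apply: clopen_bool; exact: cval_coord_continuous.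
- by move=> x p /(consistent_tgt tf (cvalP p)).
- move=> v X XC; apply/seteqP; split=> [p [x /= xX px]|p pv].
    have := consistent_tgt tf (cvalP p) px; rewrite /letter_target /=.
    have := sg_partition v => /and3P[/eqP covC _ _].
    have : x \in finset.cover (sg_C v) by apply/finset.bigcupP; exists X.
    by rewrite covC inE => /eqP ->.
  have [x xX px] := consistent_edge_sum tf (cvalP p) XC pv.
  by exists x.
- move=> v X XC; apply/trivIsetP => x y xX yX /eqP nxy.
  apply/seteqP; split=> // p [px py].
  exact/nxy/(consistent_edge_disj tf (cvalP p) XC xX yX px py).
- by move=> x; apply: cshift_continuous => p; exact: cs_V_source.
- by move=> x; apply: cshift_continuous.
- move=> x p px; rewrite /cs_H /= cval_cshift; last exact: cs_V_source.
  exact/(shift_domain tf (cvalP p))/(cs_V_source px).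
- by move=> x p px; rewrite /cs_V /= cval_cshift //= eqxx.
- move=> x p /cs_V_source px; apply: cval_inj.
  have sx := shift_domain tf (cvalP p) px.
  rewrite (@cval_cshift (x, false)) cval_cshift //.
  exact: (shiftK tf (cvalP p) px).
- move=> x p px; apply: cval_inj.
  have sx := @shift_domain _ _ _ _ _ tf _ (cvalP p) (x, false) px.
  rewrite (@cval_cshift (x, true)) cval_cshift //.
  exact: (@shiftK _ _ _ _ _ tf _ (cvalP p) (x, false) px).
Defined.

End ConsistentSystem.

(** * Consequences of universality *)

Section Equivariance.
Variables (E : sepGraph) (S S' : dynSystem E) (h : S -> S').
Hypothesis eh : equivariant h.
Local Notation lett := (letter (sg_E E)).
Implicit Types w : S.

Lemma vertex_exists (T : dynSystem E) (w : T) : exists v, ds_V v w.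
Proof. by have : [set: T] w by []; rewrite -ds_V_cover => -[v _ vw]; exists v. Qed.

Lemma equivariant_vertex v w : ds_V v (h w) <-> ds_V v w.
Proof.
split=> [vhw|vw]; last by apply: (equi_V eh); exists w.
have [v' v'w] := vertex_exists w.
suff -> : v = v' by [].
by apply: (vertex_unique vhw); apply: (equi_V eh); exists w.
Qed.

(** A point of Omega_(r x) lies in exactly one H_y for y in the block of x, so
mapping each H_y into H_y reflects membership. *)
Lemma equivariant_range x w : ds_H x (h w) <-> ds_H x w.
Proof.
split=> [xhw|xw]; last by apply: (equi_H eh); exists w.
have [X XC xX] := edge_block x.
have /equivariant_vertex := ds_H_sub xhw.
rewrite -(ds_H_cover S XC) => -[y /= yX yw].
have yhw : ds_H y (h w) by apply: (equi_H eh); exists w.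
have [->//|nxy] := eqVneq x y.
have /trivIsetP/(_ x y xX yX nxy)/seteqP[+ _] := @ds_H_disj _ S' _ _ XC.
by move=> /(_ (h w))[].
Qed.

Lemma equivariant_letter l w :
  theta_letter l (h w) = omap h (theta_letter l w).
Proof.
case: l => x []; rewrite /theta_letter /=.
  case: (asboolP (ds_V _ w)) => [vw|nvw].
    rewrite asboolT /=; last exact/equivariant_vertex.
    by rewrite (equi_th eh).
  by rewrite asboolF // => /equivariant_vertex.
case: (asboolP (ds_H _ w)) => [xw|nxw]; last first.
  by rewrite asboolF // => /equivariant_range.
rewrite asboolT /=; last exact/equivariant_range.
have vw := ds_thV_fun xw; rewrite -[in LHS](ds_thVK xw) (equi_th eh) //.
by rewrite ds_thK //; exact/equivariant_vertex.
Qed.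

Lemma equivariant_word (u : seq lett) w :
  theta_word u (h w) = omap h (theta_word u w).
Proof.
elim: u => [//|l u IHu] /=; rewrite IHu.
by case: (theta_word u w) => //= w'; exact: equivariant_letter.
Qed.

Lemma equivariant_itinerary w : itinerary (h w) = itinerary w.
Proof.
apply/funext => -[v|u] /=; first by apply/asboolP/asboolP => /equivariant_vertex.
by rewrite equivariant_word; case: theta_word.
Qed.

End Equivariance.

Section ConsistentItinerary.
Variables (E : sepGraph) (K : fieldType) (c : involution K).
Variables (D : starAlgebra c) (f : ec_gen E -> D) (tf : tame f).

(** In the system of consistent configurations a point is its own itinerary. *)
Lemma consistent_itinerary (p : consistent_system tf) : itinerary p = cval p.
Proof.
apply/funext => -[v|u] /=; first exact: asboolb.
elim: u p => [|l u IHu] p; first by rewrite (consistent_nil tf (cvalP p)).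
rewrite winv_cons theta_word_rcons.
have -> : theta_letter (linv l) p =
    if cval p (inr [:: l]) then Some (cshift (linv l) p : consistent_system tf)
    else None.
  case: l => x []; rewrite /theta_letter /=; first by rewrite asboolb.
  by rewrite (consistent_source tf (cvalP p)) asboolb.
case: ifPn => pl /=.
  by rewrite IHu cval_cshift ?linvK //= linvK.
by apply/esym/negbTE; apply: contra pl => /(consistent_prefix tf (cvalP p)).
Qed.

Variables (Omega : dynSystem E) (univOmega : universal_system Omega).

(** The universal map from the consistent system to Omega preserves
itineraries. *)
Lemma itinerary_surj xi : consistent f xi -> exists w : Omega, itinerary w = xi.
Proof.
move=> cxi; have [h [[_ eh] _]] := univOmega (consistent_system tf).
pose p : consistent_system tf := exist _ xi (mem_set cxi).
by exists (h p); rewrite (equivariant_itinerary eh) consistent_itinerary.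
Qed.

(** The relation [cylinder] induces a well-defined map from functions on Omega
to [D]: this is where the algebra is controlled by the dynamics. *)
Lemma cylinder_inj F y : cylinder f F y ->
  (forall w : Omega, F (itinerary w) = 0) -> y = 0.
Proof.
move=> Fy F0; apply: contrapT => /(cylinder_separate tf Fy)[xi cxi Fxi].
by have [w wxi] := itinerary_surj cxi; apply: Fxi; rewrite -wxi.
Qed.

End ConsistentItinerary.

Section Approximation.
Variables (E : sepGraph) (K : fieldType) (c : involution K).
Variables (D : starAlgebra c) (f : ec_gen E -> D).
Variables (Omega : dynSystem E) (inj : injective (@itinerary E Omega)).
Implicit Types (w : Omega) (xi : config E).

Lemma cylinder_near F y w : cylinder f F y ->
  \forall w' \near w, F (itinerary w') = F (itinerary w).
Proof. by move=> Fy; exact: itinerary_continuous (cylinder_locally_constant _ Fy). Qed.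

Lemma cylinder_agree w (s : seq (sg_V E + seq (letter (sg_E E)))) :
  exists2 Fy, cylinder f Fy.1 Fy.2 & forall w', Fy.1 (itinerary w') =
    (all (fun i => itinerary w' i == itinerary w i) s)%:R.
Proof.
elim: s => [|i s [[F y] /= Fy FE]].
  by exists (fun=> 1, vertex_sum f) => //; exact: Cylinder_one.
have [[G z] /= Gz GE] : exists2 Gz, cylinder f Gz.1 Gz.2 & forall w',
    Gz.1 (itinerary w') = (itinerary w' i == itinerary w i)%:R.
  case wi: (itinerary w i).
    exists (fun xi => (xi i)%:R, proj_of f i) => /= [|w'].
      exact: Cylinder_proj.
    by rewrite eqb_id.
  exists (fun xi => 1 - (xi i)%:R, vertex_sum f - proj_of f i) => /= [|w'].
    by apply: cylinderB; [exact: Cylinder_one | exact: Cylinder_proj].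
  by case: (itinerary w' i); rewrite ?subr0 ?subrr.
exists (fun xi => G xi * F xi, z ** y); first exact: Cylinder_mul.
by move=> w' /=; rewrite GE FE; case: eqP; rewrite ?mul1r ?mul0r.
Qed.

(** Outside an open neighbourhood of [w] every point differs from [w] in some
coordinate, and by compactness finitely many coordinates suffice. *)
Lemma cylinder_base w (V : set Omega) : nbhs w V ->
  exists2 Fy, cylinder f Fy.1 Fy.2 & exists b : Omega -> bool,
    [/\ forall w', Fy.1 (itinerary w') = (b w')%:R, b w & forall w', b w' -> V w'].
Proof.
rewrite nbhsE => -[U [oU Uw] UV].
have cU : compact (~` U).
  apply: (subclosed_compact _ (@ds_compact _ Omega)) => //.
  exact: open_closedC.
move/(compact_cover_inhabited w) in cU.
have [|w' nUw'|s _ sU] := cU _ setT (fun i => [set w' | itinerary w' i != itinerary w i]).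
- move=> i _; rewrite openE => w' w'i; rewrite /interior.
  by apply: filterS (itinerary_near w' i) => w'' /= ->.
- have : itinerary w' <> itinerary w by move/inj => w'w; apply: nUw'; rewrite w'w.
  move=> nw; have [i wi] : exists i, itinerary w' i <> itinerary w i.
    by apply/existsNP => e; apply: nw; apply/funext.
  by exists i => //; apply/eqP.
have [Fy Fy_cyl FyE] := cylinder_agree w (finmap.enum_fset s).
exists Fy => //; exists (fun w' => all (fun i => itinerary w' i == itinerary w i)
  (finmap.enum_fset s)).
split=> // [|w' /allP w's]; first exact/allP.
apply: UV; apply: contrapT => /sU[i /= si]; by rewrite w's.
Qed.

(** A family of neighbourhoods formulates both uses of compactness: with level
sets of [g] the cylinder function equals [g], with sets of small oscillation
it is uniformly close to [g]. *)
Lemma cylinder_approx (V : Omega -> set Omega) (g : Omega -> K) :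
  (forall w, nbhs w (V w)) ->
  exists2 Fy, cylinder f Fy.1 Fy.2 &
    forall w, exists2 w0, V w0 w & Fy.1 (itinerary w) = g w0.
Proof.
move=> nV.
have /choice[B BP] : forall w, exists Fyb : ((config E -> K) * D) * (Omega -> bool),
    cylinder f Fyb.1.1 Fyb.1.2 /\ [/\ forall w', Fyb.1.1 (itinerary w') = (Fyb.2 w')%:R,
      Fyb.2 w & forall w', Fyb.2 w' -> V w w'].
  by move=> w; have [Fy Fy_cyl [b bP]] := cylinder_base (nV w); exists (Fy, b).
have [[w1 _]|/forallNP Omega0] := pselect (exists w0 : Omega, True); last first.
  by exists (fun=> 0, 0) => [|w]; [exact: cylinder0 | have := Omega0 w].
have /(compact_cover_inhabited w1) cT := @ds_compact _ Omega.
have [|w _|s _ sT] := cT _ setT (fun w => [set w' | (B w).2 w']).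
- move=> w _; rewrite openE => w' w'i; rewrite /interior.
  have [Bc [BE _ _]] := BP w.
  apply: filterS (cylinder_near w' Bc) => w''; rewrite !BE (_ : (B w).2 w') //=.
  by case: ((B w).2 w'') => // /eqP; rewrite eq_sym oner_eq0.
- by exists w => //; have [_ []] := BP w.
have [Fy Fy_cyl FyP] : exists2 Fy, cylinder f Fy.1 Fy.2 &
    forall w, (exists2 w0, w0 \in finmap.enum_fset s & (B w0).2 w) ->
      exists2 w0, V w0 w & Fy.1 (itinerary w) = g w0.
  (* On the cylinder set of the head take its value, elsewhere the value given
     by the tail. *)
  elim: (finmap.enum_fset s) => [|a t [[F y] /= Fy_cyl FyP]].
    by exists (fun=> 0, 0) => [|w []//]; exact: cylinder0.
  have [Bc [BE Ba BV]] := BP a.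
  exists (fun xi => g a * (B a).1.1 xi + (1 - (B a).1.1 xi) * F xi,
          g a *: (B a).1.2 + (vertex_sum f - (B a).1.2) ** y) => /=.
    apply: Cylinder_lin => //; apply: Cylinder_mul => //.
    by apply: cylinderB => //; exact: Cylinder_one.
  move=> w [w0]; rewrite BE; case Baw: ((B a).2 w) => /=.
    by move=> _ _; exists a; [exact: BV | rewrite mulr1 subrr mul0r addr0].
  rewrite inE => /orP[/eqP->|w0t w0w]; first by rewrite Baw.
  have [|w2 w2w w2E] := FyP w; first by exists w0.
  by exists w2 => //; rewrite mulr0 add0r subr0 mul1r.
exists Fy => // w; apply: FyP.
by have [w0 /= sw0 w0w] := sT w I; exists w0.
Qed.

End Approximation.

Section Covariance.
Variables (E : sepGraph) (K : fieldType) (c : involution K).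
Variables (D : starAlgebra c) (f : ec_gen E -> D) (tf : tame f).
Variable S : dynSystem E.

(** The shift is only related to conjugation where the coordinate [l] is true;
multiplying by that coordinate gives the value 0 elsewhere, as the
transported function requires. *)
Lemma cylinder_covariant l F y : cylinder f F y ->
  exists2 F', cylinder f F' (letter_val f l ** y ** sstar (letter_val f l)) &
    forall w : S, F' (itinerary w) = word_transport [:: l] (F \o @itinerary E S) w.
Proof.
move=> /(cylinder_shift tf (linv l))[F']; rewrite letter_valV sstarK linvK.
move=> F'y F'E; exists (fun xi : config E => (xi (inr [:: l]))%:R * F' xi).
  apply: cylinder_eq (Cylinder_mul (Cylinder_proj f (inr [:: l])) F'y) => //=.
  by rewrite (range_proj1 tf) !smulA (letter_partial_isometry tf).
move=> w; rewrite itinerary_letter /word_transport /=.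
case lw: (theta_letter (linv l) w) => [w'|] /=; last by rewrite mul0r.
by rewrite mul1r F'E ?itinerary_letter ?lw //= (itinerary_shift lw).
Qed.

End Covariance.

(** * Monomials in the crossed product *)

Section Monomials.
Variables (E : sepGraph) (S : dynSystem E) (K : fieldType) (c : involution K).
Variable B : functionAlgebra S c.
Local Notation F := (freeGroup (sg_E E)).
Local Notation lett := (letter (sg_E E)).
Local Notation C := (crossed_product B).
Implicit Types (g h k : F) (a b : S -> K) (w : S).

(** The element a delta_g, total in [a] for convenience: it is 0 when [a] is not
in the domain D_g. *)
Definition mono g a : C :=
  insubd (0 : xp B) (fun k w => if k == g then a w else 0 : K^o).

Lemma monoE g a k w : alpha_dom B g a ->
  (mono g a : xp B) k w = if k == g then a w else 0.
Proof.
move=> ga; rewrite /mono /= insubdK //; apply/xp_predP; split.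
  move=> h; case: eqP => [-> //|_]; apply/alpha_domP; split => //.
  exact: (fa_const B 0).
apply: (sub_finite_set _ (finite_set1 g)) => h /=; apply: contra_notP => /eqP.
by move=> /negbTE ->.
Qed.

Lemma alpha_dom_lin g (k : K) a b : alpha_dom B g a -> alpha_dom B g b ->
  alpha_dom B g (fun w => k * a w + b w).
Proof.
move=> /alpha_domP[Ba a0] /alpha_domP[Bb b0]; apply/alpha_domP; split.
  exact: fa_add (fa_mul (fa_const B k) Ba) Bb.
by move=> w gw; rewrite a0 // b0 // mulr0 addr0.
Qed.

Lemma mono_lin g (k : K) a b : alpha_dom B g a -> alpha_dom B g b ->
  mono g (fun w => k * a w + b w) = k *: mono g a + mono g b.
Proof.
move=> ga gb; apply: (@xp_eqP _ _ _ _ B) => h w.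
rewrite xpDE xpZE !monoE //; last exact: alpha_dom_lin.
by case: eqP; rewrite // mulr0 addr0.
Qed.

Lemma mono_eq g h a b : g = h -> a =1 b -> mono g a = mono h b.
Proof. by move=> -> /funext ->. Qed.

Lemma mono0 g : mono g (fun=> 0) = 0.
Proof.
apply: (@xp_eqP _ _ _ _ B) => h w; rewrite monoE; first by case: ifP.
by apply/alpha_domP; split=> //; exact: (fa_const B 0).
Qed.

Lemma mono_mul_fun g h a b : alpha_dom B g a -> alpha_dom B h b -> forall k w,
  (mono g a ** mono h b : xp B) k w =
  if k == (g * h)%g then a w * alpha g b w else 0.
Proof.
move=> ga hb k w.
rewrite -[LHS]/(xp_mul (mono g a : xp B) (mono h b) k w) (@xp_mulE _ _ _ _ _ [:: g]) //.
  rewrite big_seq1 monoE // eqxx.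
  have -> : (mono h b : xp B) (g^-1 * k)%g = if k == (g * h)%g then b else fun=> 0.
    apply/funext => w'; rewrite monoE //.
    have -> : ((g^-1 * k)%g == h) = (k == (g * h)%g).
      by apply/eqP/eqP => [<-|->]; rewrite ?mulVKg ?mulKg.
    by case: ifP.
  by case: ifP => _ //; rewrite alpha0 mulr0.
by move=> g'; rewrite inE => /negbTE g'g w'; rewrite monoE // g'g.
Qed.

(** Read off from the fact that coefficients of a product lie in the domains. *)
Lemma mono_mul_dom g h a b : alpha_dom B g a -> alpha_dom B h b ->
  alpha_dom B (g * h)%g (fun w => a w * alpha g b w).
Proof.
move=> ga hb; have := xp_domP (mono g a ** mono h b : xp B) (g * h)%g.
by congr alpha_dom; apply/funext => w; rewrite mono_mul_fun // eqxx.
Qed.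

Lemma mono_mul g h a b : alpha_dom B g a -> alpha_dom B h b ->
  mono g a ** mono h b = mono (g * h)%g (fun w => a w * alpha g b w).
Proof.
move=> ga hb; apply: (@xp_eqP _ _ _ _ B) => k w.
by rewrite mono_mul_fun // monoE //; exact: mono_mul_dom.
Qed.

Lemma alpha_dom_alpha g a : B a -> alpha_dom B g (alpha g a).
Proof.
move=> Ba; apply/alpha_domP; split; first exact: alpha_mem.
by move=> w; rewrite /alpha; case: theta.
Qed.

Lemma alpha_dom_mem g a : alpha_dom B g a -> B a.
Proof. by case/alpha_domP. Qed.

Lemma mono_star g a : alpha_dom B g a ->
  sstar (mono g a) = mono g^-1%g (alpha g^-1%g (fun w => c (a w))).
Proof.
move=> ga; apply: (@xp_eqP _ _ _ _ B) => k w.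
rewrite -[LHS]/(xp_star (mono g a : xp B) k w) xp_starE monoE; last first.
  by apply: alpha_dom_alpha; apply: fa_conj; exact: alpha_dom_mem ga.
have -> : (mono g a : xp B) k^-1%g = if k == g^-1%g then a else fun=> 0.
  apply/funext => w'; rewrite monoE //.
  have -> : (k^-1%g == g) = (k == g^-1%g).
    by apply/eqP/eqP => [<-|->]; rewrite invgK.
  by case: ifP.
case: eqP => [->|_]; first by rewrite -alpha_conj.
by rewrite alpha0 rmorph0.
Qed.

Lemma xp_sumE (I : Type) (s : seq I) (Q : pred I) (G : I -> C) k w :
  (\sum_(i <- s | Q i) G i : xp B) k w = \sum_(i <- s | Q i) (G i : xp B) k w.
Proof.
elim: s => [|i s IHs]; first by rewrite !big_nil.
by rewrite !big_cons; case: (Q i); rewrite ?xpDE IHs.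
Qed.

Lemma mono_decomposition (x : C) : exists2 s : seq F, uniq s &
  (forall g, g \notin s -> forall w, (x : xp B) g w = 0) /\
  x = \sum_(g <- s) mono g ((x : xp B) g).
Proof.
have [s us s0] := xp_supp (xp_valP (x : xp B)); exists s => //; split=> //.
apply: (@xp_eqP _ _ _ _ B) => k w.
rewrite (xp_sumE s xpredT).
under eq_bigr => g _ do rewrite (monoE _ _ (xp_domP (x : xp B) g)).
have [ks|ks] := boolP (k \in s).
  rewrite (big_rem k) //= eqxx big_seq big1 ?addr0 // => g.
  by rewrite mem_rem_uniq // inE eq_sym => /andP[/negbTE ->].
rewrite s0 // big_seq big1 // => g gs; case: eqP => // kg.
by rewrite kg gs in ks.
Qed.

Lemma alpha1 a : alpha 1%g a = a.
Proof. exact/funext. Qed.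

Lemma alpha_dom1 a : B a -> alpha_dom B 1%g a.
Proof. by move=> Ba; apply/alpha_domP; split=> // w; rewrite invg1. Qed.

(** * The crossed product as a tame representation *)

Definition fg_letter (l : lett) : F := exist _ [:: l] isT.
Definition fg_word (u : seq lett) : F := exist _ (wmul u [::]) (@wmul_reduced _ u [::] isT).

Lemma fg_word_cons l u : fg_word (l :: u) = (fg_letter l * fg_word u)%g.
Proof. exact: val_inj. Qed.

Lemma fg_word_val g : fg_word (val g) = g.
Proof. by apply: val_inj; rewrite /= wmul0 //; exact: valP. Qed.

Lemma fg_letterV l : fg_letter (linv l) = (fg_letter l)^-1%g.
Proof. exact: val_inj. Qed.

Definition coord_ind i : S -> K := fun w => (itinerary w i)%:R.

Definition crossed_gen (i : ec_gen E) : C :=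
  match i with
  | inl v => mono 1%g (coord_ind (inl v))
  | inr x => mono (fg_letter (x, true)) (coord_ind (inr [:: (x, true)]))
  end.

Lemma coord_ind_mem i : B (coord_ind i). Proof. exact: fa_itinerary. Qed.

(** theta of an unreduced word is a restriction of theta of its reduction. *)
Lemma coord_ind_dom u : alpha_dom B (fg_word u) (coord_ind (inr u)).
Proof.
apply/alpha_domP; split; first exact: coord_ind_mem.
move=> w; apply: contraNeq; rewrite /coord_ind /=.
case uw: (theta_word (winv u) w) => [w'|]; last by rewrite eqxx.
move=> _; move/theta_wordV: uw; rewrite winvK => uw'.
have /thetaV -> // : theta (fg_word u) w' = Some w.
exact: (@theta_word_mul _ _ u [::] w' w').
Qed.

Lemma coord_ind_letter_dom l : alpha_dom B (fg_letter l) (coord_ind (inr [:: l])).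
Proof. exact: (coord_ind_dom [:: l]). Qed.

Lemma coord_ind_transport l u :
  coord_ind (inr (l :: u)) = word_transport [:: l] (coord_ind (inr u)).
Proof.
apply/funext => w; rewrite /coord_ind /word_transport /itinerary winv_cons.
rewrite theta_word_rcons /=.
by case: (theta_letter (linv l) w).
Qed.

Lemma alpha_letter l a w : alpha (fg_letter l) a w =
  if theta_letter (linv l) w is Some w' then a w' else 0.
Proof. by []. Qed.

Lemma coord_ind_letter l w :
  coord_ind (inr [:: l]) w = if theta_letter (linv l) w is Some _ then 1 else 0.
Proof. by rewrite /coord_ind itinerary_letter; case: theta_letter. Qed.

Lemma coord_ind_vertexE v w : coord_ind (inl v) w = if `[< ds_V v w >] then 1 else 0.
Proof. by rewrite /coord_ind /=; case: `[< _ >]. Qed.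

Lemma coord_ind_theta_letter l w w' :
  theta_letter l w = Some w' -> coord_ind (inr [:: l]) w' = 1.
Proof. by move=> lw; rewrite /coord_ind itinerary_letter (theta_letterV lw). Qed.

Lemma crossed_letter l :
  letter_val crossed_gen l = mono (fg_letter l) (coord_ind (inr [:: l])).
Proof.
case: l => x [] //; rewrite /letter_val /= mono_star; last exact: coord_ind_letter_dom.
rewrite -fg_letterV; apply: mono_eq => // w.
rewrite alpha_letter [RHS]coord_ind_letter.
by case xw: (theta_letter _ w) => [w'|] //=; rewrite (coord_ind_theta_letter xw) rmorph1.
Qed.

Lemma coord_ind_vertex_mul v i w :
  coord_ind (inl v) w * coord_ind i w = if `[< ds_V v w >] then coord_ind i w else 0.
Proof. by rewrite /coord_ind /=; case: `[< _ >]; rewrite ?mul1r ?mul0r. Qed.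

Lemma crossed_satisfies : satisfies (@ec_rel E K) crossed_gen.
Proof.
have dv v : alpha_dom B 1%g (coord_ind (inl v)) by exact/alpha_dom1/coord_ind_mem.
have dl l : alpha_dom B (fg_letter l) (coord_ind (inr [:: l])).
  exact: coord_ind_letter_dom.
move=> t u [v v'|v|x|x|v X x x' XC xX x'X|v X XC] /=.
- rewrite mono_mul // mulg1 (_ : Defs.eval _ _ = 
    mono 1%g (fun w => (v == v')%:R * coord_ind (inl v) w)); last first.
    case: eqP => _ /=; first by apply: mono_eq => // w; rewrite mul1r.
    by rewrite -(mono0 1%g); apply: mono_eq => // w; rewrite mul0r.
  apply: mono_eq => // w; rewrite alpha1 coord_ind_vertex_mul.
  case: asboolP => vw; last by rewrite /coord_ind /= asboolF // mulr0.
  by rewrite /coord_ind !(itinerary_vertex _ vw) eqxx mulr1 eq_sym.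
- rewrite mono_star // invg1; apply: mono_eq => // w.
  by rewrite alpha1 /coord_ind rmorph_nat.
- rewrite mono_mul //; apply: mono_eq => [|w]; first exact: mul1g.
  rewrite alpha1 coord_ind_vertex_mul; case: asboolP => // vw.
  rewrite coord_ind_letter /theta_letter /=; case: asboolP => // xw.
  by case: vw; exact: ds_H_sub.
- rewrite mono_mul //; apply: mono_eq => [|w]; first exact: mulg1.
  rewrite alpha_letter coord_ind_letter.
  case xw: (theta_letter _ w) => [w'|]; last by rewrite mul0r.
  by rewrite mul1r coord_ind_vertexE asboolT //; exact: (theta_letter_tgt xw).
- rewrite -[mono _ _]/(letter_val crossed_gen (x, true)).
  rewrite -[sstar _]/(letter_val crossed_gen (x, false)) crossed_letter.
  rewrite mono_mul //.
  have dE w : coord_ind (inr [:: (x, false)]) w *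
      alpha (fg_letter (x, false)) (coord_ind (inr [:: (x', true)])) w =
      (x == x')%:R * coord_ind (inl (sg_s x)) w.
    rewrite alpha_letter !coord_ind_letter coord_ind_vertexE /theta_letter /=.
    case: asboolP => [vw|]; last by rewrite mul0r mulr0.
    have xw := ds_th_fun vw; rewrite mul1r mulr1 coord_ind_letter /theta_letter /=.
    case: (eqVneq x x') => [<-|nxx']; first by rewrite asboolT.
    rewrite asboolF // => x'w.
    have /trivIsetP/(_ x x' xX x'X nxx')/seteqP[+ _] := @ds_H_disj _ S v X XC.
    by move=> /(_ (ds_th x w))[].
  case: eqP dE => [<- dE|nxx' dE] /=.
    apply: mono_eq => [|w]; last by rewrite dE mul1r.
    by rewrite -[(x, false)]/(linv (x, true)) fg_letterV mulVg.
  rewrite -(mono0 (fg_letter (x, false) * fg_letter (x', true))%g).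
  by apply: mono_eq => // w; rewrite dE mul0r.
- rewrite eval_bigTAdd /=.
  have xE x : mono (fg_letter (x, true)) (coord_ind (inr [:: (x, true)])) **
      sstar (mono (fg_letter (x, true)) (coord_ind (inr [:: (x, true)]))) =
      mono 1%g (coord_ind (inr [:: (x, true)])).
    rewrite -[X in _ ** sstar X]/(letter_val crossed_gen (x, true)).
    rewrite -letter_valV crossed_letter mono_mul //.
    apply: mono_eq => [|w]; first by rewrite fg_letterV mulgV.
    rewrite alpha_letter coord_ind_letter; case xw: (theta_letter _ w) => [w'|].
      by rewrite (coord_ind_theta_letter xw) mulr1.
    by rewrite mulr0.
  under eq_bigr => x _ do rewrite xE.
  apply: (@xp_eqP _ _ _ _ B) => k w; rewrite xp_sumE.
  under eq_bigr => x _ do rewrite (monoE _ _ (alpha_dom1 (coord_ind_mem _))).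
  rewrite (monoE _ _ (alpha_dom1 (coord_ind_mem _))).
  case: eqP => _; last by rewrite big1.
  have covE x : x \in X -> sg_r x = v.
    move=> xX; have /and3P[/eqP covC _ _] := sg_partition v.
    have : x \in finset.cover (sg_C v) by apply/finset.bigcupP; exists X.
    by rewrite covC inE => /eqP.
  have xwE x : coord_ind (inr [:: (x, true)]) w = `[< ds_H x w >]%:R.
    by rewrite coord_ind_letter /theta_letter /=; case: `[< _ >].
  rewrite coord_ind_vertexE; case: asboolP => [vw|nvw]; last first.
    rewrite big1 // => x xX; rewrite xwE asboolF // => xw; apply: nvw.
    by rewrite -(covE x xX); exact: ds_H_sub.
  have [y yX yw] : exists2 y, y \in X & ds_H y w.
    by move: vw; rewrite -(ds_H_cover S XC) => -[y yX yw]; exists y.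
  rewrite (bigD1 y) //= xwE asboolT // big1 ?addr0 // => x /andP[xX nxy].
  rewrite xwE asboolF // => xw.
  have /trivIsetP/(_ x y xX yX nxy)/seteqP[+ _] := @ds_H_disj _ S _ _ XC.
  by move=> /(_ w)[].
Qed.

End Monomials.

Section CrossedTame.
Variables (E : sepGraph) (S : dynSystem E) (K : fieldType) (c : involution K).
Variable B : functionAlgebra S c.
Local Notation F := (freeGroup (sg_E E)).
Local Notation lett := (letter (sg_E E)).
Local Notation C := (crossed_product B).
Local Notation mono := (mono B).
Local Notation coord_ind := (@coord_ind E S K).
Local Notation gen := (crossed_gen B).
Implicit Types (g h k : F) (a b : S -> K) (w : S).

Lemma mono1M h a b : B a -> alpha_dom B h b ->
  mono 1%g a ** mono h b = mono h (fun w => a w * b w).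
Proof.
move=> Ba hb; rewrite (mono_mul (alpha_dom1 Ba) hb).
by apply: mono_eq => [|w]; [exact: mul1g | rewrite alpha1].
Qed.

Lemma mono_mono_star g a : alpha_dom B g a ->
  mono g a ** sstar (mono g a) = mono 1%g (fun w => a w * c (a w)).
Proof.
move=> ga; have cga : alpha_dom B g (fun w => c (a w)).
  have /alpha_domP[Ba a0] := ga; apply/alpha_domP; split; first exact: fa_conj.
  by move=> w /a0 ->; rewrite rmorph0.
rewrite mono_star // mono_mul //; last first.
  by apply: alpha_dom_alpha; exact: alpha_dom_mem cga.
by apply: mono_eq => [|w]; [exact: mulgV | rewrite (alphaVK _ cga)].
Qed.

Lemma crossed_semigroup (x : C) :
  subsemigroup [set x | exists e, x = gen (inr e) \/ x = sstar (gen (inr e))] x ->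
  exists g a, alpha_dom B g a /\ x = mono g a.
Proof.
elim=> [y [e ye]|y z _ [g [a [ga ->]]] _ [h [b [hb ->]]]].
  have [l ->] : exists l, y = letter_val gen l.
    by case: ye => ->; [exists (e, true) | exists (e, false)].
  rewrite crossed_letter; do 2!eexists; split; last by [].
  exact: coord_ind_letter_dom.
rewrite mono_mul //; do 2!eexists; split; last by [].
exact: mono_mul_dom.
Qed.

(** The values of words are monomials a delta_g, whose range projections lie in
the commutative algebra of coefficients at the unit of the group. *)
Lemma crossed_tame : tame gen.
Proof.
split; first exact: crossed_satisfies.
move=> _ [x [y [/crossed_semigroup[g [a [ga ->]]] /crossed_semigroup[h [b [hb ->]]] ->]]].
have Bn i d : alpha_dom B i d -> B (fun w => d w * c (d w)).
  by move=> id; apply: fa_mul (alpha_dom_mem id) (fa_conj (alpha_dom_mem id)).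
rewrite !mono_mono_star // !mono1M; try exact: Bn ga; try exact: Bn hb;
  try exact/alpha_dom1/Bn/ga; try exact/alpha_dom1/Bn/hb.
by apply/eqP; rewrite subr_eq0; apply/eqP; apply: mono_eq => // w; rewrite mulrC.
Qed.

Lemma mono1_lin (k : K) a b : B a -> B b ->
  mono 1%g (fun w => k * a w + b w) = k *: mono 1%g a + mono 1%g b.
Proof. by move=> Ba Bb; apply: mono_lin; exact: alpha_dom1. Qed.

Lemma crossed_vertex_sum : vertex_sum gen = mono 1%g (fun=> 1).
Proof.
apply: (@xp_eqP _ _ _ _ B) => k w; rewrite (xp_sumE _ xpredT).
under eq_bigr => v _ do rewrite (monoE _ _ (alpha_dom1 (coord_ind_mem _ _))).
rewrite (monoE _ _ (alpha_dom1 (fa_const B 1))).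
case: eqP => _; last by rewrite big1.
have [v vw] := vertex_exists w; rewrite (bigD1 v) //= coord_ind_vertexE asboolT //.
rewrite big1 ?addr0 // => v' /eqP nv; rewrite coord_ind_vertexE asboolF // => v'w.
by apply: nv; exact: vertex_unique v'w vw.
Qed.

Lemma crossed_word u : word_val gen u = mono (fg_word u) (coord_ind (inr u)).
Proof.
elim: u => [|l u IHu] /=.
  by rewrite crossed_vertex_sum; apply: mono_eq => //; exact: val_inj.
rewrite IHu crossed_letter mono_mul; [|exact: coord_ind_letter_dom|exact: coord_ind_dom].
apply: mono_eq => [|w]; first by rewrite fg_word_cons.
rewrite alpha_letter coord_ind_letter coord_ind_transport.
rewrite -[RHS]/(if theta_letter (linv l) w is Some w' then coord_ind (inr u) w' else 0).
by case: theta_letter => [w'|]; rewrite ?mul1r ?mul0r.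
Qed.

Lemma crossed_proj i : proj_of gen i = mono 1%g (coord_ind i).
Proof.
case: i => [//|u] /=; rewrite range_projE crossed_word mono_mono_star.
  by apply: mono_eq => // w; rewrite /coord_ind rmorph_nat; case: itinerary; rewrite ?mulr1 ?mulr0.
exact: coord_ind_dom.
Qed.

Lemma cylinder_mem (D : starAlgebra c) (f : ec_gen E -> D) G y :
  cylinder f G y -> B (fun w => G (itinerary w)).
Proof.
elim=> [|i|k {}G {}y G' y' _ BG _ BG'|{}G {}y G' y' _ BG _ BG'].
- exact: fa_const.
- exact: fa_itinerary.
- exact: fa_add (fa_mul (fa_const B k) BG) BG'.
- exact: fa_mul BG BG'.
Qed.

Lemma crossed_cylinder (D : starAlgebra c) (h : C -> D) G y :
  star_hom h -> cylinder (h \o gen) G y -> y = h (mono 1%g (fun w => G (itinerary w))).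
Proof.
move=> hh; elim=> [|i|k {}G {}y G' y' Gy -> Gy' ->|{}G {}y G' y' Gy -> Gy' ->].
- by rewrite -crossed_vertex_sum (star_hom_sum _ _ _ hh).
- by rewrite -crossed_proj proj_of_hom.
- by rewrite -(star_hom_lin hh) -mono1_lin //; [exact: cylinder_mem Gy | exact: cylinder_mem Gy'].
- by rewrite -(star_hom_mul hh) mono1M //;
    [exact: cylinder_mem Gy | exact/alpha_dom1/(cylinder_mem Gy')].
Qed.

(** Evaluation of coefficients at [w] is a character of the commutative part of
the crossed product. *)
Lemma itinerary_consistent w : consistent gen (itinerary w).
Proof.
move=> G G0; have := monoE 1%g w (alpha_dom1 (cylinder_mem G0)).
by rewrite eqxx => <-; rewrite -(crossed_cylinder (star_hom_id _) G0).
Qed.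

End CrossedTame.

(** Going from Omega to the consistent system of the crossed product by the
itinerary and back by universality is an equivariant map, hence the
identity. *)
Lemma itinerary_inj (E : sepGraph) (Omega : dynSystem E) :
  universal_system Omega -> injective (@itinerary E Omega).
Proof.
move=> univOmega.
have c : involution rat by exists idfun.
pose B := functions_discrete Omega c.
pose T := consistent_system (crossed_tame B).
have [h [[ch eh] _]] := univOmega T.
pose k (w : Omega) : T := exist _ (itinerary w) (mem_set (@itinerary_consistent _ _ _ _ B w)).
have ck : continuous k.
  exact: (@continuous_comp_initial _ Omega _ (@set_val _ (consistent (crossed_gen B))) k
    (@itinerary_continuous _ Omega)).
have ek : equivariant k.
  have kV v w : ds_V v w -> ds_V v (k w).
    by move=> vw; change (is_true (itinerary w (inl v))); exact/asboolP.
  split.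
  - by move=> v _ [w vw <-]; exact: kV.
  - move=> x _ [w xw <-]; change (is_true (itinerary w (inr [:: (x, true)]))).
    by rewrite itinerary_letter /theta_letter /= asboolT.
  - move=> x w vw; apply: cval_inj; rewrite (cval_cshift (crossed_tame B)).
      rewrite /cval /=; apply: itinerary_shift.
      by rewrite /theta_letter /= asboolT.
      change (is_true (itinerary w (inr [:: (x, false)]))).
    by rewrite itinerary_letter /theta_letter /= asboolT.
have [i [_ iU]] := univOmega Omega.
have hk : h \o k = id.
  have <- : i = id.
    apply: iU; split; first by move=> w; exact: cvg_id.
    by split=> // [v|x] _ [w ? <-].
  apply/esym/iU; split.
    by move=> w; apply: continuous_comp; [exact: ck | exact: ch].
  split.
  - by move=> v _ [w vw <-]; apply: (equi_V eh); exists (k w) => //; apply: (equi_V ek); exists w.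
  - by move=> v _ [w vw <-]; apply: (equi_H eh); exists (k w) => //; apply: (equi_H ek); exists w.
  - move=> x w vw /=; rewrite (equi_th ek) // (equi_th eh) //.
    by apply: (equi_V ek); exists w.
move=> w w' ww'; rewrite -[w]/(id w) -[w']/(id w') -hk /=; congr h.
by apply: val_inj.
Qed.

(** * Covariant representations and their integrated form *)

Section FunctionRepresentations.
Variables (T : topologicalType) (K : fieldType) (c : involution K).
Variables (B : functionAlgebra T c) (D : starAlgebra c).
Implicit Types (a b : T -> K).

Record function_rep (rho : (T -> K) -> D) : Prop := FunctionRep {
  rep_lin : forall (k : K) a b, B a -> B b ->
    rho (fun w => k * a w + b w) = k *: rho a + rho b;
  rep_mul : forall a b, B a -> B b -> rho (fun w => a w * b w) = rho a ** rho b;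
  rep_star : forall a, B a -> rho (fun w => c (a w)) = sstar (rho a) }.

Variables (rho : (T -> K) -> D) (rr : function_rep rho).

Lemma rep_eq a b : a =1 b -> rho a = rho b. Proof. by move/funext ->. Qed.

Lemma rep0 : rho (fun=> 0) = 0.
Proof.
have B1 := fa_const B 1.
have := rep_lin rr (-1) B1 B1; rewrite scaleN1r addNr => <-.
by apply: rep_eq => w; rewrite mulN1r addNr.
Qed.

Lemma repZ (k : K) a : B a -> rho (fun w => k * a w) = k *: rho a.
Proof.
move=> Ba; have := rep_lin rr k Ba (fa_const B 0).
by rewrite rep0 addr0 => <-; apply: rep_eq => w; rewrite addr0.
Qed.

Lemma repB a b : B a -> B b -> rho (fun w => a w - b w) = rho a - rho b.
Proof.
move=> Ba Bb; rewrite -[RHS]addrC -scaleN1r -(rep_lin rr) //.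
by apply: rep_eq => w; rewrite mulN1r addrC.
Qed.

End FunctionRepresentations.

Lemma rep_hom (T : topologicalType) (K : fieldType) (c : involution K)
    (B : functionAlgebra T c) (C D : starAlgebra c) (rho : (T -> K) -> C)
    (h : C -> D) :
  star_hom h -> function_rep B rho -> function_rep B (h \o rho).
Proof.
move=> hh rr; split=> [k a b Ba Bb|a b Ba Bb|a Ba] /=.
- by rewrite (rep_lin rr) // (star_hom_lin hh).
- by rewrite (rep_mul rr) // (star_hom_mul hh).
- by rewrite (rep_star rr) // (star_hom_star hh).
Qed.

Lemma mono1_rep (E : sepGraph) (S : dynSystem E) (K : fieldType)
    (c : involution K) (B : functionAlgebra S c) :
  function_rep B (mono B 1%g).
Proof.
split=> [k a b Ba Bb|a b Ba Bb|a Ba]; first exact: mono1_lin.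
  by rewrite mono1M //; exact: alpha_dom1.
rewrite mono_star; last exact: alpha_dom1.
by apply: mono_eq => [|w]; rewrite ?invg1 // alpha1.
Qed.

Section IntegratedForm.
Variables (E : sepGraph) (S : dynSystem E) (K : fieldType) (c : involution K).
Variable B : functionAlgebra S c.
Variables (D : starAlgebra c) (f : ec_gen E -> D).
Local Notation F := (freeGroup (sg_E E)).
Local Notation lett := (letter (sg_E E)).
Local Notation C := (crossed_product B).
Local Notation coord_ind := (@coord_ind E S K).
Implicit Types (g h k : F) (a b : S -> K) (w : S) (l : lett) (u : seq lett).

(** Together with [f], a covariant pair for the partial action: letters implement
alpha, and rho is normalised by the vertices and their sum. *)
Record covariant (rho : (S -> K) -> D) : Prop := Covariant {
  cov_rep :> function_rep B rho;
  cov_one : rho (fun=> 1) = vertex_sum f;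
  cov_vertex : forall v, rho (coord_ind (inl v)) = f (inl v);
  cov_letter : forall l a, B a -> rho (word_transport [:: l] a) =
    letter_val f l ** rho a ** sstar (letter_val f l) }.

Hypothesis tf : tame f.
Variables (rho : (S -> K) -> D) (cr : covariant rho).
Local Notation wd := (word_val f).

Let B1 : B (fun=> 1) := fa_const B 1.

Lemma cov_one_mul a : B a -> vertex_sum f ** rho a = rho a.
Proof.
move=> Ba; rewrite -(cov_one cr) -(rep_mul cr) //.
by apply: rep_eq => w; rewrite mul1r.
Qed.

Lemma cov_mul_one a : B a -> rho a ** vertex_sum f = rho a.
Proof.
move=> Ba; rewrite -(cov_one cr) -(rep_mul cr) //.
by apply: rep_eq => w; rewrite mulr1.
Qed.

Lemma cov_word u a : B a ->
  rho (word_transport u a) = wd u ** rho a ** sstar (wd u).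
Proof.
move=> Ba; elim: u => [|l u IHu] /=.
  by rewrite (vertex_sum_star tf) cov_one_mul // cov_mul_one.
rewrite word_transport_cons (cov_letter cr); last exact: word_transport_mem.
by rewrite IHu sstarM !smulA.
Qed.

Lemma cov_range_proj u : rho (coord_ind (inr u)) = range_proj f u.
Proof.
rewrite range_projE -{1}(word_one tf u) -(cov_one cr) -cov_word //.
apply: rep_eq => w; rewrite /coord_ind /word_transport /itinerary /=.
by case: theta_word.
Qed.

(** The source projection of e_u commutes with rho(a), since both are in the
image of rho, and is absorbed by e_u. *)
Lemma cov_commute u a : B a -> wd u ** rho a = rho (word_transport u a) ** wd u.
Proof.
move=> Ba; rewrite cov_word // -!smulA.
have -> : sstar (wd u) ** wd u = range_proj f (winv u).
  by rewrite range_projE (word_val_winv tf) sstarK.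
rewrite -cov_range_proj -(rep_mul cr) //; last exact: coord_ind_mem.
have -> : rho (fun w => a w * coord_ind (inr (winv u)) w) =
    range_proj f (winv u) ** rho a.
  rewrite -cov_range_proj -(rep_mul cr) //; last exact: coord_ind_mem.
  by apply: rep_eq => w; rewrite mulrC.
rewrite range_projE (word_val_winv tf) sstarK !smulA -range_projE.
by rewrite (word_partial_isometry tf).
Qed.

Lemma cov_supported u a : B a -> (forall w, ~~ itinerary w (inr u) -> a w = 0) ->
  rho a ** range_proj f u = rho a.
Proof.
move=> Ba a0; rewrite -cov_range_proj -(rep_mul cr) //; last exact: coord_ind_mem.
apply: rep_eq => w; rewrite /coord_ind; case uw: (itinerary w (inr u)).
  by rewrite mulr1.
by rewrite mulr0 a0 // uw.
Qed.

Definition integrated (x : C) : D :=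
  \sum_(g \in [set: F]) (rho ((x : xp B) g) ** wd (val g)).

Lemma integratedE (x : C) (s : seq F) : uniq s ->
  (forall g, g \notin s -> forall w, (x : xp B) g w = 0) ->
  integrated x = \sum_(g <- s) rho ((x : xp B) g) ** wd (val g).
Proof.
move=> us s0; rewrite /integrated (fsbigE s) //.
  by apply: eq_bigl => g; rewrite in_setT.
move=> g _ gs; have -> : (x : xp B) g = fun=> 0 by apply/funext => w; exact: s0.
by rewrite (rep0 cr) smul0l.
Qed.

Lemma xp_mem (x : C) g : B ((x : xp B) g).
Proof. exact: alpha_dom_mem (xp_domP (x : xp B) g). Qed.

Lemma integrated_lin : linear integrated.
Proof.
move=> k x y; have [s us s0] := xp_suppU (x : xp B) y.
have sx g : g \notin s -> forall w, (x : xp B) g w = 0 by move=> /s0 + w => /(_ w)[].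
have sy g : g \notin s -> forall w, (y : xp B) g w = 0 by move=> /s0 + w => /(_ w)[].
rewrite !(@integratedE _ s) //; last first.
  by move=> g gs w; rewrite xpDE xpZE sx // sy // mulr0 addr0.
rewrite scaler_sumr -big_split; apply: eq_bigr => g _ /=.
have -> : rho ((k *: x + y : xp B) g) = k *: rho ((x : xp B) g) + rho ((y : xp B) g).
  by rewrite -(rep_lin cr); [apply: rep_eq | exact: xp_mem | exact: xp_mem].
by rewrite smulDl smulZl.
Qed.

Lemma integrated_mono g a : alpha_dom B g a ->
  integrated (mono B g a) = rho a ** wd (val g).
Proof.
move=> ga; rewrite (@integratedE _ [:: g]) // => [|h].
  rewrite big_seq1; congr (_ ** _); apply: rep_eq => w.
  by rewrite monoE // eqxx.
by rewrite inE => /negbTE hg w; rewrite monoE // hg.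
Qed.

Lemma integrated_sum (I : Type) (s : seq I) (G : I -> C) :
  integrated (\sum_(i <- s) G i) = \sum_(i <- s) integrated (G i).
Proof.
have i0 : integrated 0 = 0.
  by have := integrated_lin (-1) 0 0; rewrite scaler0 addr0 scaleN1r addNr.
apply: (big_morph integrated) => // x y.
by have := integrated_lin 1 x y; rewrite !scale1r.
Qed.

(** After commuting e_g past rho(b), the product e_g e_h is e_(gh) up to a range
projection that the support of the coefficient makes invisible. *)
Lemma integrated_mono_mul g h a b : alpha_dom B g a -> alpha_dom B h b ->
  integrated (mono B g a ** mono B h b) =
  integrated (mono B g a) ** integrated (mono B h b).
Proof.
move=> ga hb; have Ba := alpha_dom_mem ga; have Bb := alpha_dom_mem hb.
rewrite mono_mul // !integrated_mono //; last exact: mono_mul_dom.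
rewrite smulA -(smulA (rho a)) cov_commute // !smulA.
rewrite -(rep_mul cr) //; last exact: word_transport_mem.
rewrite -smulA (word_val_mul tf) smulA cov_supported //.
  exact: fa_mul Ba (word_transport_mem _ Bb).
move=> w; rewrite /itinerary /word_transport /= => ngh.
have wE : winv (val g ++ val h) = winv (val h) ++ winv (val g).
  by rewrite /winv rev_cat map_cat.
have [_ b0] := (alpha_domP _ _ _).1 hb.
move: ngh; rewrite wE /theta_word foldr_cat -/(theta_word (winv (val g)) w).
case: (theta_word (winv (val g)) w) => [w'|] /=; last by rewrite mulr0.
by move=> /b0 ->; rewrite mulr0.
Qed.

Lemma integrated_mono_star g a : alpha_dom B g a ->
  integrated (sstar (mono B g a)) = sstar (integrated (mono B g a)).
Proof.
move=> ga; have Ba := alpha_dom_mem ga.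
rewrite mono_star // !integrated_mono //; last first.
  by apply: alpha_dom_alpha; exact: fa_conj.
rewrite sstarM -(rep_star cr) // -(word_val_winv tf).
by rewrite cov_commute //; exact: fa_conj.
Qed.

Lemma integrated_hom : star_hom integrated.
Proof.
split; first exact: integrated_lin.
- move=> x y; have [s us [_ xE]] := mono_decomposition x.
  have [t ut [_ yE]] := mono_decomposition y.
  rewrite {1}xE {1}yE smul_suml integrated_sum {2}xE {2}yE !integrated_sum smul_suml.
  apply: eq_bigr => g _; rewrite !smul_sumr integrated_sum.
  by apply: eq_bigr => h _; apply: integrated_mono_mul; exact: xp_domP.
- move=> x; have [s us [_ xE]] := mono_decomposition x.
  rewrite {1}xE {2}xE sstar_sum !integrated_sum sstar_sum.
  by apply: eq_bigr => g _; apply: integrated_mono_star; exact: xp_domP.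
Qed.

Lemma integrated_gen i : integrated (crossed_gen B i) = f i.
Proof.
case: i => [v|x] /=.
  rewrite integrated_mono; last exact/alpha_dom1/coord_ind_mem.
  by rewrite (cov_vertex cr) /= (proj_one tf (inl v)).
rewrite integrated_mono; last exact: (coord_ind_letter_dom B (x, true)).
rewrite cov_range_proj (word_val1 tf) -[in LHS](word_val1 tf).
by rewrite (word_partial_isometry tf) (word_val1 tf).
Qed.

End IntegratedForm.

(** * The action of locally constant functions *)

Section CovariantRelations.
Variables (E : sepGraph) (S : dynSystem E) (K : fieldType) (c : involution K).
Variable B : functionAlgebra S c.
Variables (D : starAlgebra c) (f : ec_gen E -> D).
Local Notation coord_ind := (@coord_ind E S K).
Implicit Types (a b : S -> K) (y : D).

(** The graph of a covariant representation. Graphs are easier to produce: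
the cylinder relation and its uniform closure are both given as relations. *)
Record covariant_rel (G : (S -> K) -> D -> Prop) : Prop := CovariantRel {
  crel_total : forall a, B a -> exists y, G a y;
  crel_fun : forall a y y', G a y -> G a y' -> y = y';
  crel_lin : forall (k : K) a b y z, G a y -> G b z ->
    G (fun w => k * a w + b w) (k *: y + z);
  crel_mul : forall a b y z, G a y -> G b z -> G (fun w => a w * b w) (y ** z);
  crel_star : forall a y, G a y -> G (fun w => c (a w)) (sstar y);
  crel_one : G (fun=> 1) (vertex_sum f);
  crel_vertex : forall v, G (coord_ind (inl v)) (f (inl v));
  crel_letter : forall l a y, G a y -> G (word_transport [:: l] a)
    (letter_val f l ** y ** sstar (letter_val f l)) }.

Definition rel_value (G : (S -> K) -> D -> Prop) a : D := xget 0 (G a).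

Variables (G : (S -> K) -> D -> Prop) (cG : covariant_rel G).

Lemma rel_valueE a y : G a y -> rel_value G a = y.
Proof.
by move=> Gay; rewrite /rel_value; apply: xget_unique => // z Gaz; exact: (crel_fun cG Gaz Gay).
Qed.

Lemma rel_valueP a : B a -> G a (rel_value G a).
Proof. by move=> /(crel_total cG)[y Gay]; rewrite (rel_valueE Gay). Qed.

Lemma rel_value_covariant : covariant B f (rel_value G).
Proof.
split; first split.
- move=> k a b /rel_valueP Ba /rel_valueP Bb.
  by apply: rel_valueE; exact: crel_lin.
- move=> a b /rel_valueP Ba /rel_valueP Bb.
  by apply: rel_valueE; exact: crel_mul.
- by move=> a /rel_valueP Ba; apply: rel_valueE; exact: crel_star.
- by apply: rel_valueE; exact: crel_one.
- by move=> v; apply: rel_valueE; exact: crel_vertex.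
- by move=> l a /rel_valueP Ba; apply: rel_valueE; exact: crel_letter.
Qed.

End CovariantRelations.

Section CylinderRelation.
Variables (E : sepGraph) (K : fieldType) (c : involution K).
Variables (D : starAlgebra c) (f : ec_gen E -> D) (tf : tame f).

Lemma cylinder_star F y : cylinder f F y -> cylinder f (fun xi => c (F xi)) (sstar y).
Proof.
elim=> [|i|k {}F {}y F' y' _ C1 _ C2|{}F {}y F' y' _ C1 _ C2].
- apply: cylinder_eq (Cylinder_one f) => [xi|]; first by rewrite rmorph1.
  by rewrite (vertex_sum_star tf).
- apply: cylinder_eq (Cylinder_proj f i) => [xi|]; first by rewrite rmorph_nat.
  by rewrite (proj_of_star tf).
- apply: cylinder_eq (Cylinder_lin (c k) C1 C2) => [xi|].
    by rewrite rmorphD rmorphM.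
  by rewrite sstarD sstarZ.
- apply: cylinder_eq (Cylinder_mul C2 C1) => [xi|]; last by rewrite sstarM.
  by rewrite rmorphM mulrC.
Qed.

Variables (Omega : dynSystem E) (univOmega : universal_system Omega).
Implicit Types (a b : Omega -> K) (y : D).

Definition cylinder_rel a y : Prop :=
  exists2 F, cylinder f F y & a =1 (fun w => F (itinerary w)).

Lemma cylinder_rel_fun a y y' : cylinder_rel a y -> cylinder_rel a y' -> y = y'.
Proof.
move=> [F Fy aF] [F' F'y' aF']; apply/eqP; rewrite -subr_eq0; apply/eqP.
apply: (cylinder_inj tf univOmega (cylinderB Fy F'y')) => w.
by rewrite -aF -aF' subrr.
Qed.

Lemma cylinder_rel_eq a b y : a =1 b -> cylinder_rel a y -> cylinder_rel b y.
Proof. by move/funext ->. Qed.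

Lemma cylinder_rel_lin (k : K) a b y z : cylinder_rel a y -> cylinder_rel b z ->
  cylinder_rel (fun w => k * a w + b w) (k *: y + z).
Proof.
move=> [F Fy aF] [F' F'z bF']; exists (fun xi => k * F xi + F' xi).
  exact: Cylinder_lin.
by move=> w; rewrite aF bF'.
Qed.

Lemma cylinder_rel_mul a b y z : cylinder_rel a y -> cylinder_rel b z ->
  cylinder_rel (fun w => a w * b w) (y ** z).
Proof.
move=> [F Fy aF] [F' F'z bF']; exists (fun xi => F xi * F' xi).
  exact: Cylinder_mul.
by move=> w; rewrite aF bF'.
Qed.

Lemma cylinder_rel_star a y :
  cylinder_rel a y -> cylinder_rel (fun w => c (a w)) (sstar y).
Proof.
move=> [F Fy aF]; exists (fun xi => c (F xi)); first exact: cylinder_star.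
by move=> w; rewrite aF.
Qed.

Lemma cylinder_rel_letter l a y : cylinder_rel a y ->
  cylinder_rel (word_transport [:: l] a)
    (letter_val f l ** y ** sstar (letter_val f l)).
Proof.
move=> [F Fy aF]; have [F' F'y F'E] := cylinder_covariant tf Omega l Fy.
by exists F' => // w; rewrite F'E (funext aF).
Qed.

(** Injectivity of itineraries, hence uniqueness in the universal property of
Omega, enters here. *)
Lemma cylinder_rel_approx (V : Omega -> set Omega) a :
  (forall w, nbhs w (V w)) ->
  exists b y, cylinder_rel b y /\ forall w, exists2 w0, V w0 w & b w = a w0.
Proof.
move=> nV; have [[F y] /= Fy FE] := cylinder_approx f (itinerary_inj univOmega) a nV.
by exists (fun w => F (itinerary w)), y; split=> //; exists F.
Qed.

Lemma cylinder_rel_covariant :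
  covariant_rel (functions_discrete Omega c) f cylinder_rel.
Proof.
split.
- move=> a /discrete_continuousP ca.
  have [b [y [Gby bE]]] := cylinder_rel_approx a ca.
  exists y; apply: cylinder_rel_eq Gby => w.
  by have [w0 /= -> ->] := bE w.
- exact: cylinder_rel_fun.
- exact: cylinder_rel_lin.
- exact: cylinder_rel_mul.
- exact: cylinder_rel_star.
- by exists (fun=> 1) => //; exact: Cylinder_one.
- move=> v; exists (fun xi => (xi (inl v))%:R) => //.
  exact: (Cylinder_proj f (inl v)).
- exact: cylinder_rel_letter.
Qed.

End CylinderRelation.

(** * The universal tame algebra *)

Section LeavittUniversal.
Variables (E : sepGraph) (K : fieldType) (c : involution K).

Definition leavitt_ab_gen : ec_gen E -> leavitt_ab E c :=
  @ideal_proj K c _ _ (@ec_comm_star E K c (leavitt E c) (@leavitt_gen E K c))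
    \o @leavitt_gen E K c.

Lemma leavitt_ab_tame : tame leavitt_ab_gen.
Proof.
apply: tame_hom; first exact: ideal_proj_hom.
- exact: presented_satisfies.
- by move=> x xc; apply/ideal_proj_ker => J _; exact.
Qed.

Lemma leavitt_hom_eq (D : starAlgebra c) (h h' : leavitt E c -> D) :
  star_hom h -> star_hom h' ->
  (forall i, h (@leavitt_gen E K c i) = h' (@leavitt_gen E K c i)) -> h = h'.
Proof.
move=> hh hh' e.
have sh : satisfies (@ec_rel E K) (h \o @leavitt_gen E K c).
  move=> t u tu; rewrite (eval_hom _ t hh) (eval_hom _ u hh); congr h.
  exact: presented_satisfies.
have [h0 [_ h0U]] := presented_univ sh.
by rewrite -(h0U h) // -(h0U h') //; split=> // g; rewrite -[RHS]/(h _) e.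
Qed.

Lemma leavitt_ab_hom_eq (D : starAlgebra c) (h h' : leavitt_ab E c -> D) :
  star_hom h -> star_hom h' ->
  (forall i, h (leavitt_ab_gen i) = h' (leavitt_ab_gen i)) -> h = h'.
Proof.
move=> hh hh' e; apply/funext => x; have [x0 <-] := ideal_proj_surj x.
have := @leavitt_hom_eq _ _ _
  (star_hom_comp (ideal_proj_hom _) hh) (star_hom_comp (ideal_proj_hom _) hh') e.
by move=> /(congr1 (fun k => k x0)).
Qed.

Lemma star_hom_factor (A B D : starAlgebra c) (q : A -> B) (h : A -> D) :
  star_hom q -> (forall y, exists x, q x = y) -> star_hom h ->
  (forall x, q x = 0 -> h x = 0) ->
  exists2 k : B -> D, star_hom k & forall x, k (q x) = h x.
Proof.
move=> hq /choice[r rK] hh ker.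
have hE x y : q x = q y -> h x = h y.
  move=> qxy; apply/eqP; rewrite -subr_eq0 -star_homB //; apply/eqP/ker.
  by rewrite star_homB // qxy subrr.
exists (h \o r) => [|x] /=; last by apply: hE; rewrite rK.
split=> [k x y|x y|x] /=.
- by rewrite -(star_hom_lin hh); apply: hE; rewrite (star_hom_lin hq) !rK.
- by rewrite -(star_hom_mul hh); apply: hE; rewrite (star_hom_mul hq) !rK.
- by rewrite -(star_hom_star hh); apply: hE; rewrite (star_hom_star hq) !rK.
Qed.

Lemma ec_comm_hom (A B : starAlgebra c) (f : ec_gen E -> A) (h : A -> B) x :
  star_hom h -> ec_comm f x -> ec_comm (h \o f) (h x).
Proof.
move=> hh; have img w : subsemigroup [set x | exists e, x = f (inr e) \/
      x = sstar (f (inr e))] w ->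
    subsemigroup [set x | exists e, x = (h \o f) (inr e) \/
      x = sstar ((h \o f) (inr e))] (h w).
  elim=> [y [e ye]|y z _ Uy _ Uz].
    apply: Subsemigroup_gen; exists e; rewrite /= -(star_hom_star hh).
    by case: ye => ->; [left | right].
  by rewrite (star_hom_mul hh); exact: Subsemigroup_mul.
move=> [w [w' [Uw Uw' ->]]]; exists (h w), (h w'); split; try exact: img.
by rewrite star_homB // !(star_hom_mul hh) !(star_hom_star hh).
Qed.

Lemma leavitt_ab_univ (D : starAlgebra c) (f : ec_gen E -> D) : tame f ->
  exists2 h : leavitt_ab E c -> D, star_hom h & forall i, h (leavitt_ab_gen i) = f i.
Proof.
move=> tf; have [h0 [[hh0 h0E] _]] := presented_univ (tame_rel tf).
pose q := ideal_proj (@ec_comm_star E K c (leavitt E c) (@leavitt_gen E K c)).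
have ker x : q x = 0 -> h0 x = 0.
  move=> /ideal_proj_ker x0; suff : [set y | h0 y = 0] x by [].
  apply: x0.
    split=> /= [|k y z y0 z0|a y y0|a y y0]; first exact: (star_hom0 hh0).
    + by rewrite (star_hom_lin hh0) y0 z0 scaler0 addr0.
    + by rewrite (star_hom_mul hh0) y0 smul0r.
    + by rewrite (star_hom_mul hh0) y0 smul0l.
  move=> y /(ec_comm_hom hh0); have -> : h0 \o @leavitt_gen E K c = f by exact/funext.
  exact: (tame_comm tf).
have [h hh hE] := star_hom_factor (ideal_proj_hom _) (@ideal_proj_surj _ _ _ _ _) hh0 ker.
by exists h => // i; rewrite hE; exact: h0E.
Qed.

End LeavittUniversal.

Section Homs.
Variables (E : sepGraph) (K : fieldType) (c : involution K).

Lemma cylinder_hom (A B : starAlgebra c) (f : ec_gen E -> A) (h : A -> B) F y :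
  star_hom h -> cylinder f F y -> cylinder (h \o f) F (h y).
Proof.
move=> hh; elim=> [|i|k {}F {}y F' y' _ C1 _ C2|{}F {}y F' y' _ C1 _ C2].
- apply: cylinder_eq (Cylinder_one _) => //.
  exact: (word_val_hom f [::] hh).
- by apply: cylinder_eq (Cylinder_proj _ i) => //; exact: proj_of_hom.
- by rewrite (star_hom_lin hh); exact: Cylinder_lin.
- by rewrite (star_hom_mul hh); exact: Cylinder_mul.
Qed.

(** The word of a reduced g represents 1_(U_g) delta_g, and a is supported
in U_g. *)
Lemma crossed_mono_factor (S : dynSystem E) (B : functionAlgebra S c) g a :
  alpha_dom B g a ->
  mono B 1%g a ** word_val (crossed_gen B) (val g) = mono B g a.
Proof.
move=> ga; rewrite crossed_word mono1M; first 1 last.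
- exact: alpha_dom_mem ga.
- exact: coord_ind_dom.
apply: mono_eq => [|w]; first exact: fg_word_val.
have /alpha_domP[_ a0] := ga; have [/a0 ->|gw] := boolP (~~ theta g^-1%g w).
  by rewrite mul0r.
rewrite /coord_ind /itinerary; move/negPn: gw; rewrite /theta /=.
by case: theta_word => // w' _; rewrite mulr1.
Qed.

End Homs.

Section UniversalTame.
Variables (E : sepGraph) (Omega : dynSystem E) (univOmega : universal_system Omega).
Variables (K : fieldType) (c : involution K).
Local Notation B := (functions_discrete Omega c).

(** The homomorphism given by the generators sends rho(a) to a delta_1 and e_g to
1_(U_g) delta_g, which makes it inverse to the integrated form. *)
Lemma universal_tame_crossed (L : starAlgebra c) (f : ec_gen E -> L) :
  tame f ->
  (forall g : ec_gen E -> crossed_product B, tame g ->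
     exists2 h : L -> crossed_product B, star_hom h & forall i, h (f i) = g i) ->
  (forall h : L -> L, star_hom h -> (forall i, h (f i) = f i) -> h = id) ->
  star_isomorphic L (crossed_product B).
Proof.
move=> tL univL endL; have tC := crossed_tame B.
have [Phi hPhi PhiE] := univL _ tC.
have cG := cylinder_rel_covariant tL univOmega.
have cr := rel_value_covariant cG.
set rho := rel_value _ in cr.
pose Psi := integrated (B := B) f rho.
have hPsi : star_hom Psi := integrated_hom tL cr.
exists Phi => //; exists Psi.
  have H : Psi \o Phi = id.
    apply: endL => [|i] /=; first exact: star_hom_comp.
    by rewrite PhiE; exact: (integrated_gen tL cr).
  by move=> x; rewrite -[RHS]/(id x) -H.
move=> x; have [s us [_ xE]] := mono_decomposition x.
rewrite {1}xE (star_hom_sum _ _ _ hPsi) (star_hom_sum _ _ _ hPhi) [RHS]xE.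
apply: eq_bigr => g _; have ga := xp_domP (x : xp B) g.
move: ((x : xp B) g) ga => a ga.
rewrite /Psi (integrated_mono cr) // (star_hom_mul hPhi).
have [F Fy aF] := rel_valueP cG (alpha_dom_mem ga).
have PhiG : Phi \o f = crossed_gen B by exact/funext.
have FPhi : cylinder (crossed_gen B) F (Phi (rho a)).
  by rewrite -PhiG; exact: cylinder_hom.
rewrite (crossed_cylinder (star_hom_id _) FPhi).
rewrite -(funext aF) -[Phi (word_val _ _)](word_val_hom _ _ hPhi) PhiG.
exact: crossed_mono_factor.
Qed.

Theorem leavitt_ab_crossed : star_isomorphic (leavitt_ab E c) (crossed_product B).
Proof.
apply: (universal_tame_crossed (leavitt_ab_tame E c)).
  by move=> g tg; exact: leavitt_ab_univ.
move=> h hh hE; apply: (leavitt_ab_hom_eq hh (star_hom_id _)).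
exact: hE.
Qed.

End UniversalTame.

(** * Norms with real values *)

Section ComplexModulus.
Variable R : realType.
Implicit Types (z : R[i]) (r : R).

Lemma Re_ge0K z : 0 <= z -> (complex.Re z)%:C%C = z.
Proof. by case: z => a b; rewrite lecE /= => /andP[/eqP -> _]. Qed.

(** Norms in a C*-algebra over R[i] are values in R[i]; their real parts live in
a totally ordered field. *)
Definition cmod z : R := complex.Re `|z|.

Lemma cmodE z : (cmod z)%:C%C = `|z|. Proof. exact: Re_ge0K. Qed.

Lemma cmod_ge0 z : 0 <= cmod z.
Proof. by rewrite -lecR cmodE; exact: normr_ge0. Qed.

Lemma cmodM z z' : cmod (z * z') = cmod z * cmod z'.
Proof. by apply: complexI; rewrite rmorphM /= !cmodE normrM. Qed.

Lemma cmodD z z' : cmod (z + z') <= cmod z + cmod z'.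
Proof. by rewrite -lecR rmorphD /= !cmodE ler_normD. Qed.

Lemma cmodN z : cmod (- z) = cmod z.
Proof. by rewrite /cmod normrN. Qed.

Lemma cmod_conj z : cmod (conj_involution R z) = cmod z.
Proof. by apply: complexI; rewrite !cmodE norm_conjC. Qed.

Lemma cmod_real r : cmod r%:C%C = `|r|.
Proof. by apply: complexI; rewrite cmodE normc_def /= expr0n addr0 sqrtr_sqr. Qed.

Lemma cmod0 : cmod 0 = 0. Proof. by rewrite /cmod normr0. Qed.
Lemma cmod1 : cmod 1 = 1. Proof. by rewrite /cmod normr1. Qed.

Lemma cmod_eq0 z : cmod z = 0 -> z = 0.
Proof. by move=> z0; apply/eqP; rewrite -normr_eq0 -cmodE z0. Qed.

Lemma conj_mul_self z : conj_involution R z * z = (cmod z ^+ 2)%:C%C.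
Proof. by rewrite rmorphXn /= cmodE normCKC. Qed.

Lemma conj_real r : conj_involution R r%:C%C = r%:C%C.
Proof. by apply/conj_Creal/complex_realP; exists r. Qed.

Lemma half_powers_small (e : R) : 0 < e -> exists n, (2^-1) ^+ n < e.
Proof.
move=> e0; exists (Num.bound e^-1).
have n0 : (0 : R) < 2 ^+ Num.bound e^-1 by rewrite exprn_gt0.
rewrite exprVn invf_plt ?posrE //.
apply: (lt_trans (archi_boundP _)); first by rewrite invr_ge0 ltW.
by rewrite -natrX ltr_nat; exact: ltn_expl.
Qed.

End ComplexModulus.

Section CstarNorm.
Variables (R : realType) (A : cstarAlgebra R).
Implicit Types (x y z : A).

Definition cnorm x : R := complex.Re `|(x : cs_space A)|.

Lemma cnormE x : (cnorm x)%:C%C = `|(x : cs_space A)|. Proof. exact: Re_ge0K. Qed.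

Lemma cnorm_ge0 x : 0 <= cnorm x.
Proof. by rewrite -lecR cnormE; exact: normr_ge0. Qed.

Lemma cnormD x y : cnorm (x + y) <= cnorm x + cnorm y.
Proof. by rewrite -lecR rmorphD /= !cnormE; exact: ler_normD. Qed.

Lemma cnormZ (k : R[i]) x : cnorm (k *: x) = cmod k * cnorm x.
Proof. by apply: complexI; rewrite rmorphM /= !cnormE cmodE; exact: normrZ. Qed.

Lemma cnormN x : cnorm (- x) = cnorm x.
Proof. by apply: complexI; rewrite !cnormE; exact: normrN. Qed.

Lemma cnormB x y : cnorm (x - y) <= cnorm x + cnorm y.
Proof. by rewrite -(cnormN y); exact: cnormD. Qed.

Lemma cnorm_distC x y : cnorm (x - y) = cnorm (y - x).
Proof. by rewrite -cnormN opprB. Qed.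

Lemma cnorm0 : cnorm (0 : A) = 0.
Proof. by apply: complexI; rewrite cnormE; exact: normr0. Qed.

Lemma cnorm_eq0 x : cnorm x = 0 -> x = 0.
Proof.
by move=> x0; have := cnormE x; rewrite x0 => /esym/eqP; rewrite normr_eq0 => /eqP.
Qed.

Lemma cnormM x y : cnorm (x ** y) <= cnorm x * cnorm y.
Proof. by rewrite -lecR rmorphM /= !cnormE; exact: cs_normM. Qed.

Lemma cnormS x : cnorm (sstar x ** x) = cnorm x ^+ 2.
Proof. by apply: complexI; rewrite rmorphXn /= !cnormE; exact: cs_normS. Qed.

Lemma cnorm_star x : cnorm (sstar x) = cnorm x.
Proof.
have le y : cnorm y <= cnorm (sstar y).
  have [y0|y0] := eqVneq (cnorm y) 0; first by rewrite y0 cnorm_ge0.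
  have yp : 0 < cnorm y by rewrite lt_neqAle eq_sym y0 cnorm_ge0.
  rewrite -(ler_pM2r yp); apply: le_trans (cnormM _ _).
  by rewrite cnormS expr2.
by apply/eqP; rewrite eq_le le -{2}(sstarK x) le.
Qed.

Lemma cnorm_small_eq0 x (k : R) :
  0 <= k -> (forall e, 0 < e -> e <= 1 -> cnorm x <= k * e) -> x = 0.
Proof.
move=> k0 xe; apply/cnorm_eq0/eqP; rewrite eq_le cnorm_ge0 andbT.
rewrite leNgt; apply/negP => xp.
have d0 : 0 < cnorm x / (k + cnorm x + 1) by apply: divr_gt0 => //; lra.
have := xe (cnorm x / (k + cnorm x + 1)) d0.
rewrite ler_pdivrMr; last lra.
move=> /(_ ltac:(lra)); rewrite mulrA ler_pdivlMr; last lra.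
by nra.
Qed.

(** Completeness for geometric Cauchy sequences, with the rate of convergence. *)
Lemma cnorm_limit (u : nat -> A) :
  (forall n m, (n <= m)%N -> cnorm (u n - u m) <= (2^-1) ^+ n) ->
  exists l, forall n, cnorm (u n - l) <= (2^-1) ^+ n.
Proof.
move=> uC; have cu : cauchy ((u : nat -> cs_space A) @ \oo).
  apply: cauchy_exP => e e0.
  have eE := Re_ge0K (ltW e0); have re0 : 0 < complex.Re e by rewrite -ltcR eE.
  have [n ne] := half_powers_small re0.
  exists (u n); exists n => // m /= nm; rewrite -ball_normE /=.
  rewrite -[ltLHS]cnormE -eE ltcR; exact: le_lt_trans (uC _ _ nm) ne.
have ul := cauchy_cvg _ cu; set l := lim _ in ul.
exists l => n; apply/ler_addgt0Pr => e e0.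
have e0' : 0 < e%:C%C :> R[i] by rewrite ltcR.
have [N _ Nl] := (cvgrPdist_lt (u : nat -> cs_space A) l).1 (ul _) _ e0'.
have ul_m := Nl (maxn n N) (leq_maxr _ _).
rewrite -[ltLHS]cnormE ltcR in ul_m.
have un_m := uC _ _ (leq_maxl n N).
have := cnormD (u n - u (maxn n N)) (u (maxn n N) - l).
rewrite addrA subrK (cnorm_distC (u (maxn n N)) l) => le; apply: (le_trans le); exact: lerD un_m (ltW ul_m).
Qed.

End CstarNorm.

(** * Real parts of unitaries *)

Section UnitaryTrick.
Variables (R : realType) (A : cstarAlgebra R).
Implicit Types (x y z : A).

(** With k = i or -i: the cross terms k y^*w and -k w^*y cancel. *)
Lemma cnorm_isometry (k : R[i]) y w z :
  conj_involution R k = - k -> - k * k = 1 ->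
  sstar y ** y + sstar w ** w = sstar z ** z -> sstar y ** w = sstar w ** y ->
  cnorm (y + k *: w) = cnorm z.
Proof.
move=> ck kk yw C.
apply/eqP; rewrite -(eqrXn2 (_ : 0 < 2)%N) ?cnorm_ge0 // -!cnormS -yw.
apply/eqP; congr cnorm.
rewrite sstarD sstarZ ck smulDl !smulDr !smulZl !smulZr C scalerA kk scale1r.
by rewrite scaleNr -addrA (addrA (k *: _)) subrr add0r.
Qed.

(** Formally y = 1 - sqrt(1 - x^2), and x is half the sum of the unitaries
x + i(1 - y) and x - i(1 - y). Letting them act on an element z by left
multiplication avoids the unit, which the algebra need not have. *)
Lemma cnorm_unitary x y : sstar x = x -> sstar y = y -> x ** y = y ** x ->
  y + y - y ** y = x ** x -> cnorm x <= 1.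
Proof.
move=> sx sy xy yx.
have le z : cnorm (x ** z) <= cnorm z.
  pose w := z - y ** z.
  have E1 : sstar (x ** z) ** (x ** z) + sstar w ** w = sstar z ** z.
    rewrite /w sstarB !sstarM sx sy smulBl !smulBr.
    have -> : sstar z ** x ** (x ** z) = sstar z ** (y + y - y ** y) ** z.
      by rewrite yx !smulA.
    rewrite smulBr smulDr smulBl smulDl !smulA.
    set p := sstar z ** y ** z; set q := sstar z ** y ** y ** z.
    by rewrite -(addrA (sstar z ** z)) -opprD (addrA p) [LHS]addrC subrK.
  have E2 : sstar (x ** z) ** w = sstar w ** (x ** z).
    by rewrite /w sstarB !sstarM sx sy smulBl smulBr !smulA -(smulA _ x y) xy !smulA.
  have ki : conj_involution R 'i = - 'i := conjCi _.
  have kk : - 'i * 'i = 1 :> R[i] by rewrite mulNr -expr2 sqrCi opprK.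
  have n1 := cnorm_isometry ki kk E1 E2.
  have n2 : cnorm (x ** z + - 'i *: w) = cnorm z.
    by apply: cnorm_isometry E1 E2; rewrite ?rmorphN ?mulrNN ?ki // -kk mulNr mulrN.
  have := cnormD (x ** z + 'i *: w) (x ** z + - 'i *: w).
  rewrite n1 n2 scaleNr addrACA subrr addr0 -mulr2n -scaler_nat cnormZ.
have -> : (2 : R[i]) = (2 : R)%:C%C by rewrite rmorph_nat.
  by rewrite cmod_real normr_nat; lra.
(* For z = x the C*-identity turns |x x| <= |x| into |x| <= 1. *)
have := le x; have := cnormS x; rewrite sx => ->; have := cnorm_ge0 x; nra.
Qed.

(** The element y = 1 - sqrt(1 - x^2) is the fixed point of y |-> (x^2 + y^2) / 2,
which is a contraction by 1/4 on the ball of radius 1/4. *)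
Lemma cstar_half_sqrt x : sstar x = x -> cnorm x <= 2^-1 ->
  exists y, [/\ sstar y = y, x ** y = y ** x & y + y - y ** y = x ** x].
Proof.
move=> sx x2; pose h : R[i] := (2^-1 : R)%:C%C.
have ch z : cnorm (h *: z) = 2^-1 * cnorm z.
  by rewrite cnormZ cmod_real ger0_norm // invr_ge0.
have conj_h : conj_involution R h = h := conj_real _.
have hh z : h *: z + h *: z = z.
  have h2 : (2^-1 : R) + 2^-1 = 1 by lra.
  by rewrite -scalerDl -rmorphD h2 rmorph1 scale1r.
pose b := fix b n : A := if n is n'.+1 then h *: (x ** x + b n' ** b n') else 0.
have bx : cnorm (x ** x) <= 4^-1.
  by apply: le_trans (cnormM _ _) _; have := cnorm_ge0 x; nra.
have bS n : b n.+1 = h *: (x ** x + b n ** b n) by [].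
have b_norm n : cnorm (b n) <= 4^-1.
  elim: n => [|n IHn]; first by rewrite cnorm0; lra.
  rewrite bS ch; have := cnormD (x ** x) (b n ** b n).
  by have := cnormM (b n) (b n); have := cnorm_ge0 (b n); nra.
have b_star n : sstar (b n) = b n.
  elim: n => [|n IHn]; first exact: sstar0.
  by rewrite bS sstarZ conj_h sstarD !sstarM sx IHn.
have b_comm n : x ** b n = b n ** x.
  elim: n => [|n IHn]; first by rewrite /= smul0r smul0l.
  rewrite bS smulZl smulZr smulDl smulDr; congr (_ *: (_ + _)).
    by rewrite smulA.
  by rewrite smulA IHn -smulA IHn smulA.
have b_step n : cnorm (b n.+1 - b n) <= (2^-1) ^+ n.+1.
  elim: n => [|n IHn].
    by rewrite subr0 bS /= smul0l addr0 ch expr1; lra.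
  have -> : b n.+2 - b n.+1 =
      h *: (b n.+1 ** (b n.+1 - b n) + (b n.+1 - b n) ** b n).
    rewrite (bS n.+1) [X in _ - X]bS -scalerBr smulBr smulBl addrA subrK.
    by congr (_ *: _); rewrite opprD addrACA subrr add0r.
  rewrite ch exprS; apply: ler_pM => //; first exact: cnorm_ge0.
  apply: le_trans (cnormD _ _) _.
  have := cnormM (b n.+1) (b n.+1 - b n); have := cnormM (b n.+1 - b n) (b n).
  have := b_norm n; have := b_norm n.+1; have := cnorm_ge0 (b n.+1 - b n).
  by nra.
have b_dist n k : cnorm (b n - b (n + k)%N) <= (2^-1) ^+ n - (2^-1) ^+ (n + k).
  elim: k => [|k IHk]; first by rewrite addn0 !subrr cnorm0.
  have := cnormD (b n - b (n + k)%N) (b (n + k)%N - b (n + k).+1).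
  rewrite addrA subrK (cnorm_distC (b (n + k)%N)) addnS => le.
  have := b_step (n + k)%N; rewrite exprS in IHk *; lra.
have [|y yb] := @cnorm_limit _ _ b.
  move=> n m nm; rewrite -(subnKC nm); apply: le_trans (b_dist _ _) _.
  by rewrite gerBl exprn_ge0 // invr_ge0.
have approx e : 0 < e -> exists n, cnorm (b n - y) <= e /\ cnorm (b n.+1 - y) <= e.
  move=> /half_powers_small[n ne]; exists n; split.
    by apply: le_trans (yb n) _; exact: ltW.
  apply: le_trans (yb n.+1) _; apply: le_trans (ltW ne).
  have p0 : 0 <= (2^-1 : R) ^+ n by rewrite exprn_ge0 // invr_ge0.
  by rewrite exprS; lra.
exists y; split.
- apply/eqP; rewrite -subr_eq0; apply/eqP.
  apply: (@cnorm_small_eq0 _ _ _ 2) => // e e0 _.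
  have [n [ne _]] := approx e e0.
  have -> : sstar y - y = (b n - y) - sstar (b n - y).
    by rewrite sstarB b_star opprB [RHS]addrC addrA subrK.
  by apply: le_trans (cnormB _ _) _; rewrite cnorm_star; lra.
- apply/eqP; rewrite -subr_eq0; apply/eqP.
  apply: (@cnorm_small_eq0 _ _ _ (2 * cnorm x)) => [|e e0 _].
    by have := cnorm_ge0 x; lra.
  have [n [ne _]] := approx e e0.
  have -> : x ** y - y ** x = (b n - y) ** x - x ** (b n - y).
    by rewrite smulBl smulBr b_comm opprB [RHS]addrC addrA subrK.
  apply: le_trans (cnormB _ _) _.
  have := cnormM (b n - y) x; have := cnormM x (b n - y); have := cnorm_ge0 x; nra.
- apply/eqP; rewrite -subr_eq0; apply/eqP.
  apply: (@cnorm_small_eq0 _ _ _ (3 + 2 * cnorm y)) => [|e e0 e1].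
    by have := cnorm_ge0 y; lra.
  have [n [ne ne1]] := approx e e0.
  have b2 : b n.+1 + b n.+1 = x ** x + b n ** b n by rewrite bS hh.
  have -> : y + y - y ** y - x ** x =
     (b n ** (b n - y) + (b n - y) ** y) - ((b n.+1 - y) + (b n.+1 - y)).
    rewrite smulBr smulBl addrA subrK [X in _ = _ - X]addrACA b2 -opprD.
    set t := y + y; rewrite opprB opprD [RHS]addrC -!addrA addKr.
    by rewrite [- (y ** y) + _]addrC.
  apply: le_trans (cnormB _ _) _.
  have := cnormD (b n ** (b n - y)) ((b n - y) ** y).
  have := cnormD (b n.+1 - y) (b n.+1 - y).
  have := cnormM (b n) (b n - y); have := cnormM (b n - y) y.
  have := b_norm n; have := cnorm_ge0 y; have := cnorm_ge0 (b n - y); nra.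
Qed.

End UnitaryTrick.

(** * Boundedness of homomorphisms *)

Section BoundedHoms.
Variables (R : realType) (A D : cstarAlgebra R) (phi : A -> D).
Hypothesis hphi : star_hom phi.
Implicit Types (x y : A).

(** After scaling the norm of [x] to 1/2 there is a square root as above, and
its image exhibits the image of [x] as the real part of a unitary. *)
Lemma star_hom_selfadjoint_bounded x : sstar x = x -> cnorm (phi x) <= 2 * cnorm x.
Proof.
move=> sx; have [x0|nx0] := eqVneq (cnorm x) 0.
  by rewrite (cnorm_eq0 x0) (star_hom0 hphi) !cnorm0 mulr0.
have xp : 0 < cnorm x by rewrite lt_neqAle eq_sym nx0 cnorm_ge0.
pose t := (2 * cnorm x)^-1; have t0 : 0 < t by rewrite invr_gt0; lra.
pose x' := t%:C%C *: x.
have sx' : sstar x' = x' by rewrite sstarZ sx conj_real.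
have nx' : cnorm x' <= 2^-1.
  by rewrite cnormZ cmod_real gtr0_norm // /t invfM -mulrA mulVf // mulr1.
have [y [sy xy yy]] := cstar_half_sqrt sx' nx'.
have : cnorm (phi x') <= 1.
  apply: (@cnorm_unitary _ _ _ (phi y)).
  - by rewrite -(star_hom_star hphi) sx'.
  - by rewrite -(star_hom_star hphi) sy.
  - by rewrite -!(star_hom_mul hphi) xy.
  - by rewrite -!(star_hom_mul hphi) -star_homD // -star_homB // yy.
rewrite star_homZ // cnormZ cmod_real gtr0_norm // /t.
by rewrite ler_pdivrMl ?mulr1 //; lra.
Qed.

(** Reduction to the self-adjoint case by the C*-identity. *)
Lemma star_hom_bounded x : cnorm (phi x) <= 2 * cnorm x.
Proof.
have := @star_hom_selfadjoint_bounded (sstar x ** x) _.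
rewrite (star_hom_mul hphi) (star_hom_star hphi) !cnormS sstarM sstarK.
move=> /(_ erefl) le; have := cnorm_ge0 x; have := cnorm_ge0 (phi x).
by move: (cnorm x) (cnorm (phi x)) le => s t; nra.
Qed.

Lemma star_hom_kernel_closed : @closed (cs_space A) [set x | phi x = 0].
Proof.
move=> x clx; apply: (@cnorm_small_eq0 _ _ _ 2) => // e e0 _.
have e0' : 0 < e%:C%C :> R[i] by rewrite ltcR.
have [y [/= y0 xy]] := clx _ (nbhsx_ballx x _ e0').
have -> : phi x = phi (x - y) by rewrite star_homB // y0 subr0.
apply: le_trans (star_hom_bounded _) _; rewrite ler_pM2l //.
by move: xy; rewrite -ball_normE /= -[ltLHS]cnormE ltcR => /ltW.
Qed.

Lemma star_hom_kernel_ideal : is_ideal [set x | phi x = 0].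
Proof.
split=> /= [|k x y x0 y0|a x x0|a x x0]; first exact: (star_hom0 hphi).
- by rewrite (star_hom_lin hphi) x0 y0 scaler0 addr0.
- by rewrite (star_hom_mul hphi) x0 smul0r.
- by rewrite (star_hom_mul hphi) x0 smul0l.
Qed.

End BoundedHoms.

Section FunctionRepresentationNorm.
Variables (R : realType) (T : topologicalType) (D : cstarAlgebra R).
Variable B : functionAlgebra T (conj_involution R).
Hypothesis Bsqrt : forall a, B a ->
  B (fun w => (Num.sqrt (1 - complex.Re (a w) ^+ 2))%:C%C).
Variables (rho : (T -> R[i]) -> D) (rr : function_rep B rho).

(** In a function algebra closed under the square root, 1 - sqrt(1 - r^2) is
available as a function. *)
Lemma rep_real_contractive (r : T -> R) :
  B (fun w => (r w)%:C%C) -> (forall w, `|r w| <= 1) ->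
  cnorm (rho (fun w => (r w)%:C%C)) <= 1.
Proof.
move=> Br r1; pose s w := Num.sqrt (1 - r w ^+ 2).
have Bs : B (fun w => (s w)%:C%C) by exact: Bsqrt Br.
have Bb : B (fun w => (1 - s w)%:C%C).
  have := fa_add (fa_const B 1) (fa_mul (fa_const B (-1)) Bs).
  by congr (fa_mem _ _); apply/funext => w; rewrite mulN1r rmorphB.
have rep_real (p : T -> R) : B (fun w => (p w)%:C%C) ->
    sstar (rho (fun w => (p w)%:C%C)) = rho (fun w => (p w)%:C%C).
  move=> Bp; rewrite -(rep_star rr) //; apply: rep_eq => w; exact: conj_real.
apply: (@cnorm_unitary _ _ _ (rho (fun w => (1 - s w)%:C%C))).
- exact: rep_real.
- exact: rep_real.
- by rewrite -!(rep_mul rr) //; apply: rep_eq => w; rewrite mulrC.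
rewrite -[X in X + _ - _]scale1r -(@rep_lin _ _ _ _ _ _ rr 1 _ _ Bb Bb) -(rep_mul rr Bb Bb) -(rep_mul rr Br Br).
rewrite -(repB rr); last 2 first.
- exact: fa_add (fa_mul (fa_const B 1) Bb) Bb.
- exact: (fa_mul Bb Bb).
apply: rep_eq => w; rewrite mul1r -!rmorphM -rmorphD -rmorphB; congr (_%:C)%C.
have s2 : s w ^+ 2 = 1 - r w ^+ 2.
  by apply: sqr_sqrtr; rewrite subr_ge0 -real_normK ?num_real // expr_le1.
have -> : r w * r w = 1 - s w * s w by rewrite -!expr2 s2; ring.
by ring.
Qed.

Let realM (p q : R) : (p * q)%:C%C = p%:C%C * q%:C%C := rmorphM _ p q.

(** The C*-identity reduces to the real function |a|^2 / M^2. *)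
Lemma rep_contractive a (M : R) :
  B a -> 0 <= M -> (forall w, cmod (a w) <= M) -> cnorm (rho a) <= M.
Proof.
move=> Ba M0 aM; have [M00|nM0] := eqVneq M 0.
  have -> : a = fun=> 0.
    apply/funext => w; apply/cmod_eq0/eqP.
    by rewrite eq_le cmod_ge0 andbT -M00 aM.
  by rewrite (rep0 rr) cnorm0.
have Mp : 0 < M by rewrite lt_neqAle eq_sym nM0.
have Bn : B (fun w => conj_involution R (a w) * a w) by exact: fa_mul (fa_conj Ba) Ba.
pose k w := M ^- 2 * cmod (a w) ^+ 2.
have Bk : B (fun w => (k w)%:C%C).
  have := fa_mul (fa_const B (M ^- 2)%:C%C) Bn.
  by congr (fa_mem _ _); apply/funext => w; rewrite conj_mul_self -realM.
have k1 : cnorm (rho (fun w => (k w)%:C%C)) <= 1.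
  apply: rep_real_contractive => // w.
  rewrite ger0_norm ?mulr_ge0 ?invr_ge0 ?sqr_ge0 ?cmod_ge0 //.
  rewrite ler_pdivrMl ?exprn_gt0 // mulr1.
  by rewrite ler_sqr ?nnegrE ?cmod_ge0.
have kE : rho (fun w => (k w)%:C%C) =
    (M ^- 2)%:C%C *: (sstar (rho a) ** rho a).
  rewrite -(rep_star rr) // -(rep_mul rr) //; last exact: fa_conj.
  rewrite -(repZ rr) //; apply: rep_eq => w.
  by rewrite conj_mul_self -realM.
move: k1; rewrite kE cnormZ cmod_real cnormS ger0_norm ?invr_ge0 ?sqr_ge0 //.
rewrite ler_pdivrMl ?exprn_gt0 // mulr1.
by rewrite ler_sqr ?nnegrE ?cnorm_ge0.
Qed.

End FunctionRepresentationNorm.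

(** * The action of continuous functions *)

Section SqrtClosed.
Variables (R : realType) (T : topologicalType).
Implicit Types a : T -> R[i].

Lemma discrete_sqrt a : functions_discrete T (conj_involution R) a ->
  functions_discrete T (conj_involution R)
    (fun w => (Num.sqrt (1 - complex.Re (a w) ^+ 2))%:C%C).
Proof.
move=> /discrete_continuousP ca; apply/discrete_continuousP => w.
by apply: filterS (ca w) => w' ->.
Qed.

Lemma complex_cmod_near a w (e : R) : functions_complex T R a -> 0 < e ->
  \forall w' \near w, cmod (a w' - a w) < e.
Proof.
move=> ca e0; have e0' : 0 < e%:C%C :> R[i] by rewrite ltcR.
have /cvgrPdist_lt/(_ _ e0') := ca w; apply: filterS => w'.
by rewrite -cmodE ltcR -[a w - _]opprB cmodN.
Qed.

Lemma complex_sqrt a : functions_complex T R a ->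
  functions_complex T R (fun w => (Num.sqrt (1 - complex.Re (a w) ^+ 2))%:C%C).
Proof.
move=> ca w.
have cRe : (fun w => complex.Re (a w)) @ w --> complex.Re (a w).
  apply/cvgrPdist_lt => e e0; apply: filterS (complex_cmod_near w ca e0) => w'.
  apply: le_lt_trans; rewrite distrC -lecR cmodE.
  have -> : complex.Re (a w') - complex.Re (a w) = complex.Re (a w' - a w).
    by case: (a w') => ? ?; case: (a w).
  exact: normc_ge_Re.
have cs : (fun w => Num.sqrt (1 - complex.Re (a w) ^+ 2)) @ w -->
    Num.sqrt (1 - complex.Re (a w) ^+ 2).
  have cq : (fun w => 1 - complex.Re (a w) ^+ 2) @ w --> 1 - complex.Re (a w) ^+ 2.
    by apply: cvgB; [exact: cvg_cst | rewrite expr2; exact: cvgM].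
  apply: (cvg_comp _ _ cq); exact: sqrt_continuous.
apply/cvgrPdist_lt => e e0; have eE := Re_ge0K (ltW e0).
have re0 : 0 < complex.Re e by rewrite -ltcR eE.
have /cvgrPdist_lt/(_ _ re0) := cs; apply: filterS => w' lt.
by rewrite -eE -rmorphB -cmodE cmod_real ltcR.
Qed.

End SqrtClosed.

Section UniformClosure.
Variables (E : sepGraph) (R : realType).
Local Notation c := (conj_involution R).
Variables (D : cstarAlgebra R) (f : ec_gen E -> D) (tf : tame f).
Variables (Omega : dynSystem E) (univOmega : universal_system Omega).
Local Notation rel := (@cylinder_rel E R[i] c D f Omega).
Implicit Types (a b : Omega -> R[i]) (y z : D) (e M : R).

Lemma cylinder_rel_contractive a y M : rel a y -> 0 <= M ->
  (forall w, cmod (a w) <= M) -> cnorm y <= M.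
Proof.
move=> ay M0 aM; have cG := cylinder_rel_covariant tf univOmega.
rewrite -(rel_valueE cG ay).
apply: (rep_contractive (@discrete_sqrt R Omega) (rel_value_covariant cG)) => //.
by have [F Fy aF] := ay; rewrite (funext aF); exact: cylinder_mem Fy.
Qed.

Lemma cylinder_rel_distance a b y z M : rel a y -> rel b z -> 0 <= M ->
  (forall w, cmod (a w - b w) <= M) -> cnorm (y - z) <= M.
Proof.
move=> ay bz M0 abM.
apply: (@cylinder_rel_contractive (fun w => (-1) * b w + a w)) => //.
  by have := cylinder_rel_lin (-1) bz ay; rewrite scaleN1r addrC.
by move=> w; rewrite mulN1r addrC.
Qed.

(** The closure of the cylinder relation for the supremum norm on functions and
the norm of the algebra. *)
Definition uniform_rel a y : Prop := forall e, 0 < e ->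
  exists b z, [/\ rel b z, forall w, cmod (a w - b w) <= e & cnorm (y - z) <= e].

(** Estimates up to a constant factor and for small e suffice. *)
Lemma uniform_relI k a y : 0 <= k ->
  (forall e, 0 < e -> e <= 1 -> exists b z,
    [/\ rel b z, forall w, cmod (a w - b w) <= k * e & cnorm (y - z) <= k * e]) ->
  uniform_rel a y.
Proof.
move=> k0 H e e0; pose d := Num.min 1 (e / (k + 1)).
have d0 : 0 < d by rewrite lt_min ltr01 divr_gt0 //; lra.
have d1 : d <= 1 by rewrite ge_min lexx.
have kd : k * d <= e.
  have : d <= e / (k + 1) by rewrite ge_min lexx orbT.
  by rewrite ler_pdivlMr; [nra | lra].
have [b [z [bz ab yz]]] := H d d0 d1; exists b, z; split=> // [w|].
  exact: le_trans (ab w) kd.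
exact: le_trans yz kd.
Qed.

Lemma uniform_rel_cylinder a y : rel a y -> uniform_rel a y.
Proof.
move=> ay e e0; exists a, y; split=> // [w|]; rewrite subrr ?cmod0 ?cnorm0 ltW //.
Qed.

Lemma uniform_rel_distance a y b z M : uniform_rel a y -> rel b z -> 0 <= M ->
  (forall w, cmod (a w - b w) <= M) -> cnorm (y - z) <= M.
Proof.
move=> ay bz M0 abM; apply/ler_addgt0Pr => e e0.
have e2 : 0 < e / 2 by rewrite divr_gt0.
have [b' [z' [bz' ab' yz']]] := ay _ e2.
have zz' : cnorm (z' - z) <= M + e / 2.
  apply: (cylinder_rel_distance bz' bz) => [|w]; first lra.
  have := cmodD (b' w - a w) (a w - b w); rewrite addrA subrK.
  by have := ab' w; rewrite -cmodN opprB => ? ?; have := abM w; lra.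
have := cnormD (y - z') (z' - z); rewrite addrA subrK; lra.
Qed.

Lemma uniform_rel_fun a y y' : uniform_rel a y -> uniform_rel a y' -> y = y'.
Proof.
move=> ay ay'; apply/eqP; rewrite -subr_eq0; apply/eqP.
apply: (@cnorm_small_eq0 _ _ _ 2) => // e e0 _.
have [b [z [bz ab yz']]] := ay' e e0.
have yz := uniform_rel_distance ay bz (ltW e0) ab.
have := cnormB (y - z) (y' - z); rewrite opprB addrA subrK; lra.
Qed.

Lemma cylinder_bounded F y : cylinder f F y ->
  exists2 M, 0 <= M & forall xi, cmod (F xi) <= M.
Proof.
elim=> [|i|k {}F {}y F' y' _ [M M0 FM] _ [M' M'0 FM']|
        {}F {}y F' y' _ [M M0 FM] _ [M' M'0 FM']].
- by exists 1 => // xi; rewrite cmod1.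
- by exists 1 => // xi; case: (xi i); rewrite ?cmod1 ?cmod0.
- exists (cmod k * M + M') => [|xi]; first by rewrite addr_ge0 ?mulr_ge0 ?cmod_ge0.
  apply: le_trans (cmodD _ _) _; rewrite cmodM lerD //.
  by rewrite ler_wpM2l ?cmod_ge0.
- exists (M * M') => [|xi]; first exact: mulr_ge0.
  by rewrite cmodM; apply: ler_pM; rewrite ?cmod_ge0.
Qed.

Lemma uniform_rel_bounded a y : uniform_rel a y ->
  exists2 M, 0 <= M & forall w, cmod (a w) <= M.
Proof.
move=> /(_ 1 ltr01)[b [z [[F Fz bF] ab _]]].
have [M M0 FM] := cylinder_bounded Fz; exists (M + 1) => [|w]; first lra.
have := cmodD (a w - b w) (b w); rewrite subrK.
by have := ab w; have := FM (itinerary w); rewrite -bF; lra.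
Qed.

(** Cylinder functions approximate [a] at geometric speed, and by contractivity
their values in [D] form a Cauchy sequence. *)
Lemma uniform_rel_total a : functions_complex Omega R a -> exists y, uniform_rel a y.
Proof.
move=> ca.
have /choice[bz bzP] : forall n : nat, exists bz : (Omega -> R[i]) * D,
    rel bz.1 bz.2 /\ forall w, cmod (a w - bz.1 w) <= (2^-1) ^+ n.+1.
  move=> n; have e0 : (0 : R) < (2^-1) ^+ n.+1 by rewrite exprn_gt0 // invr_gt0.
  have [b [z [bz bE]]] := cylinder_rel_approx f univOmega
    (V := fun w => [set w' | cmod (a w' - a w) < (2^-1) ^+ n.+1]) a
    (fun w => complex_cmod_near w ca e0).
  by exists (b, z); split=> // w /=; have [w0 /= /ltW + ->] := bE w.
have [|y yz] := @cnorm_limit _ _ (fun n => (bz n).2).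
  move=> n m nm; have [bn an] := bzP n; have [bm am] := bzP m.
  have p0 k : (0 : R) <= (2^-1) ^+ k by rewrite exprn_ge0 // invr_ge0.
  apply: (cylinder_rel_distance bn bm) => // w.
  have := cmodD ((bz n).1 w - a w) (a w - (bz m).1 w); rewrite addrA subrK.
  have := an w; rewrite -cmodN opprB; have := am w.
  have : (2^-1 : R) ^+ m <= (2^-1) ^+ n.
    by apply: ler_wiXn2l => //; lra.
  by rewrite !exprS; have := p0 n; lra.
exists y => e e0; have [n ne] := half_powers_small e0; have [bn an] := bzP n.
exists (bz n).1, (bz n).2; split=> // [w|].
  apply: le_trans (an w) _; rewrite exprS.
  have : (0 : R) <= (2^-1) ^+ n by rewrite exprn_ge0 // invr_ge0.
  by lra.
by rewrite cnorm_distC; apply: le_trans (yz n) _; exact: ltW.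
Qed.

Lemma uniform_rel_lin (k : R[i]) a b y z : uniform_rel a y -> uniform_rel b z ->
  uniform_rel (fun w => k * a w + b w) (k *: y + z).
Proof.
move=> ay bz; apply: (@uniform_relI (cmod k + 1)) => [|e e0 _].
  by have := cmod_ge0 k; lra.
have [a' [y' [ay' aa' yy']]] := ay e e0; have [b' [z' [bz' bb' zz']]] := bz e e0.
exists (fun w => k * a' w + b' w), (k *: y' + z'); split=> [|w|].
- exact: cylinder_rel_lin.
- rewrite opprD addrACA -mulrBr; apply: le_trans (cmodD _ _) _.
  rewrite cmodM mulrDl mul1r lerD // ler_wpM2l ?cmod_ge0 //.
- rewrite opprD addrACA -scalerBr; apply: le_trans (cnormD _ _) _.
  by rewrite cnormZ mulrDl mul1r lerD // ler_wpM2l ?cmod_ge0.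
Qed.

Lemma uniform_rel_mul a b y z : uniform_rel a y -> uniform_rel b z ->
  uniform_rel (fun w => a w * b w) (y ** z).
Proof.
move=> ay bz; have [M M0 aM] := uniform_rel_bounded ay.
have [N N0 bN] := uniform_rel_bounded bz.
apply: (@uniform_relI (M + N + 1 + cnorm y + cnorm z)) => [|e e0 e1].
  by have := cnorm_ge0 y; have := cnorm_ge0 z; lra.
have [a' [y' [ay' aa' yy']]] := ay e e0; have [b' [z' [bz' bb' zz']]] := bz e e0.
have cy := cnorm_ge0 y; have cz := cnorm_ge0 z.
exists (fun w => a' w * b' w), (y' ** z'); split=> [|w|].
- exact: cylinder_rel_mul.
- have -> : a w * b w - a' w * b' w =
      (a w - a' w) * b w + (a w * (b w - b' w) - (a w - a' w) * (b w - b' w)) by ring.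
  apply: le_trans (cmodD _ _) _; rewrite cmodM.
  have := cmodD (a w * (b w - b' w)) (- ((a w - a' w) * (b w - b' w))).
  rewrite cmodN !cmodM.
  have := aa' w; have := bb' w; have := aM w; have := bN w.
  have := cmod_ge0 (a w); have := cmod_ge0 (b w).
  have := cmod_ge0 (a w - a' w); have := cmod_ge0 (b w - b' w).
  move: (cmod (a w)) (cmod (b w)) (cmod (a w - a' w)) (cmod (b w - b' w)) => p q r s.
  move=> s0 r0 q0 p0 qN pM se re.
  have : r * q <= e * N by apply: ler_pM.
  have : p * s <= M * e by apply: ler_pM.
  have : r * s <= e * 1 by apply: ler_pM => //; lra.
  by nra.
- have -> : y ** z - y' ** z' = (y - y') ** z + y' ** (z - z').
    by rewrite smulBl smulBr addrA subrK.
  apply: le_trans (cnormD _ _) _.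
  have := cnormM (y - y') z; have := cnormM y' (z - z').
  have := cnormB y (y - y'); rewrite opprB addrC subrK.
  have := cnorm_ge0 (y - y'); have := cnorm_ge0 (z - z'); have := cnorm_ge0 y'.
  move: (cnorm (y - y')) (cnorm (z - z')) (cnorm y') yy' zz' => r s t re se t0 s0 r0 ty.
  have : r * cnorm z <= e * cnorm z by rewrite ler_wpM2r.
  have : t * s <= (cnorm y + 1) * e by apply: ler_pM => //; lra.
  by nra.
Qed.

Lemma uniform_rel_star a y :
  uniform_rel a y -> uniform_rel (fun w => c (a w)) (sstar y).
Proof.
move=> ay e e0; have [b [z [bz ab yz]]] := ay e e0.
exists (fun w => c (b w)), (sstar z); split=> [|w|].
- exact: cylinder_rel_star.
- by rewrite -rmorphB cmod_conj.
- by rewrite -sstarB cnorm_star.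
Qed.

Lemma uniform_rel_letter l a y : uniform_rel a y ->
  uniform_rel (word_transport [:: l] a)
    (letter_val f l ** y ** sstar (letter_val f l)).
Proof.
move=> ay; set x := letter_val f l.
apply: (@uniform_relI (1 + cnorm x * cnorm x)) => [|e e0 _].
  by rewrite addr_ge0 // mulr_ge0 ?cnorm_ge0.
have xx0 : 0 <= cnorm x * cnorm x * e by rewrite !mulr_ge0 ?cnorm_ge0 // ltW.
have [b [z [bz ab yz]]] := ay e e0.
exists (word_transport [:: l] b), (x ** z ** sstar x); split=> [|w|].
- exact: cylinder_rel_letter.
- rewrite /word_transport; case: theta_word => [w'|]; last by rewrite subrr cmod0; lra.
  by have := ab w'; lra.
- rewrite -smulBl -smulBr; apply: le_trans (cnormM _ _) _; rewrite cnorm_star.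
  have : cnorm (x ** (y - z)) <= cnorm x * e.
    by apply: le_trans (cnormM _ _) _; rewrite ler_wpM2l ?cnorm_ge0.
  move=> le; have : cnorm (x ** (y - z)) * cnorm x <= cnorm x * e * cnorm x.
    by rewrite ler_wpM2r ?cnorm_ge0.
  by rewrite -(mulrA _ e) (mulrC e) mulrA; lra.
Qed.

Lemma uniform_rel_covariant :
  covariant_rel (functions_complex Omega R) f uniform_rel.
Proof.
have cG := cylinder_rel_covariant tf univOmega; split.
- exact: uniform_rel_total.
- exact: uniform_rel_fun.
- exact: uniform_rel_lin.
- exact: uniform_rel_mul.
- exact: uniform_rel_star.
- exact/uniform_rel_cylinder/(crel_one cG).
- by move=> v; exact/uniform_rel_cylinder/(crel_vertex cG).
- exact: uniform_rel_letter.
Qed.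

End UniformClosure.

(** * The C*-algebraic isomorphism *)

Section CstarPart.
Variables (E : sepGraph) (Omega : dynSystem E) (univOmega : universal_system Omega).
Variable R : realType.
Local Notation c := (conj_involution R).
Local Notation B := (functions_complex Omega R).
Local Notation C := (crossed_product B).

(** Both sides are continuous in [a], the left because [h] is bounded and the
right because [sigma] is contractive, and they agree on cylinder functions. *)
Lemma uniform_rel_hom (D D' : cstarAlgebra R) (f : ec_gen E -> D)
    (h : D -> D') (sigma : (Omega -> R[i]) -> D') a y :
  star_hom h -> function_rep B sigma ->
  (forall b z, cylinder_rel f b z -> h z = sigma b) ->
  B a -> uniform_rel f a y -> h y = sigma a.
Proof.
move=> hh sr hs Ba ay; apply/eqP; rewrite -subr_eq0; apply/eqP.
apply: (@cnorm_small_eq0 _ _ _ 3) => // e e0 _.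
have [b [z [bz ab yz]]] := ay e e0.
have Bb : B b by have [F Fz bF] := bz; rewrite (funext bF); exact: cylinder_mem Fz.
have Bab : B (fun w => a w - b w).
  have := fa_add Ba (fa_mul (fa_const B (-1)) Bb).
  by congr (fa_mem _ _); apply/funext => w; rewrite mulN1r.
have -> : h y - sigma a = h (y - z) - sigma (fun w => a w - b w).
  by rewrite (repB sr Ba Bb) (star_homB hh) (hs b z bz) opprB addrA subrK.
apply: le_trans (cnormB _ _) _.
have ->: 3 * e = 2 * e + e by rewrite -{3}[e]mul1r -mulrDl -natr1.
apply: lerD (rep_contractive (@complex_sqrt R Omega) sr Bab (ltW e0) ab).
by apply: le_trans (star_hom_bounded hh _) _; rewrite ler_pM2l.
Qed.

(** The two composites are the identity: on O because the generators are fixed,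
on P because j(a delta_g) is fixed for every a and g. *)
Theorem cstar_crossed (A : cstarAlgebra R) (f : ec_gen E -> A)
    (O : cstarAlgebra R) (q : A -> O) (P : cstarAlgebra R) (j : C -> P) :
  universal_cstar (@ec_rel E R[i]) f -> cstar_quotient (ec_comm f) q ->
  universal_completion j -> star_isomorphic O P.
Proof.
move=> [rf univ] [hq q_surj q_ker] [hj univj].
have tC := crossed_tame B.
have commq x : ec_comm f x -> q x = 0.
  by move=> xc; apply/q_ker => J _ _; exact.
have tq : tame (q \o f) := tame_hom hq rf commq.
have tj : tame (j \o crossed_gen B).
  apply: (tame_hom hj (tame_rel tC)) => x /(tame_comm tC) ->.
  exact: (star_hom0 hj).
have [phi0 [[hphi0 phi0E] _]] := univ P _ (tame_rel tj).
have phi0f : phi0 \o f = j \o crossed_gen B by exact/funext.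
have [phi hphi phiE] : exists2 phi : O -> P, star_hom phi & forall x, phi (q x) = phi0 x.
  apply: (star_hom_factor hq q_surj hphi0) => x /q_ker x0.
  apply: (x0 [set x | phi0 x = 0] (star_hom_kernel_ideal hphi0)
    (star_hom_kernel_closed hphi0)) => y /(ec_comm_hom hphi0).
  by rewrite phi0f; exact: (tame_comm tj).
have cG := uniform_rel_covariant tq univOmega.
have cr := rel_value_covariant cG; set rho := rel_value _ in cr.
have hpsi0 : star_hom (integrated (B := B) (q \o f) rho) := integrated_hom tq cr.
have [psi [[hpsi psiE] _]] := univj O _ hpsi0.
have phipsi : phi \o psi = id.
  have [k [_ kU]] := univj P j hj.
  rewrite -(kU (phi \o psi)).
    by apply: kU; split=> //; exact: star_hom_id.
  split; first exact: star_hom_comp hpsi hphi.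
  move=> x /=; rewrite psiE; have [s us [_ xE]] := mono_decomposition x.
  rewrite xE (star_hom_sum _ _ _ hpsi0) (star_hom_sum _ _ _ hphi) (star_hom_sum _ _ _ hj).
  apply: eq_bigr => g _; have ga := xp_domP (x : xp B) g.
  move: ((x : xp B) g) ga => a ga; have Ba := alpha_dom_mem ga.
  rewrite (integrated_mono cr) // (star_hom_mul hphi).
  have phif i : phi ((q \o f) i) = j (crossed_gen B i) by rewrite /= phiE phi0E.
  have phiqf : phi \o (q \o f) = j \o crossed_gen B by exact/funext.
  have jr : function_rep B (j \o mono B 1%g) := rep_hom hj (mono1_rep B).
  have hcyl b z : cylinder_rel (q \o f) b z -> phi z = (j \o mono B 1%g) b.
    move=> [F Fz /funext ->]; have := cylinder_hom hphi Fz; rewrite phiqf.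
    exact: crossed_cylinder.
  rewrite (uniform_rel_hom hphi jr hcyl Ba (rel_valueP cG Ba)).
  rewrite -(word_val_hom _ _ hphi) phiqf (word_val_hom _ _ hj) -(star_hom_mul hj).
  by rewrite crossed_mono_factor.
have psiphi : psi \o phi \o q = q.
  have [k [_ kU]] := univ O (q \o f) (tame_rel tq).
  have kq : k = q by apply: kU; split.
  rewrite -[RHS]kq; apply/esym/kU; split.
    exact: (star_hom_comp hq (star_hom_comp hphi hpsi)).
  move=> i /=; rewrite phiE phi0E /= psiE.
  exact: (integrated_gen tq cr).
exists phi => //; exists psi => y.
  by have [x <-] := q_surj y; rewrite -[LHS]/((psi \o phi \o q) x) psiphi.
by rewrite -[LHS]/((phi \o psi) y) phipsi.
Qed.

End CstarPart.

Theorem corollary6p12 (E : sepGraph) (bipE : bipartite E)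
    (Omega : dynSystem E) (univOmega : universal_system Omega) :
  (forall (K : fieldType) (c : involution K),
     star_isomorphic (leavitt_ab E c)
                     (crossed_product (functions_discrete Omega c)))
  /\
  (forall (R : realType)
     (A : cstarAlgebra R) (f : ec_gen E -> A)
     (O : cstarAlgebra R) (q : A -> O)
     (P : cstarAlgebra R) (j : crossed_product (functions_complex Omega R) -> P),
     universal_cstar (@ec_rel E R[i]) f ->
     cstar_quotient (ec_comm f) q ->
     universal_completion j ->
     star_isomorphic O P).
Proof.
split=> [K c|R A f O q P j]; first exact: leavitt_ab_crossed.
exact: cstar_crossed.
Qed.
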